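(* Let $N\geq 3$. Let $p\in C^{0,\alpha}_{\rm loc}(\mathbb{R}^N)$ (for some $0<\alpha<1$) be non-negative, and let $f:[0,\infty)\to[0,\infty)$ be a non-decreasing function with $f\in C^{0,\alpha}_{\rm loc}[0,\infty)$, $f(0)=0$, $f>0$ on $(0,\infty)$, and $\Lambda:=\sup_{s\geq 1} f(s)/s<\infty$. For $r\geq0$ set $\varphi(r)=\max_{|x|=r}p(x)$, $\psi(r)=\min_{|x|=r}p(x)$, $h(r)=\varphi(r)-\psi(r)$, $\Lambda_N=\Lambda/(N-2)$ and $\Psi(r)=\exp\left(\Lambda_N\int_0^r s\psi(s)\,ds\right)$. Assume $$\int_0^\infty r\,h(r)\,\Psi(r)\,dr<\infty.$$ Then the problem $$\Delta u+|\nabla u|=p(x)f(u)\ \text{ in }\mathbb{R}^N,\qquad u\geq 0\ \text{ in }\mathbb{R}^N,$$ has a positive entire large solution (i.e. a positive solution with $u(x)\to\infty$ as $|x|\to\infty$) if and only if $$\int_1^\infty e^{-t}t^{1-N}\int_0^t e^s s^{N-1}\psi(s)\,ds\,dt=\infty.$$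
   Context: An entire large solution is a solution defined on all of $\mathbb{R}^N$ with $u(x)\to\infty$ as $|x|\to\infty$. *)

(* Defs.v *)
From HB Require Import structures.
From mathcomp Require Import all_boot all_order all_algebra.
From mathcomp Require Import all_classical all_reals all_analysis.
Set Implicit Arguments. Unset Strict Implicit. Unset Printing Implicit Defensive.
Import Order.TTheory GRing.Theory Num.Theory.
Import numFieldNormedType.Exports.
Local Open Scope classical_set_scope.
Local Open Scope ring_scope.

Definition enorm {R : realType} {N : nat} (x : 'rV[R]_N) : R :=
  Num.sqrt (\sum_(i < N) (x 0 i) ^+ 2).

Definition ebasis {R : realType} {N : nat} (i : 'I_N) : 'rV[R]_N := delta_mx 0 i.

Definition partial {R : realType} {N : nat} (i : 'I_N) (u : 'rV[R]_N -> R)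
  : 'rV[R]_N -> R := fun x => derive u x (ebasis i).

Definition C2 {R : realType} {N : nat} (u : 'rV[R]_N -> R) : Prop :=
  continuous u /\
  (forall i x, derivable u x (ebasis i)) /\
  (forall i, continuous (partial i u)) /\
  (forall i j x, derivable (partial i u) x (ebasis j)) /\
  (forall i j, continuous (partial j (partial i u))).

Definition laplacian {R : realType} {N : nat} (u : 'rV[R]_N -> R) (x : 'rV[R]_N) : R :=
  \sum_(i < N) partial i (partial i u) x.

Definition grad_norm {R : realType} {N : nat} (u : 'rV[R]_N -> R) (x : 'rV[R]_N) : R :=
  Num.sqrt (\sum_(i < N) (partial i u x) ^+ 2).

Definition loc_holder_on {R : realType} {N : nat} (alpha : R) (D : set 'rV[R]_N)
  (g : 'rV[R]_N -> R) : Prop :=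
  forall r : R, 0 < r -> exists C : R, forall x y, D x -> D y ->
    enorm x <= r -> enorm y <= r ->
    `|g x - g y| <= C * powR (enorm (x - y)) alpha.

Definition loc_holder_halfline {R : realType} (alpha : R) (g : R -> R) : Prop :=
  forall r : R, 0 < r -> exists C : R, forall s t, 0 <= s -> 0 <= t ->
    s <= r -> t <= r -> `|g s - g t| <= C * powR `|s - t| alpha.

Definition sphere {R : realType} {N : nat} (r : R) : set 'rV[R]_N :=
  [set x | enorm x = r].

Definition phi_max {R : realType} {N : nat} (p : 'rV[R]_N -> R) (r : R) : R :=
  sup (p @` sphere r).
Definition psi_min {R : realType} {N : nat} (p : 'rV[R]_N -> R) (r : R) : R :=
  inf (p @` sphere r).

Definition Lambda_of {R : realType} (f : R -> R) : R :=
  sup [set f s / s | s in [set s : R | 1 <= s]].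

Definition Psi_of {R : realType} (N : nat) (f : R -> R) (psi : R -> R) (r : R) : R :=
  expR ((Lambda_of f / (N%:R - 2)) *
        Rintegral lebesgue_measure `[0, r] (fun s => s * psi s)).

Definition pos_entire_large_solution {R : realType} {N : nat}
  (p : 'rV[R]_N -> R) (f : R -> R) (u : 'rV[R]_N -> R) : Prop :=
  C2 u /\
  (forall x, laplacian u x + grad_norm u x = p x * f (u x)) /\
  (forall x, 0 < u x) /\
  (forall M : R, exists R0 : R, forall x, R0 < enorm x -> M < u x).

(* Main.v *)
(* The operator [Lap u + |grad u|] has a monotone finite difference scheme, and radial functions
   reduce it to [r^(1-N) e^(-r) (r^(N-1) e^r G')'], which is solved by [pot].

   Necessity.  If the integral is finite, the potential [pot q] of [q = Lambda phi + e^(-r)] is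
   bounded, because [(N - 2) pot q <= int s q]; so [(1 + u) / exp (pot q)] has a minimum for a
   large solution [u].  There [p f(u) >= (1 + u) q > (1 + u) Lambda phi >= p f(u)].

   Sufficiency.  Let [v] solve the radial equation with [phi] in place of [p].  Since
   [f(v) <= Lambda v <= Lambda exp (Lambda pot phi) <= C Psi], the potential of [(phi - psi) f(v)]
   is bounded, so adding a constant to the potential of [psi f(v)] gives a supersolution above the
   subsolution [v], and [v] tends to infinity.  A solution between the two is a limit of discrete
   solutions.  Regularity comes from the gradient estimate alone: applied to differences of the
   discrete solution at longer and longer increments it bounds differences of high order of the
   gradient, and Marchaud's inequality brings the order down to two with a Dini modulus.  The
   limit is then C^2 and solves the equation by a touching argument in which the test function is
   the limit itself plus a small quadratic. *)
From HB Require Import structures.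
From mathcomp Require Import all_boot all_order all_algebra.
From mathcomp Require Import all_classical all_reals all_analysis.
From mathcomp Require Import measurable_realfun ring lra zify.
Require Import Defs.
Set Implicit Arguments. Unset Strict Implicit. Unset Printing Implicit Defensive.
Import Order.TTheory GRing.Theory Num.Theory.
Import numFieldNormedType.Exports.
Local Open Scope classical_set_scope.
Local Open Scope ring_scope.

(** * The monotone scheme on the lattice *)

(** The scheme is monotone because the gradient norm, taken with central differences, carries the
    weight [h / 2], far below the weight 1 of the neighbours in the Laplacian. Comparison for it
    controls first differences only: if [|u| <= M] and the operator is bounded by [K] on a cube of
    radius [r], the gradient is of size [M / r + K * r]. Everything about second derivatives has to
    be drawn from this one bound. For increments of length [s ^+ (2 * q)] and radius
    [s ^+ (2 * q).-1], each further difference makes the first term smaller by a factor [s], until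
    the source term takes over. With [q * alpha >= 1] the Hoelder right-hand side changes by order
    [s ^+ 2], so the gain continues up to order 2q + 1; for an increment [t] it then reads t^(1 +
    1/(2q)). The excess over [t] is what makes the sums over dyadic scales converge. As [f] is only
    assumed Hoelder and non-decreasing, every lattice comparison is run with a strict margin: part
    of the curvature of the barrier in the gradient estimate, part of the gap between the two sides
    in the touching argument. The dimension enters through [N - 2 > 0], which bounds a potential by
    the integral of [s * q s]. *)

Lemma eq_ler (R : realType) (x y : R) : x = y -> x <= y.
Proof. by move->. Qed.

Section EuclideanNorm.
Context {R : realType} {N : nat}.
Implicit Types a b : 'I_N -> R.

Definition l2norm a : R := Num.sqrt (\sum_i a i ^+ 2).

Lemma sum_sqr_ge0 a : 0 <= \sum_i a i ^+ 2.
Proof. by apply: sumr_ge0 => i _; exact: sqr_ge0. Qed.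

Lemma l2norm_ge0 a : 0 <= l2norm a.
Proof. exact: sqrtr_ge0. Qed.

Lemma sqr_l2norm a : l2norm a ^+ 2 = \sum_i a i ^+ 2.
Proof. by rewrite sqr_sqrtr// sum_sqr_ge0. Qed.

Lemma l2norm_le_sqr a c : 0 <= c -> \sum_i a i ^+ 2 <= c ^+ 2 -> l2norm a <= c.
Proof.
by move=> c0 h; rewrite /l2norm -[leRHS]ger0_norm// -sqrtr_sqr ler_wsqrtr.
Qed.

Lemma coord_le_l2norm a i : `|a i| <= l2norm a.
Proof.
rewrite -sqrtr_sqr ler_wsqrtr// (bigD1 i)//= lerDl.
by apply: sumr_ge0 => j _; exact: sqr_ge0.
Qed.

Lemma cauchy_schwarz a b : \sum_i a i * b i <= l2norm a * l2norm b.
Proof.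
set A := l2norm a; set B := l2norm b.
have A0 : 0 <= A := l2norm_ge0 a.
have B0 : 0 <= B := l2norm_ge0 b.
have [AB0|AB] := eqVneq (A * B) 0.
  rewrite AB0.
  suff H : forall i, a i * b i = 0 by rewrite big1.
  move=> i; move/eqP: AB0; rewrite mulf_eq0 => /orP[] /eqP h.
    by have := coord_le_l2norm a i; rewrite -/A h normr_le0 => /eqP ->; rewrite mul0r.
  by have := coord_le_l2norm b i; rewrite -/B h normr_le0 => /eqP ->; rewrite mulr0.
have AB_gt0 : 0 < A * B by rewrite lt_neqAle eq_sym AB mulr_ge0.
have : 0 <= \sum_i (B * a i - A * b i) ^+ 2 := sum_sqr_ge0 (fun i => B * a i - A * b i).
have -> : \sum_i (B * a i - A * b i) ^+ 2 = B ^+ 2 * A ^+ 2 + A ^+ 2 * B ^+ 2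
     - 2 * (A * B) * \sum_i a i * b i.
  rewrite [in X in X + _ - _](sqr_l2norm a) [in X in _ + X - _](sqr_l2norm b).
  rewrite !mulr_sumr -big_split -sumrB /=; apply: eq_bigr => i _; ring.
have -> : B ^+ 2 * A ^+ 2 + A ^+ 2 * B ^+ 2 - 2 * (A * B) * \sum_i a i * b i
   = 2 * (A * B) * (A * B - \sum_i a i * b i) by ring.
rewrite pmulr_rge0; first by rewrite subr_ge0.
by rewrite mulr_gt0.
Qed.

Lemma l2norm_triangle a b : l2norm (fun i => a i + b i) <= l2norm a + l2norm b.
Proof.
apply: l2norm_le_sqr; first by rewrite addr_ge0// l2norm_ge0.
rewrite sqrrD !sqr_l2norm.
under eq_bigr do rewrite sqrrD.
rewrite !big_split/= lerD2r lerD2l mulr2n.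
by rewrite lerD// cauchy_schwarz.
Qed.

Lemma l2normN a : l2norm (fun i => - a i) = l2norm a.
Proof. by congr (Num.sqrt _); apply: eq_bigr => i _; rewrite sqrrN. Qed.

Lemma l2normZ c a : l2norm (fun i => c * a i) = `|c| * l2norm a.
Proof.
rewrite /l2norm; under eq_bigr do rewrite exprMn.
by rewrite -mulr_sumr sqrtrM ?sqr_ge0// sqrtr_sqr.
Qed.

Lemma eq_l2norm a b : a =1 b -> l2norm a = l2norm b.
Proof. by move=> ab; congr (Num.sqrt _); apply: eq_bigr => i _; rewrite ab. Qed.

Lemma l2norm_lip a b : `|l2norm a - l2norm b| <= l2norm (fun i => a i - b i).
Proof.
have H c d : l2norm c - l2norm d <= l2norm (fun i => c i - d i).
  rewrite lerBlDr; apply: le_trans (l2norm_triangle _ _).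
  by rewrite (@eq_l2norm c (fun i => c i - d i + d i))// => i; rewrite subrK.
rewrite ler_norml H andbT lerNl opprB.
rewrite -(l2normN (fun i => a i - b i)).
by apply: le_trans (H _ _) _; rewrite (@eq_l2norm _ (fun i => - (a i - b i)))// => i; rewrite opprB.
Qed.

Lemma l2norm_le_sum a : l2norm a <= \sum_i `|a i|.
Proof.
apply: l2norm_le_sqr; first by apply: sumr_ge0.
rewrite [leRHS]expr2 mulr_suml; apply: ler_sum => i _.
rewrite -real_normK ?num_real// expr2 ler_wpM2l//.
by rewrite (bigD1 i)//= lerDl; apply: sumr_ge0.
Qed.

Lemma l2norm_le_max a c : (forall i, `|a i| <= c) -> l2norm a <= N%:R * c.
Proof.
move=> h; apply: le_trans (l2norm_le_sum a) _.
rewrite mulr_natl -[in leRHS](card_ord N) -sumr_const.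
by apply: ler_sum => i _; exact: h.
Qed.

End EuclideanNorm.

Section Lattice.
Context {R : realType} {N : nat}.
Local Notation lat := 'rV[int]_N.
Implicit Types (z u v : lat -> R) (x y : lat) (i j : 'I_N).

Definition ee i : lat := delta_mx 0 i.

(** Over an arbitrary abelian group, because the same difference calculus is used on the lattice
    and, after the passage to the limit, on the Euclidean space. *)
Definition fdiff {V : zmodType} (a : V) (w : V -> R) : V -> R :=
  fun t : V => w (t + a) - w t.

Definition dlap z x : R := \sum_i (z (x + ee i) + z (x - ee i) - 2 * z x).

Definition dgrad z x : R := l2norm (fun i => z (x + ee i) - z (x - ee i)).

(** At mesh [h], [dlap] approximates [h ^+ 2] times the Laplacian and [dgrad] approximates [2 * h]
    times the gradient norm. The operator of the equation, multiplied by [h ^+ 2], therefore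
    corresponds to [tau = h / 2]. *)
Definition dop (tau : R) z x : R := dlap z x + tau * dgrad z x.

Lemma dlapE z x :
  dlap z x = \sum_i (z (x + ee i) + z (x - ee i)) - 2 * N%:R * z x.
Proof.
rewrite /dlap big_split/= sumrN; congr (_ - _).
by rewrite sumr_const card_ord -[in RHS]mulrA (mulrC N%:R) mulrA mulr_natr.
Qed.

Lemma dlapB u v x : dlap (fun k => u k - v k) x = dlap u x - dlap v x.
Proof. by rewrite /dlap -sumrB; apply: eq_bigr => i _; ring. Qed.

Lemma dlapZ c v x : dlap (fun k => c * v k) x = c * dlap v x.
Proof. by rewrite /dlap mulr_sumr; apply: eq_bigr => i _; ring. Qed.

Lemma dlap_shift v y x : dlap (fun k => v (k + y)) x = dlap v (x + y).
Proof. by rewrite /dlap; apply: eq_bigr => i _; rewrite (addrAC x (ee i)) (addrAC x (- ee i)). Qed.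

Lemma dgrad_shift v y x : dgrad (fun k => v (k + y)) x = dgrad v (x + y).
Proof. by rewrite /dgrad; apply: eq_l2norm => i; rewrite (addrAC x (ee i)) (addrAC x (- ee i)). Qed.

Lemma dlap_fdiff y v x : dlap (fdiff y v) x = fdiff y (dlap v) x.
Proof. by rewrite /fdiff dlapB dlap_shift. Qed.

(** Each neighbouring value enters [dlap] with weight 1, while the norm changes by at most the sum
    of the changes of its entries; for [tau <= 1] the Laplacian absorbs the gradient term. The value
    at the centre occurs only in [dlap], with the coefficient that is added back on both sides. *)
Lemma dop_mono tau u v x : 0 <= tau <= 1 ->
  (forall i, u (x + ee i) <= v (x + ee i)) ->
  (forall i, u (x - ee i) <= v (x - ee i)) ->
  dop tau u x + 2 * N%:R * u x <= dop tau v x + 2 * N%:R * v x.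
Proof.
move=> /andP[t0 t1] hp hm; rewrite /dop !dlapE.
suff : tau * (dgrad u x - dgrad v x) <=
   \sum_i (v (x + ee i) + v (x - ee i)) - \sum_i (u (x + ee i) + u (x - ee i)).
  rewrite mulrBr; lra.
apply: (@le_trans _ _ (\sum_i `|(u (x + ee i) - u (x - ee i)) - (v (x + ee i) - v (x - ee i))|)).
  apply: (@le_trans _ _ (tau * l2norm (fun i => (u (x + ee i) - u (x - ee i)) - (v (x + ee i) - v (x - ee i))))).
    rewrite ler_wpM2l//; apply: le_trans (ler_norm _) _; exact: l2norm_lip.
  apply: le_trans (l2norm_le_sum _).
  by rewrite ler_piMl// l2norm_ge0.
rewrite -sumrB; apply: ler_sum => i _.
rewrite ler_norml; have := hp i; have := hm i => h1 h2; apply/andP; split; lra.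
Qed.

Lemma dop_addc tau v c x : dop tau (fun k => v k + c) x = dop tau v x.
Proof.
rewrite /dop; congr (_ + _ * _); first by rewrite /dlap; apply: eq_bigr => i _; ring.
by rewrite /dgrad; apply: eq_l2norm => i; ring.
Qed.

(* No attainment is needed: strictness by a uniform kappa lets a near-supremum do the work of a maximum. *)
Lemma discrete_comparison (D : lat -> Prop) tau u v c B kappa :
  0 <= tau <= 1 -> 0 < kappa ->
  (forall x, D x -> u x - v x <= B) ->
  (forall x, D x -> dop tau v x + kappa <= dop tau u x) ->
  (forall x y, D x -> c < u x - v x -> ~ D y ->
     (exists i, y = x + ee i \/ y = x - ee i) -> u y - v y <= c) ->
  forall x, D x -> u x - v x <= c.
Proof.
move=> tau01 k0 uB hop hbd x0 Dx0; rewrite leNgt; apply/negP => cx0.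
pose S : set R := [set u x - v x | x in [set x | D x]].
have S0 : has_sup S.
  split; first by exists (u x0 - v x0), x0.
  by exists B => _ [x Dx <-]; exact: uB.
set m := sup S.
have ubm x : D x -> u x - v x <= m by move=> Dx; apply: ub_le_sup; [exact: S0.2 | exists x].
have cm : c < m by apply: lt_le_trans cx0 (ubm _ Dx0).
(* The first entry puts a near-maximum above the level [c], where the boundary hypothesis applies.
   The second makes the defect [2 * N%:R * eps], caused by the supremum not being attained, smaller
   than [kappa]. *)
pose eps := Num.min (m - c) (kappa / (2 * N%:R + 1)).
have N0 : 0 <= N%:R :> R by [].
have eps0 : 0 < eps.
  rewrite lt_min subr_gt0 cm/= divr_gt0//; lra.
have [_ [x Dx <-] hx] := sup_adherent eps0 S0.
rewrite -/m in hx.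
have epsc : eps <= m - c by rewrite ge_min lexx.
have epsk : (2 * N%:R + 1) * eps <= kappa.
  rewrite -ler_pdivlMl; last by lra.
  by rewrite ge_min mulrC lexx orbT.
have cx : c < u x - v x by lra.
have nb y : (exists i, y = x + ee i \/ y = x - ee i) -> u y <= v y + m.
  move=> hy; have [Dy|nDy] := pselect (D y).
    by have := ubm _ Dy; lra.
  by have := hbd _ _ Dx cx nDy hy; lra.
have /= := @dop_mono tau u (fun k => v k + m) x tau01
  (fun i => nb _ (ex_intro _ i (or_introl erefl)))
  (fun i => nb _ (ex_intro _ i (or_intror erefl))).
rewrite dop_addc => h1; have h2 := hop _ Dx.
have h3 : 2 * N%:R * (v x + m - u x) <= 2 * N%:R * eps.
  by rewrite ler_wpM2l//; lra.
have : 2 * N%:R * (v x + m - u x) = 2 * N%:R * (v x + m) - 2 * N%:R * u x by ring.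
lra.
Qed.

End Lattice.

(** * Interior gradient estimate *)

Section GradientEstimate.
Context {R : realType} {N : nat}.
Local Notation lat := 'rV[int]_N.
Implicit Types (z u v : lat -> R) (x y : lat) (i j : 'I_N).

Lemma eeE i j : (ee i : lat) 0 j = (j == i)%:R.
Proof. by rewrite mxE. Qed.

(** Reflection in the hyperplane where coordinate [i] equals 1/2: it passes halfway between [0] and
    [ee i], so no lattice point lies on the mirror. *)
Definition rho i x : lat := x + (1 - 2 * x 0 i) *: ee i.

Lemma rhoE i x j : rho i x 0 j = if j == i then 1 - x 0 i else x 0 j.
Proof. by rewrite !mxE/=; case: eqP => [->|_]/=; ring. Qed.

Lemma rhoK i : involutive (rho i).
Proof.
move=> x; apply/rowP => j; rewrite !rhoE eqxx; case: eqP => // ->.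
by ring.
Qed.

Lemma rhoD i x j :
  rho i (x + ee j) = if j == i then rho i x - ee j else rho i x + ee j.
Proof.
apply/rowP => k; case: (eqVneq j i) => [->|ji]; rewrite rhoE !mxE/= ?eqxx.
  by case: (eqVneq k i) => [->|ki]/=; ring.
by rewrite (eq_sym i j) (negPf ji)/= ; case: (eqVneq k i) => [->|ki]/=; rewrite ?(eq_sym i j) ?(negPf ji)/=; ring.
Qed.

Lemma rhoB i x j :
  rho i (x - ee j) = if j == i then rho i x + ee j else rho i x - ee j.
Proof.
have h := rhoD i (x - ee j) j; rewrite subrK in h.
by move: h; case: eqP => _ ->; rewrite ?subrK ?addrK.
Qed.

Lemma dlap_rho i u x : dlap (fun k => u (rho i k)) x = dlap u (rho i x).
Proof.
rewrite /dlap; apply: eq_bigr => j _; rewrite rhoD rhoB.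
by case: eqP => _; congr (_ - _); rewrite addrC.
Qed.

(** The reflection reverses the sign of one central difference, which the norm does not see; what
    remains is the triangle inequality. *)
Lemma dgrad_rho_lip i u x :
  `|dgrad u x - dgrad u (rho i x)| <= dgrad (fun k => u k - u (rho i k)) x.
Proof.
pose b j := u (rho i (x + ee j)) - u (rho i (x - ee j)).
have -> : dgrad u (rho i x) = l2norm b.
  rewrite /dgrad /l2norm; congr (Num.sqrt _); apply: eq_bigr => j _.
  by rewrite /b rhoD rhoB; case: eqP => _ //; rewrite -[in RHS]opprB sqrrN.
apply: le_trans (l2norm_lip _ _) _.
by apply: eq_ler; apply: eq_l2norm => j; rewrite /b; ring.
Qed.

(** Barriers are taken as sums of functions of one coordinate, so that their lattice differences
    reduce to differences in one variable. *)
Definition separable (c : 'I_N -> R -> R) x : R := \sum_j c j (x 0 j)%:~R.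

Lemma separableD c x j :
  separable c (x + ee j) = separable c x + (c j ((x 0 j)%:~R + 1) - c j (x 0 j)%:~R).
Proof.
rewrite /separable (bigD1 j)//= [in RHS](bigD1 j)//= !mxE !eqxx/= intrD.
rewrite (eq_bigr (fun k => c k (x 0 k)%:~R)); first by ring.
by move=> k kj; rewrite !mxE/= (negPf kj) addr0.
Qed.

Lemma separableB c x j :
  separable c (x - ee j) = separable c x + (c j ((x 0 j)%:~R - 1) - c j (x 0 j)%:~R).
Proof.
have := separableD c (x - ee j) j; rewrite subrK !mxE !eqxx/= intrB subrK => ->.
by ring.
Qed.

Lemma dlap_separable c x : dlap (separable c) x =
  \sum_j (c j ((x 0 j)%:~R + 1) + c j ((x 0 j)%:~R - 1) - 2 * c j (x 0 j)%:~R).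
Proof. by apply: eq_bigr => j _; rewrite separableD separableB; ring. Qed.

Lemma dgrad_separable c x : dgrad (separable c) x =
  l2norm (fun j => c j ((x 0 j)%:~R + 1) - c j ((x 0 j)%:~R - 1)).
Proof. by apply: eq_l2norm => j; rewrite separableD separableB; ring. Qed.

Definition incube (c : lat) (n : int) x := forall j, `|x 0 j - c 0 j| <= n.

Section Barrier.
Variables (i : 'I_N) (n : nat) (M K tau : R).
Hypotheses (n0 : (0 < n)%N) (M0 : 0 < M) (K0 : 0 <= K)
  (tau01 : 0 <= tau <= 1) (taun : tau * n%:R <= 12^-1).

(** The barrier is [alp * t - kap * t ^+ 2] in the distance [t] to the mirror, plus [mu * s ^+ 2] in
    each other coordinate. [mu] makes it reach [M] on the lateral faces, [alp] on the face opposite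
    the mirror, and [kap] pays for [K] and for the gradient term. The constant [kap / 4] makes the
    values of [c i] at 0 and 1 opposite. *)
Let mu := M / n%:R ^+ 2.
Let kap := K + 3 * N%:R * mu.
Let alp := 2 * M / n%:R + kap * n%:R.
Let c j (s : R) : R := if j == i then alp * (s - 2^-1) - kap * (s - 2^-1) ^+ 2 + kap / 4
                       else mu * s ^+ 2.
Let psi := separable c.

Let nR : 0 < n%:R :> R. Proof. by rewrite ltr0n. Qed.
Let n1 : 1 <= n%:R :> R. Proof. by rewrite ler1n. Qed.
Let NR : 1 <= N%:R :> R.
Proof. by rewrite ler1n; apply: leq_ltn_trans (ltn_ord i). Qed.
Let mu0 : 0 < mu. Proof. by rewrite divr_gt0// exprn_gt0. Qed.
Let muM : mu * n%:R ^+ 2 = M.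
Proof. by rewrite /mu divfK// expf_neq0// gt_eqF. Qed.
Let kap0 : 0 < kap.
Proof. by rewrite ltr_wpDl// mulr_gt0// mulr_gt0//; have := NR; lra. Qed.
Let alpE : alp = 2 * mu * n%:R + kap * n%:R.
Proof.
rewrite /alp; congr (_ + _); rewrite -mulrA -[RHS]mulrA; congr (2 * _).
by rewrite -muM expr2 mulrA mulfK// gt_eqF.
Qed.

Let ci_ge (s : R) : 1 <= s -> s <= n%:R -> mu * n%:R * s <= c i s.
Proof.
move=> s1 sn; rewrite /c eqxx alpE.
have h1 : 0 <= mu * n%:R * (s - 1) by rewrite !mulr_ge0 ?subr_ge0// ltW.
have h2 : 0 <= kap * ((s - 2^-1) * (n%:R - (s - 2^-1))).
  by rewrite mulr_ge0 ?mulr_ge0//; [exact: ltW|lra|lra].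
have := kap0; nra.
Qed.

Let c_ge0 j (s : R) : (j = i -> 1 <= s /\ s <= n%:R) -> 0 <= c j s.
Proof.
case: (eqVneq j i) => [-> /(_ erefl)[s1 sn]|ji _].
  apply: le_trans (ci_ge s1 sn).
  by rewrite !mulr_ge0//; [exact: ltW|lra].
by rewrite /c (negPf ji) mulr_ge0 ?sqr_ge0// ltW.
Qed.

Let coordR (m : nat) x j : `|x 0 j| <= m%:Z -> `|(x 0 j)%:~R : R| <= m%:R.
Proof. by rewrite -intr_norm -[m%:R]/(m%:Z%:~R) ler_int. Qed.

Let psi_ge0 x : (1 <= x 0 i) -> (forall j, `|x 0 j| <= n%:Z) -> 0 <= psi x.
Proof.
move=> xi xn; apply: sumr_ge0 => j _; apply: c_ge0 => ->; split.
  by rewrite -[1]/(1%:~R) ler_int.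
by have := coordR (xn i); rewrite ler_norml => /andP[].
Qed.

Let psi_geM x j : (1 <= x 0 i) -> (forall j, `|x 0 j| <= n%:Z) -> `|x 0 j| = n%:Z ->
  M <= psi x.
Proof.
move=> xi xn xj.
apply: (@le_trans _ _ (c j (x 0 j)%:~R)); last first.
  rewrite /psi /separable (bigD1 j)//= lerDl; apply: sumr_ge0 => k _.
  apply: c_ge0 => ->; split; first by rewrite -[1]/(1%:~R) ler_int.
  by have := coordR (xn i); rewrite ler_norml => /andP[].
have xjR : `|(x 0 j)%:~R : R| = n%:R by rewrite -intr_norm xj.
case: (eqVneq j i) => [ji|ji].
  subst j; have xiE : (x 0 i)%:~R = n%:R :> R.
    by rewrite -xjR ger0_norm// ler0z (le_trans ler01 xi).
  by rewrite xiE -{1}muM expr2 mulrA ci_ge.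
by rewrite /c (negPf ji) -(real_normK (num_real (x 0 j)%:~R)) xjR muM.
Qed.

(** The second differences give at most [2 * N%:R * mu - 2 * kap]. By [taun] the gradient term costs
    at most a twelfth of [4 * N%:R * mu + 10 * kap], so [7 / 6 * kap] survives; its share
    [7 / 2 * N%:R * mu] exceeds the [10 / 3 * N%:R * mu] to be paid, margin included. This fixes the
    constants 3 and 1/12. *)
Let dop_psi x : (forall j, `|x 0 j| <= n%:Z) ->
  dop tau psi x + N%:R * mu <= - K.
Proof.
move=> xn; rewrite /dop.
have h1 : dlap psi x <= 2 * N%:R * mu - 2 * kap.
  rewrite dlap_separable (bigD1 i)//= /c eqxx.
  rewrite (eq_bigr (fun j => 2 * mu)); last first.
    by move=> j ji; rewrite (negPf ji); ring.
  have : \sum_(j < N | j != i) 2 * mu <= 2 * N%:R * mu.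
    apply: (@le_trans _ _ (\sum_(j < N) 2 * mu)).
      rewrite [leRHS](bigD1 i)//= lerDr; have := mu0; lra.
    by rewrite sumr_const card_ord -mulr_natl; apply: eq_ler; ring.
  set S := \sum_(_ < _ | _) _ => hS.
  set t := (x 0 i)%:~R : R.
  have -> : alp * (t + 1 - 2^-1) - kap * (t + 1 - 2^-1) ^+ 2 + kap / 4 +
   (alp * (t - 1 - 2^-1) - kap * (t - 1 - 2^-1) ^+ 2 + kap / 4) -
   2 * (alp * (t - 2^-1) - kap * (t - 2^-1) ^+ 2 + kap / 4) = - 2 * kap by field.
  lra.
have h2 : dgrad psi x <= 4 * N%:R * mu * n%:R + 10 * kap * n%:R.
  rewrite dgrad_separable; apply: le_trans (l2norm_le_sum _) _.
  rewrite (bigD1 i)//= {1 2}/c eqxx.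
  have hj : \sum_(j < N | j != i) `|c j ((x 0 j)%:~R + 1) - c j ((x 0 j)%:~R - 1)|
     <= \sum_(j < N | j != i) (4 * mu * n%:R).
    apply: ler_sum => j ji; rewrite /c (negPf ji).
    have -> : mu * ((x 0 j)%:~R + 1) ^+ 2 - mu * ((x 0 j)%:~R - 1) ^+ 2 = 4 * mu * (x 0 j)%:~R by ring.
    by rewrite normrM ger0_norm ?mulr_ge0// ?ler_wpM2l ?mulr_ge0 ?coordR// ltW.
  have hi : `|alp * ((x 0 i)%:~R + 1 - 2^-1) - kap * ((x 0 i)%:~R + 1 - 2^-1) ^+ 2 + kap / 4 -
    (alp * ((x 0 i)%:~R - 1 - 2^-1) - kap * ((x 0 i)%:~R - 1 - 2^-1) ^+ 2 + kap / 4)|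
     <= 4 * mu * n%:R + 10 * kap * n%:R.
    set t := (x 0 i)%:~R : R.
    have -> : alp * (t + 1 - 2^-1) - kap * (t + 1 - 2^-1) ^+ 2 + kap / 4 -
      (alp * (t - 1 - 2^-1) - kap * (t - 1 - 2^-1) ^+ 2 + kap / 4) =
      2 * alp + - 4 * kap * (t - 2^-1) by field.
    have ht : `|t - 2^-1| <= 2 * n%:R.
      apply: le_trans (ler_normB _ _) _; rewrite (ger0_norm (_ : 0 <= 2^-1))//.
      have := coordR (xn i); rewrite -/t; have := n1; lra.
    apply: le_trans (ler_normD _ _) _; rewrite !normrM.
    rewrite normrN (ger0_norm (_ : 0 <= 2))// (ger0_norm (_ : 0 <= 4))//.
    rewrite (gtr0_norm kap0) (ger0_norm (_ : 0 <= alp)); last first.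
      by rewrite alpE addr_ge0 ?mulr_ge0// ltW.
    have h3 : 4 * kap * `|t - 2^-1| <= 4 * kap * (2 * n%:R).
      by rewrite ler_wpM2l// mulr_ge0// ltW.
    rewrite alpE; lra.
  have : \sum_(j < N | j != i) (4 * mu * n%:R) + 4 * mu * n%:R = 4 * N%:R * mu * n%:R.
    rewrite addrC -(bigD1 i (P := xpredT) (F := fun=> 4 * mu * n%:R))//=.
    by rewrite sumr_const card_ord -mulr_natl; ring.
  lra.
have /andP[t0 t1] := tau01; have NR1 := NR; have n11 := n1.
have h4 : tau * dgrad psi x <= 12^-1 * (4 * N%:R * mu + 10 * kap).
  apply: (@le_trans _ _ (tau * n%:R * (4 * N%:R * mu + 10 * kap))).
    rewrite -[leRHS]mulrA ler_wpM2l//; apply: le_trans h2 _; apply: eq_ler; ring.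
  by rewrite ler_wpM2r// addr_ge0// ?mulr_ge0// ltW//.
have kE : kap = K + 3 * (N%:R * mu) by rewrite /kap; ring.
have Nmu : 0 < N%:R * mu by rewrite mulr_gt0//; exact: lt_le_trans ltr01 NR1.
move: h1 h4 kE Nmu K0; rewrite -!mulrA.
move: (dlap psi x) (tau * dgrad psi x) (N%:R * mu) => A B C.
by move: kap => k; lra.
Qed.

(** Comparison with the barrier on the half cube beyond the mirror. On the outer faces the barrier
    is at least [M]; across the mirror the oddness of [phi] replaces a boundary condition. The bound
    comes from [alp / 2], the value of the barrier at [ee i]. *)
Lemma odd_barrier phi :
  (forall x, phi (rho i x) = - phi x) ->
  (forall x, 0 <= x 0 i -> (forall j, `|x 0 j| <= n%:Z) -> phi x <= M) ->
  (forall x, 1 <= x 0 i -> (forall j, `|x 0 j| < n%:Z) -> - K <= dop tau phi x) ->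
  phi (ee i) <= (3 * N%:R + 1) * M / n%:R + K * n%:R / 2.
Proof.
move=> odd phiM phiK.
have NR1 := NR; have n11 := n1.
pose D x := 1 <= x 0 i /\ forall j, `|x 0 j| < n%:Z.
(* For [n = 1] the point [ee i] is on the boundary of the cube, outside [D], and the bound [M] is
   enough. *)
have [n2|n2] := leqP n 1.
  have -> : n = 1%N by apply/eqP; rewrite eqn_leq n2 n0.
  have h : phi (ee i) <= M.
    apply: phiM; first by rewrite eeE eqxx.
    by move=> j; rewrite eeE; case: (j == i).
  have h0 : 0 <= N%:R * M by rewrite mulr_ge0// ltW.
  have -> : (3 * N%:R + 1) * M / 1%:R + K * 1%:R / 2 = 3 * (N%:R * M) + M + K / 2 by field.
  by move: h h0 K0; move: (phi _) (N%:R * M) => A B; lra.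
have hpsi : psi (ee i) = alp / 2.
  rewrite /psi /separable (bigD1 i)//= eeE eqxx big1; last first.
    by move=> j ji; rewrite eeE (negPf ji) /c (negPf ji) expr0n mulr0.
  by rewrite /c eqxx addr0/=; field.
have halp : alp / 2 <= (3 * N%:R + 1) * M / n%:R + K * n%:R / 2.
  have -> : (3 * N%:R + 1) * M / n%:R + K * n%:R / 2 = alp / 2 + 3 / 2 * (N%:R * mu * n%:R).
    rewrite alpE /kap -muM; field; exact: lt0r_neq0.
  by rewrite lerDl !mulr_ge0// ltW.
apply: le_trans halp; rewrite -hpsi -subr_le0.
apply: (@discrete_comparison _ _ D tau phi psi 0 M (N%:R * mu)) => //.
- by rewrite mulr_gt0//; lra.
- move=> x [x1 xn]; rewrite lerBlDr.
  apply: le_trans (phiM x (le_trans ler01 x1) _) _; first by move=> j; rewrite ltW.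
  by rewrite lerDl psi_ge0// => j; rewrite ltW.
- move=> x [x1 xn]; apply: le_trans (dop_psi _) (phiK _ x1 xn) => j.
  by rewrite ltW.
- move=> x y [x1 xn] px nDy hy.
  have yn : forall j, `|y 0 j| <= n%:Z.
    move=> j; case: hy => k [->|->]; rewrite !mxE/=; have := xn j;
    by case: (j == k) => /=; clear; lia.
  have [y1|y1] := leP 1 (y 0 i).
    rewrite subr_le0.
    have [j hj] : exists j, `|y 0 j| = n%:Z.
      apply: contrapT => h; apply: nDy; split=> // j.
      rewrite lt_neqAle yn andbT; apply/eqP => hj; apply: h; by exists j.
    by apply: le_trans (phiM _ _ yn) (psi_geM y1 yn hj); exact: le_trans ler01 y1.
  have [y0 yx] : y 0 i = 0 /\ y = x - ee i.
    case: hy => k [yE|yE]; move: y1; rewrite yE !mxE/=.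
      by case: (i == k) => /=; clear -x1; lia.
    by case: (eqVneq i k) => [<-|_]/=; [move=> h; split=> //; clear -x1 h; lia|clear -x1; lia].
  have xi1 : x 0 i = 1 by move: y0; rewrite yx !mxE !eqxx/=; clear; lia.
  have yrho : y = rho i x.
    apply/rowP => j; rewrite yx rhoE !mxE/=; case: (eqVneq j i) => [->|_]/=; clear -xi1; lia.
  (* Here [phi y = - phi x], so a nonnegative sum of the two barrier values turns a positive excess
     at [x] into a negative one at [y]. *)
  have : 0 <= psi x + psi y.
    rewrite yx {2}/psi separableB xi1 /c eqxx /psi /separable (bigD1 i)//= xi1 /c eqxx.
    set S := \sum_(_ < _ | _) _.
    have S0 : 0 <= S.
      by apply: sumr_ge0 => j ji; rewrite (negPf ji) mulr_ge0 ?sqr_ge0// ltW.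
    have -> : alp * (1%:~R - 2^-1) - kap * (1%:~R - 2^-1) ^+ 2 + kap / 4 + S +
      (alp * (1%:~R - 2^-1) - kap * (1%:~R - 2^-1) ^+ 2 + kap / 4 + S +
       (alp * (1%:~R - 1 - 2^-1) - kap * (1%:~R - 1 - 2^-1) ^+ 2 + kap / 4 -
       (alp * (1%:~R - 2^-1) - kap * (1%:~R - 2^-1) ^+ 2 + kap / 4))) = 2 * S by field.
    lra.
  have := odd x; rewrite -yrho => ->; lra.
- split; first by rewrite eeE eqxx.
  by move=> j; rewrite eeE; case: (j == i).
Qed.

End Barrier.

(* The part of [u] that is odd under the reflection exchanging [k0] and [k0 + ee i]
   vanishes on the mirror, so a quadratic barrier controls it next to the mirror. *)
Lemma gradient_estimate tau u k0 n M K i :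
  (0 < n)%N -> 0 < M -> 0 <= tau <= 1 -> tau * n%:R <= 12^-1 ->
  (forall x, incube k0 n%:Z x -> `|u x| <= M) ->
  (forall x, incube k0 n%:Z x -> `|dop tau u x| <= K) ->
  `|u (k0 + ee i) - u k0| <= (6 * N%:R + 2) * M / n%:R + K * n%:R.
Proof.
move=> n0 M0 tau01 taun uM uK.
have K0 : 0 <= K.
  apply: le_trans (uK k0 _); first exact: normr_ge0.
  by move=> j; rewrite subrr normr0.
pose w x := u (x + k0).
have inw x : (forall j, `|x 0 j| <= n%:Z) -> incube k0 n%:Z (x + k0).
  by move=> h j; rewrite mxE addrK.
have H s : s ^+ 2 = 1 -> s * (u (k0 + ee i) - u k0) <= (6 * N%:R + 2) * M / n%:R + K * n%:R.
  move=> s1; have sn : `|s| = 1.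
    by apply/eqP; rewrite -sqrp_eq1// real_normK ?num_real// s1.
  pose phi x := s / 2 * (w x - w (rho i x)).
  have /andP[t0 t1] := tau01.
  have rin x : 0 <= x 0 i -> (forall j, `|x 0 j| <= n%:Z) ->
     forall j, `|rho i x 0 j| <= n%:Z.
    move=> xi xn j; rewrite rhoE; case: eqP => // _; have := xn i; clear -xi n0; lia.
  have sle a b : `|a| <= b -> s * a <= b.
    by move=> ab; apply: le_trans (ler_norm _) _; rewrite normrM sn mul1r.
  have : phi (ee i) <= (3 * N%:R + 1) * M / n%:R + K * n%:R / 2.
    apply: (odd_barrier n0 M0 K0 tau01 taun).
    - by move=> x; rewrite /phi rhoK; ring.
    - move=> x xi xn; rewrite /phi mulrAC ler_pdivrMr//; apply: sle.
      apply: le_trans (ler_normB _ _) _; rewrite mulr_natr mulr2n lerD//.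
        by apply: uM; exact: inw.
      by apply: uM; apply: inw; exact: rin.
    - move=> x xi xn.
      have xn' j : `|x 0 j| <= n%:Z by rewrite ltW.
      have e1 : dlap phi x = s / 2 * (dlap w x - dlap w (rho i x)).
        by rewrite /phi dlapZ dlapB dlap_rho.
      have e2 : dgrad phi x = 2^-1 * dgrad (fun k => w k - w (rho i k)) x.
        rewrite -[2^-1]ger0_norm//; have -> : `|2^-1 : R| = `|s / 2|.
          by rewrite normrM sn mul1r.
        rewrite -l2normZ; apply: eq_l2norm => j; rewrite /phi; ring.
      have h1 := uK _ (inw _ xn').
      have h2 := uK _ (inw _ (rin _ (le_trans ler01 xi) xn')).
      have h3 := dgrad_rho_lip i w x.
      rewrite /dop -dlap_shift -dgrad_shift -/w in h1.
      rewrite /dop -(dlap_shift u k0 (rho i x)) -(dgrad_shift u k0 (rho i x)) -/w in h2.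
      rewrite /dop e1 e2 -lerN2 opprK.
      (* The gradient norm of the odd part enters with a plus sign and dominates the difference of
         the two gradient norms, whatever the sign [s]. Only the two operator values, each bounded
         by [K], are left. *)
      have -> : - (s / 2 * (dlap w x - dlap w (rho i x)) +
         tau * (2^-1 * dgrad (fun k => w k - w (rho i k)) x)) =
         (s * ((dlap w (rho i x) + tau * dgrad w (rho i x))
          - (dlap w x + tau * dgrad w x))
         + tau * (s * (dgrad w x - dgrad w (rho i x)) - dgrad (fun k => w k - w (rho i k)) x)) / 2.
        by field.
      rewrite ler_pdivrMr// -[leRHS]addr0 lerD//.
        apply: sle; apply: le_trans (ler_normB _ _) _.
        by rewrite mulr_natr mulr2n lerD.
      by rewrite mulr_ge0_le0// subr_le0 sle.
  have rho_ee : rho i (ee i) = 0.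
    by apply/rowP => j; rewrite rhoE !eeE eqxx !mxE; case: (j == i) => /=; rewrite ?subrr.
  rewrite /phi rho_ee /w add0r (addrC (ee i)).
  set A := _ * M / _; set B := u _ - u _.
  have -> : (6 * N%:R + 2) * M / n%:R = 2 * A by rewrite /A; ring.
  have -> : s / 2 * B = s * B / 2 by ring.
  lra.
rewrite ler_norml; apply/andP; split.
  by have := H (-1); rewrite sqrrN expr1n => /(_ erefl); rewrite mulN1r; lra.
by have := H 1; rewrite expr1n => /(_ erefl); rewrite mul1r.
Qed.

End GradientEstimate.

(** * Uniform estimates at small mesh *)

Section Embedding.
Context {R : realType} {N : nat}.
Local Notation lat := 'rV[int]_N.
Implicit Types (x y k : lat) (i j : 'I_N).

Definition at_mesh (h : R) k : 'rV[R]_N := \row_j (h * (k 0 j)%:~R).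

Definition box (rho h : R) (k : lat) := forall j, `|h * (k 0 j)%:~R| <= rho.

Lemma eeMnE i l j : (ee i *+ l : lat) 0 j = (l * (j == i))%N%:R.
Proof. by rewrite mulmxnE eeE mulnC natrM mulr_natr. Qed.

Lemma box_le rho rho' h k : rho <= rho' -> box rho h k -> box rho' h k.
Proof. by move=> rr bk j; apply: le_trans rr. Qed.

Lemma boxD rho r h k x : box rho h k ->
  (forall j, `|h * (x 0 j - k 0 j)%:~R| <= r) -> box (rho + r) h x.
Proof.
move=> bk xk j; have -> : h * (x 0 j)%:~R = h * (k 0 j)%:~R + h * (x 0 j - k 0 j)%:~R.
  by rewrite -mulrDr -intrD addrC subrK.
by apply: le_trans (ler_normD _ _) _; rewrite lerD.
Qed.

Lemma box_eeMn rho h k j l : 0 <= h -> box rho h k ->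
  box (rho + l%:R * h) h (k + ee j *+ l).
Proof.
move=> h0 bk; apply: (boxD bk) => j'; rewrite mxE addrAC subrr add0r eeMnE.
rewrite mulrz_nat ger0_norm ?mulr_ge0// mulrC ler_wpM2r// ler_nat.
by rewrite leq_pmulr// || (case: (j' == j); rewrite ?muln1// muln0).
Qed.

Lemma box_ee rho h k j : 0 <= h <= 1 -> box rho h k -> box (rho + 1) h (k + ee j).
Proof.
move=> /andP[h0 h1] bk; rewrite -[ee j]mulr1n; apply: box_le (box_eeMn j 1 h0 bk).
by rewrite lerD2l mul1r.
Qed.

Lemma boxBee rho h k j : 0 <= h <= 1 -> box rho h k -> box (rho + 1) h (k - ee j).
Proof.
move=> /andP[h0 h1] bk; apply: (boxD bk) => j'.
rewrite mxE addrAC subrr add0r mxE eeE.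
rewrite rmorphN/= mulrN normrN ger0_norm; last by rewrite mulr_ge0// ler0z; case: (_ == _).
by case: (_ == _); rewrite /= ?mulr1 ?mulr0.
Qed.

Lemma fdiff_path (z : lat -> R) x j l B :
  (forall m, (m < l)%N -> `|fdiff (ee j) z (x + ee j *+ m)| <= B) ->
  `|fdiff (ee j *+ l) z x| <= l%:R * B.
Proof.
elim: l => [_|l IH h]; first by rewrite /fdiff mulr0n addr0 subrr normr0 mul0r.
have -> : fdiff (ee j *+ l.+1) z x = fdiff (ee j *+ l) z x + fdiff (ee j) z (x + ee j *+ l).
  by rewrite /fdiff mulrSr addrA; ring.
rewrite -[l.+1]addn1 natrD mulrDl mul1r.
apply: le_trans (ler_normD _ _) _; rewrite lerD//; last exact: h.
by apply: IH => m ml; apply: h; rewrite ltnW.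
Qed.

Lemma fdiffC (V : zmodType) (a b : V) (w : V -> R) : fdiff a (fdiff b w) = fdiff b (fdiff a w).
Proof. by apply/funext => t; rewrite /fdiff (addrAC t b a); ring. Qed.

Lemma mesh_count (h r : R) : 0 < h -> h <= r ->
  exists n : nat, [/\ (0 < n)%N, n%:R * h <= r & r <= 2 * (n%:R * h)].
Proof.
move=> h0 hr; have rh : 0 <= r / h by rewrite divr_ge0 ?(ltW h0)// (le_trans _ hr) ?ltW.
have /andP[h1 h2] := truncn_itv rh.
exists (Num.truncn (r / h)); have n0 : (0 < Num.truncn (r / h))%N.
  by rewrite truncn_gt0 ler_pdivlMr// mul1r.
split=> //; first by rewrite -ler_pdivlMr.
have : r < (Num.truncn (r / h)).+1%:R * h by rewrite -ltr_pdivrMr.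
move: n0; rewrite -(ler1n R) => n1; rewrite -natr1 mulrDl mul1r.
have : h <= (Num.truncn (r / h))%:R * h by rewrite ler_peMl// ltW.
lra.
Qed.

(** The estimate on a cube of [n] cells with [n%:R * h] between [r / 2] and [r]; the factor 2 lost
    in this rounding turns [6 * N%:R + 2] into [12 * N%:R + 4]. *)
Lemma gradient_step tau (z : lat -> R) k h r M K i :
  0 < h -> h <= r -> 0 < M -> 0 <= tau <= 1 -> tau * r <= 12^-1 * h ->
  (forall x, (forall j, `|h * (x 0 j - k 0 j)%:~R| <= r) -> `|z x| <= M) ->
  (forall x, (forall j, `|h * (x 0 j - k 0 j)%:~R| <= r) -> `|dop tau z x| <= h ^+ 2 * K) ->
  `|fdiff (ee i) z k| <= h * ((12 * N%:R + 4) * M / r + K * r).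
Proof.
move=> h0 hr M0 tau01 taur zM zK.
have r0 : 0 < r by exact: lt_le_trans hr.
have [n [n0 nh rn]] := mesh_count h0 hr.
have nR : 0 < n%:R :> R by rewrite ltr0n.
have inr x : incube k n%:Z x -> forall j, `|h * (x 0 j - k 0 j)%:~R| <= r.
  move=> xn j; rewrite normrM (gtr0_norm h0) mulrC.
  apply: le_trans nh; rewrite ler_wpM2r ?(ltW h0)// -intr_norm.
  by rewrite -[n%:R]/(n%:Z%:~R) ler_int xn.
have taun : tau * n%:R <= 12^-1.
  rewrite -(ler_pM2r h0); apply: le_trans taur.
  by rewrite -mulrA ler_wpM2l//; case/andP: tau01.
have K0 : 0 <= K.
  have kk j : `|h * (k 0 j - k 0 j)%:~R| <= r by rewrite subrr mulr0 normr0 ltW.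
  by have := le_trans (normr_ge0 _) (zK k kk); rewrite pmulr_rge0// exprn_gt0.
have := gradient_estimate i n0 M0 tau01 taun (fun x hx => zM x (inr x hx)) (fun x hx => zK x (inr x hx)).
move=> /le_trans; apply.
rewrite mulrDr lerD//.
  have c0 : 0 <= (6 * N%:R + 2) * M by rewrite mulr_ge0 ?(ltW M0)// addr_ge0// mulr_ge0.
  rewrite ler_pdivrMr//.
  have -> : h * ((12 * N%:R + 4) * M / r) * n%:R = (6 * N%:R + 2) * M * (2 * (n%:R * h)) / r by ring.
  by rewrite ler_pdivlMr// ler_wpM2l.
have -> : h ^+ 2 * K * n%:R = h * (K * (n%:R * h)) by ring.
by rewrite ler_wpM2l ?(ltW h0)// ler_wpM2l.
Qed.

End Embedding.

Section UniformEstimates.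
Context {R : realType} {N : nat}.
Local Notation lat := 'rV[int]_N.
Variables (alpha : R) (p : 'rV[R]_N -> R) (f : R -> R) (h : nat -> R) (u : nat -> lat -> R).
Hypotheses (N0 : (0 < N)%N) (alpha0 : 0 < alpha) (p0 : forall x, 0 <= p x)
  (p_holder : loc_holder_on alpha setT p)
  (f_mono : forall s t : R, 0 <= s -> s <= t -> f s <= f t)
  (f_holder : loc_holder_halfline alpha f) (f0 : f 0 = 0)
  (h0 : forall n, 0 < h n) (hn : forall n, h n <= n.+1%:R^-1)
  (u0 : forall n k, box n%:R (h n) k -> 0 <= u n k)
  (u_bnd : forall rho : R, exists M : R, forall n k, rho <= n%:R -> box rho (h n) k -> u n k <= M)
  (u_eq : forall n k, box n%:R (h n) k ->
     dop (h n / 2) (u n) k = h n ^+ 2 * (p (at_mesh (h n) k) * f (u n k))).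

(** The threshold [n0] may depend on the box, since [u n] is known to solve the scheme only on
    [box n%:R (h n)]. *)
Definition locally_uniformly (Q : R -> nat -> lat -> Prop) :=
  forall rho : R, exists (C : R) (n0 : nat), 0 < C /\ forall n k, (n0 <= n)%N -> box rho (h n) k -> Q C n k.

Let h1 n : h n <= 1.
Proof. by apply: le_trans (hn n) _; rewrite invf_le1// ler1n. Qed.

Let h01 n : 0 <= h n <= 1. Proof. by rewrite (ltW (h0 n)) h1. Qed.

Let tau01 n : 0 <= h n / 2 <= 1.
Proof. have := h0 n; have := h1 n; lra. Qed.

Lemma nat_above (r : R) : exists n0 : nat, forall n, (n0 <= n)%N -> r <= n%:R.
Proof.
exists (Num.truncn r).+1 => n nr.
by rewrite (le_trans (ltW (real_truncnS_gt (num_real r))))// ler_nat.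
Qed.

Lemma enorm_at_mesh_le (r m : R) (k : lat) : box r m k -> enorm (at_mesh m k) <= N%:R * r.
Proof. by move=> bk; apply: l2norm_le_max => j; rewrite mxE. Qed.

Lemma at_meshD (m : R) (x y : lat) : at_mesh m (x + y) = at_mesh m x + at_mesh m y.
Proof. by apply/rowP => j; rewrite !mxE intrD mulrDr. Qed.

Lemma enorm_at_mesh_shift (m : R) (k : lat) j l : 0 <= m ->
  enorm (at_mesh m (k + ee j *+ l) - at_mesh m k) = l%:R * m.
Proof.
move=> m0; rewrite at_meshD addrC addKr /enorm (bigD1 j)//= big1 ?addr0.
  rewrite mxE eeMnE eqxx muln1 mulrz_nat.
  by rewrite sqrtr_sqr ger0_norm ?mulr_ge0// mulrC.
move=> i ij; rewrite mxE eeMnE (negPf ij) muln0.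
by rewrite mulr0 expr0n.
Qed.

Lemma uniform_bound : locally_uniformly (fun (C : R) n k => `|u n k| <= C).
Proof.
move=> rho; have [M uM] := u_bnd rho; have [n0 hn0] := nat_above rho.
exists (Num.max M 1), n0; split; first by rewrite lt_max ltr01 orbT.
move=> n k n0n bk; have rn := hn0 n n0n.
rewrite ger0_norm; first by rewrite le_max (uM n k)//.
exact: u0 (box_le rn bk).
Qed.

Lemma f_ge0 s : 0 <= s -> 0 <= f s.
Proof. by move=> s0; rewrite -f0 f_mono. Qed.

Lemma p_mesh_bound (rho : R) : exists C : R, 0 < C /\
  forall (m : R) (k : lat), box rho m k -> p (at_mesh m k) <= C.
Proof.
pose r := N%:R * `|rho| + 1.
have r0 : 0 < r by rewrite ltr_wpDl// mulr_ge0.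
have [C HC] := p_holder r0.
exists (p 0 + `|C| * (r `^ alpha) + 1); split.
  by rewrite ltr_wpDl// addr_ge0// mulr_ge0// powR_ge0.
move=> m k bk; set x := at_mesh m k.
have xr : enorm x <= r.
  apply: le_trans (enorm_at_mesh_le bk) _; rewrite -[leLHS]addr0 lerD//.
  by rewrite ler_wpM2l// ler_norm.
have e0 : enorm (0 : 'rV[R]_N) = 0.
  by rewrite /enorm big1 ?sqrtr0// => i _; rewrite mxE expr0n.
have := HC x 0 I I xr; rewrite e0 => /(_ (ltW r0)); rewrite subr0 => hx.
have : C * enorm x `^ alpha <= `|C| * r `^ alpha.
  apply: (@le_trans _ _ (`|C| * enorm x `^ alpha)).
    by rewrite ler_wpM2r ?powR_ge0// ler_norm.
  by rewrite ler_wpM2l// ge0_ler_powR ?nnegrE ?(ltW alpha0) ?(ltW r0)// sqrtr_ge0.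
have := ler_norm (p x - p 0); lra.
Qed.

Lemma uniform_rhs : locally_uniformly (fun (C : R) n k =>
  `|dop (h n / 2) (u n) k| <= h n ^+ 2 * C).
Proof.
move=> rho; have [M [n0 [M0 uM]]] := uniform_bound rho.
have [C [C0 pC]] := p_mesh_bound rho; have [n1 hn1] := nat_above rho.
exists (C * (f M + 1)), (maxn n0 n1); split.
  by rewrite mulr_gt0// ltr_wpDl// f_ge0// ltW.
move=> n k; rewrite geq_max => /andP[n0n n1n] bk.
have bn := box_le (hn1 _ n1n) bk.
have un0 := u0 bn.
rewrite u_eq// normrM ger0_norm ?sqr_ge0// ler_wpM2l ?sqr_ge0//.
rewrite ger0_norm ?mulr_ge0 ?f_ge0// ler_pM ?f_ge0 ?pC//.
have : f (u n k) <= f M by rewrite f_mono// (le_trans (ler_norm _)) ?uM.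
lra.
Qed.

Lemma uniform_gradient : locally_uniformly (fun (C : R) n k =>
  forall i, `|fdiff (ee i) (u n) k| <= h n * C).
Proof.
move=> rho; have [M [n0 [M0 uM]]] := uniform_bound (rho + 6^-1).
have [K [n1 [K0 uK]]] := uniform_rhs (rho + 6^-1).
exists ((12 * N%:R + 4) * M / 6^-1 + K * 6^-1), (maxn (maxn n0 n1) 6); split.
  by rewrite addr_gt0// ?mulr_gt0// ?addr_gt0// ?mulr_gt0// ?ltr0n.
move=> n k; rewrite !geq_max => /andP[/andP[n0n n1n] n6] bk i.
have h6 : h n <= 6^-1.
  by apply: le_trans (hn n) _; rewrite lef_pV2 ?posrE// ler_nat ltnW.
apply: gradient_step (tau01 n) _ _ _ => //.
- apply: eq_ler; by field.
- by move=> x xk; exact: (uM n x n0n (boxD bk xk)).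
- by move=> x xk; exact: (uK n x n1n (boxD bk xk)).
Qed.

(** Once the gradient is bounded, its term can be moved to the right-hand side. The operator left
    over is linear and commutes with differences, so [gradient_step] is applied with [tau = 0] from
    here on. *)
Lemma uniform_laplacian : locally_uniformly (fun (C : R) n k =>
  `|dlap (u n) k| <= h n ^+ 2 * C).
Proof.
move=> rho; have [G [n0 [G0 uG]]] := uniform_gradient (rho + 1).
have [K [n1 [K0 uK]]] := uniform_rhs rho.
exists (K + N%:R * G), (maxn n0 n1); split.
  by rewrite addr_gt0// mulr_gt0// ltr0n.
move=> n k; rewrite !geq_max => /andP[n0n n1n] bk.
have -> : dlap (u n) k = dop (h n / 2) (u n) k - h n / 2 * dgrad (u n) k.
  by rewrite /dop addrK.
apply: le_trans (ler_normB _ _) _; rewrite mulrDr lerD ?uK//.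
rewrite ger0_norm; last by rewrite mulr_ge0 ?l2norm_ge0//; case/andP: (tau01 n).
have : dgrad (u n) k <= N%:R * (2 * (h n * G)).
  apply: l2norm_le_max => i.
  have -> : u n (k + ee i) - u n (k - ee i) =
     fdiff (ee i) (u n) k + fdiff (ee i) (u n) (k - ee i).
    by rewrite /fdiff subrK; ring.
  apply: le_trans (ler_normD _ _) _; rewrite mulr_natl mulr2n lerD//.
    by apply: uG => //; apply: box_le bk; rewrite lerDl.
  by apply: uG => //; exact: boxBee.
move=> hd; apply: (@le_trans _ _ (h n / 2 * (N%:R * (2 * (h n * G))))).
  by rewrite ler_wpM2l//; case/andP: (tau01 n).
apply: eq_ler; by field.
Qed.

Let fdiff_bound (rho B : R) n k j (l : nat) : 
  (forall x i, box (rho + 1) (h n) x -> `|fdiff (ee i) (u n) x| <= B) ->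
  l%:R * h n <= 1 -> box rho (h n) k -> `|fdiff (ee j *+ l) (u n) k| <= l%:R * B.
Proof.
move=> HB lh bk; apply: fdiff_path => m ml; apply: HB.
apply: box_le (box_eeMn j m (ltW (h0 n)) bk); rewrite lerD2l.
by apply: le_trans lh; rewrite ler_wpM2r ?(ltW (h0 n))// ler_nat ltnW.
Qed.

Let le_mesh (l : nat) (n : nat) (s : R) : (0 < l)%N -> l%:R * h n = s -> h n <= s.
Proof. by move=> l0 <-; rewrite ler_peMl ?(ltW (h0 n))// ler1n. Qed.

(* Interpolating between scales: the gradient estimate for an increment of
   length [l h = t ^ 2] is applied on a cube of radius [t]. *)
Lemma uniform_gradient_holder : locally_uniformly (fun (C : R) n k =>
  forall i j (l : nat) (t : R), (0 < l)%N -> 0 < t -> t <= 1 -> l%:R * h n = t ^+ 2 ->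
   `|fdiff (ee i) (fdiff (ee j *+ l) (u n)) k| <= h n * (C * t)).
Proof.
move=> rho; have [G [n0 [G0 uG]]] := uniform_gradient (rho + 2).
have [K [n1 [K0 uK]]] := uniform_laplacian (rho + 2).
exists ((12 * N%:R + 4) * G + K * 2), (maxn n0 n1); split.
  by rewrite addr_gt0// ?mulr_gt0// ?addr_gt0// ?mulr_gt0// ?ltr0n.
move=> n k; rewrite !geq_max => /andP[n0n n1n] bk i j l t l0 t0 t1 lh.
have t21 : t ^+ 2 <= t by rewrite expr2 ler_piMl// ltW.
have ht : h n <= t by apply: le_trans t21; exact: le_mesh lh.
have lh1 : l%:R * h n <= 1 by rewrite lh exprn_ile1// ltW.
have inb (x : lat) : (forall j0, `|h n * (x 0 j0 - k 0 j0)%:~R| <= t) -> box (rho + 1) (h n) x.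
  by move=> xk; apply: box_le (boxD bk xk); rewrite lerD2l.
have -> : h n * (((12 * N%:R + 4) * G + K * 2) * t) =
   h n * ((12 * N%:R + 4) * (t ^+ 2 * G) / t + K * 2 * t).
  by field; rewrite gt_eqF.
apply: (@gradient_step _ _ 0) => //.
- by rewrite mulr_gt0// exprn_gt0.
- by rewrite lexx ler01.
- by rewrite mul0r mulr_ge0 ?(ltW (h0 n)).
- move=> x /inb bx; rewrite -lh.
  have -> : l%:R * h n * G = l%:R * (h n * G) by rewrite mulrA.
  apply: (fdiff_bound j _ lh1 bx) => y i' by1; apply: uG => //.
  by apply: box_le by1; rewrite -addrA.
- move=> x /inb bx; rewrite /dop mul0r addr0 dlap_fdiff /fdiff.
  apply: le_trans (ler_normB _ _) _.
  have -> : h n ^+ 2 * (K * 2) = h n ^+ 2 * K + h n ^+ 2 * K by ring.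
  rewrite lerD// uK//; last by apply: box_le bx; rewrite lerD2l ler1n.
  by apply: box_le (box_eeMn j l (ltW (h0 n)) bx); rewrite -addrA lerD2l; lra.
Qed.

Variable q : nat.
Hypotheses (q2 : (2 <= q)%N) (qalpha : 1 <= q%:R * alpha).

(** By [qalpha], an increment of length [s ^+ (2 * q)] changes a Hoelder function of exponent
    [alpha] by order [s ^+ 2] only. This is the reason for writing lengths as powers of [s]. *)
Let powR_scale (s : R) : 0 < s -> s <= 1 -> (s ^+ (2 * q)) `^ alpha <= s ^+ 2.
Proof.
move=> s0 s1; rewrite -[s ^+ (2 * q)]powR_mulrn ?(ltW s0)// -powRrM.
rewrite -[leRHS]powR_mulrn ?(ltW s0)//.
rewrite /powR gt_eqF// ler_expR ler_wnM2r//; first by rewrite ln_le0.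
by rewrite natrM -mulrA -[leLHS]mulr1 ler_wpM2l.
Qed.

(** Three contributions, each of order [s ^+ 2]: [p] by its Hoelder bound, [f (u n)] by the
    Lipschitz bound on [u n] followed by the Hoelder bound on [f], and the gradient by
    [uniform_gradient_holder] with [t = s ^+ q], where [q >= 2] gives [s ^+ q <= s ^+ 2]. *)
Lemma uniform_rhs_holder : locally_uniformly (fun (C : R) n k =>
  forall j (l : nat) (s : R), (0 < l)%N -> 0 < s -> s <= 1 -> l%:R * h n = s ^+ (2 * q) ->
   `|fdiff (ee j *+ l) (dlap (u n)) k| <= h n ^+ 2 * (C * s ^+ 2)).
Proof.
move=> rho.
have [M [n0 [M0 uM]]] := uniform_bound (rho + 1).
have [G [n1 [G0 uG]]] := uniform_gradient (rho + 1).
have [H [n2 [H0 uH]]] := uniform_gradient_holder (rho + 1).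
have [P [P0 pP]] := p_mesh_bound (rho + 1).
pose r := N%:R * (`|rho| + 1) + 1.
have r0 : 0 < r by rewrite ltr_wpDl// mulr_ge0// addr_ge0.
have [Cp HCp] := p_holder r0.
have [Cf HCf] := f_holder M0.
have [n3 hn3] := nat_above (rho + 1).
exists (`|Cp| * f M + P * (`|Cf| * G `^ alpha) + N%:R * H + 1), (maxn (maxn n0 n1) (maxn n2 n3)); split.
  by rewrite ltr_wpDl// !addr_ge0// !mulr_ge0// ?f_ge0 ?powR_ge0// ltW.
move=> n k; rewrite !geq_max => /andP[/andP[n0n n1n] /andP[n2n n3n]] bk j l s l0 s0 s1 lh.
have hp := h0 n.
set y := ee j *+ l.
have sle1 : s ^+ (2 * q) <= 1 by rewrite exprn_ile1// ltW.
have lh1 : l%:R * h n <= 1 by rewrite lh.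
have bky : box (rho + 1) (h n) (k + y).
  by apply: box_le (box_eeMn j l (ltW hp) bk); rewrite lerD2l.
have bk1 : box (rho + 1) (h n) k by apply: box_le bk; rewrite lerDl.
have bn := box_le (hn3 _ n3n) bk1; have bny := box_le (hn3 _ n3n) bky.
have uk0 := u0 bn; have uky0 := u0 bny.
have ukM := le_trans (ler_norm _) (uM n k n0n bk1).
have ukyM := le_trans (ler_norm _) (uM n _ n0n bky).
have dE (x : lat) : box n%:R (h n) x -> dlap (u n) x =
   h n ^+ 2 * (p (at_mesh (h n) x) * f (u n x)) - h n / 2 * dgrad (u n) x.
  by move=> bx; rewrite -u_eq// /dop addrK.
rewrite /fdiff !dE//.
set pk := p (at_mesh (h n) k); set pky := p (at_mesh (h n) (k + y)).
have rP : rho + 1 <= `|rho| + 1 by rewrite lerD2r ler_norm.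
have er (x : lat) : box (rho + 1) (h n) x -> enorm (at_mesh (h n) x) <= r.
  move=> bx; apply: le_trans (enorm_at_mesh_le bx) _.
  by rewrite -[leLHS]addr0 lerD// ler_wpM2l.
have hp1 : `|pky - pk| <= `|Cp| * s ^+ 2.
  apply: le_trans (HCp _ _ I I (er _ bky) (er _ bk1)) _.
  rewrite enorm_at_mesh_shift ?(ltW hp)// lh.
  apply: (@le_trans _ _ (`|Cp| * (s ^+ (2 * q)) `^ alpha)).
    by rewrite ler_wpM2r ?powR_ge0// ler_norm.
  by rewrite ler_wpM2l// powR_scale.
have hf1 : `|f (u n (k + y)) - f (u n k)| <= `|Cf| * (G `^ alpha * s ^+ 2).
  apply: le_trans (HCf _ _ uky0 uk0 ukyM ukM) _.
  apply: (@le_trans _ _ (`|Cf| * `|u n (k + y) - u n k| `^ alpha)).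
    by rewrite ler_wpM2r ?powR_ge0// ler_norm.
  rewrite ler_wpM2l//.
  apply: (@le_trans _ _ ((G * s ^+ (2 * q)) `^ alpha)).
    rewrite ge0_ler_powR ?nnegrE ?(ltW alpha0) ?mulr_ge0 ?exprn_ge0 ?(ltW G0) ?(ltW s0)//.
    rewrite -lh mulrC -mulrA.
    by apply: (fdiff_bound j _ lh1 bk) => x i bx; exact: uG.
  rewrite powRM ?exprn_ge0 ?(ltW G0) ?(ltW s0)//.
  by rewrite ler_wpM2l ?powR_ge0// powR_scale.
have hd : `|dgrad (u n) (k + y) - dgrad (u n) k| <= N%:R * (2 * (h n * (H * s ^+ 2))).
  apply: le_trans (l2norm_lip _ _) _; apply: l2norm_le_max => i.
  have -> : u n (k + y + ee i) - u n (k + y - ee i) - (u n (k + ee i) - u n (k - ee i)) =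
     fdiff (ee i) (fdiff y (u n)) k + fdiff (ee i) (fdiff y (u n)) (k - ee i).
    by rewrite /fdiff subrK (addrAC k y) (addrAC k y (- _)); ring.
  have sq : H * s ^+ q <= H * s ^+ 2.
    by rewrite ler_wpM2l ?(ltW H0)// ler_wiXn2l// ltW.
  have bkH (x : lat) : box (rho + 1) (h n) x -> `|fdiff (ee i) (fdiff y (u n)) x| <= h n * (H * s ^+ 2).
    move=> bx; apply: le_trans (_ : h n * (H * s ^+ q) <= _); last by rewrite ler_wpM2l// ltW.
    apply: uH => //; first by rewrite exprn_gt0.
      by rewrite exprn_ile1// ltW.
    by rewrite -exprM mulnC.
  apply: le_trans (ler_normD _ _) _; rewrite mulr_natl mulr2n lerD// bkH//.
  exact: boxBee.
have -> : h n ^+ 2 * (pky * f (u n (k + y))) - h n / 2 * dgrad (u n) (k + y) -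
   (h n ^+ 2 * (pk * f (u n k)) - h n / 2 * dgrad (u n) k) =
   h n ^+ 2 * ((pky - pk) * f (u n (k + y)) + pk * (f (u n (k + y)) - f (u n k)))
   - h n / 2 * (dgrad (u n) (k + y) - dgrad (u n) k) by ring.
apply: le_trans (ler_normB _ _) _.
have e1 : `|(pky - pk) * f (u n (k + y)) + pk * (f (u n (k + y)) - f (u n k))| <=
   (`|Cp| * f M + P * (`|Cf| * G `^ alpha)) * s ^+ 2.
  apply: le_trans (ler_normD _ _) _; rewrite [leRHS]mulrDl lerD// normrM.
    by rewrite mulrAC ler_pM// ger0_norm ?f_ge0// f_mono//.
  by rewrite -!mulrA ler_pM// ger0_norm ?pP ?p0.
have e2 : `|h n / 2 * (dgrad (u n) (k + y) - dgrad (u n) k)| <= h n ^+ 2 * (N%:R * H * s ^+ 2).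
  rewrite normrM ger0_norm ?divr_ge0 ?(ltW hp)//.
  apply: (@le_trans _ _ (h n / 2 * (N%:R * (2 * (h n * (H * s ^+ 2)))))).
    by rewrite ler_wpM2l// divr_ge0// ltW.
  apply: eq_ler; by field.
apply: (@le_trans _ _ (h n ^+ 2 * ((`|Cp| * f M + P * (`|Cf| * G `^ alpha)) * s ^+ 2) +
   h n ^+ 2 * (N%:R * H * s ^+ 2))).
  apply: lerD e2; rewrite normrM ger0_norm ?sqr_ge0//.
  by rewrite ler_wpM2l ?sqr_ge0.
rewrite -mulrDr ler_wpM2l ?sqr_ge0// -mulrDl ler_wpM2r ?sqr_ge0// lerDl//.
Qed.

Lemma dlap_iter_fdiff m y (v : lat -> R) :
  dlap (iter m (fdiff y) v) = iter m (fdiff y) (dlap v).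
Proof.
elim: m => //= m <-; apply/funext => x; exact: dlap_fdiff.
Qed.

Lemma iter_fdiff_bound m j l (v : lat -> R) (n : nat) rho B :
  l%:R * h n <= 1 ->
  (forall x, box (rho + m%:R) (h n) x -> `|v x| <= B) ->
  forall x, box rho (h n) x -> `|iter m (fdiff (ee j *+ l)) v x| <= 2 ^+ m * B.
Proof.
move=> lh; elim: m rho => [|m IH] rho vB x bx /=.
  by rewrite expr0 mul1r vB// addr0.
have IH1 := IH (rho + 1); rewrite /fdiff.
apply: le_trans (ler_normB _ _) _; rewrite exprS -mulrA mulr_natl mulr2n.
have vB' y : box (rho + 1 + m%:R) (h n) y -> `|v y| <= B.
  by move=> yb; apply: vB; rewrite -addrA -natr1 (addrC m%:R) in yb *.
rewrite lerD// IH1//; last by apply: box_le bx; rewrite lerDl.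
by apply: box_le (box_eeMn j l (ltW (h0 n)) bx); rewrite lerD2l.
Qed.

(* With increments of length [s ^ (2q)] and cubes of radius [s ^ (2q - 1)], each further difference gains a factor [s]. *)
Lemma uniform_higher_differences m : (m <= (2 * q).+1)%N ->
  locally_uniformly (fun (C : R) n k =>
  forall i j (l : nat) (s : R), (0 < l)%N -> 0 < s -> s <= 1 -> l%:R * h n = s ^+ (2 * q) ->
   `|fdiff (ee i) (iter m (fdiff (ee j *+ l)) (u n)) k| <= h n * (C * s ^+ m)).
Proof.
elim: m => [_|m IH mq] rho.
  have [G [n0 [G0 uG]]] := uniform_gradient rho.
  exists G, n0; split=> // n k n0n bk i j l s _ _ _ _.
  by rewrite expr0 mulr1 uG.
have [G [n0 [G0 uG]]] := IH (ltnW mq) (rho + 2).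
have [K [n1 [K0 uK]]] := uniform_rhs_holder (rho + 1 + m%:R).
exists ((12 * N%:R + 4) * G + 2 ^+ m * K), (maxn n0 n1); split.
  by rewrite addr_gt0// ?mulr_gt0// ?addr_gt0// ?mulr_gt0// ?ltr0n// exprn_gt0.
move=> n k; rewrite !geq_max => /andP[n0n n1n] bk i j l s l0 s0 s1 lh.
have [Q QE] : exists Q, (2 * q = Q.+1)%N by exists (2 * q).-1; rewrite prednK// muln_gt0 (ltnW q2).
set r := s ^+ Q.
have sE : s ^+ (2 * q) = s * r by rewrite QE exprS.
have r0 : 0 < r by rewrite exprn_gt0.
have r1 : r <= 1 by rewrite exprn_ile1// ltW.
have hr : h n <= r.
  by apply: le_trans (le_mesh l0 lh) _; rewrite sE ler_piMl// ltW.
have lh1 : l%:R * h n <= 1 by rewrite lh exprn_ile1// ltW.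
have inb (x : lat) : (forall j0, `|h n * (x 0 j0 - k 0 j0)%:~R| <= r) -> box (rho + 1) (h n) x.
  by move=> xk; apply: box_le (boxD bk xk); rewrite lerD2l.
(* The induction hypothesis, summed along the increment [s * r] and divided by the radius [r], gains
   the factor [s]. The source contributes [s ^+ 2 * r = s ^+ (2 * q).+1], which is what caps the
   order. *)
apply: (@le_trans _ _ (h n * ((12 * N%:R + 4) * (s * r * (G * s ^+ m)) / r + 2 ^+ m * K * s ^+ 2 * r))); last first.
  rewrite ler_wpM2l ?(ltW (h0 n))// [leRHS]mulrDl lerD//.
    rewrite exprS; apply: eq_ler; field; exact: lt0r_neq0.
  rewrite -mulrA ler_wpM2l ?mulr_ge0 ?exprn_ge0 ?(ltW K0)//.
  by rewrite -exprD ler_wiXn2l ?(ltW s0)//; rewrite QE in mq.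
apply: (@gradient_step _ _ 0) => //.
- by rewrite !mulr_gt0// exprn_gt0.
- by rewrite lexx ler01.
- by rewrite mul0r mulr_ge0 ?(ltW (h0 n)).
- move=> x /inb bx; rewrite -sE -lh.
  have -> : l%:R * h n * (G * s ^+ m) = l%:R * (h n * (G * s ^+ m)) by ring.
  apply: fdiff_path => m' ml; apply: uG => //.
  apply: box_le (box_eeMn j m' (ltW (h0 n)) bx); rewrite -addrA lerD2l.
  have : m'%:R * h n <= l%:R * h n by rewrite ler_wpM2r ?(ltW (h0 n))// ler_nat ltnW.
  lra.
- move=> x /inb bx; rewrite /dop mul0r addr0 dlap_iter_fdiff iterSr.
  have -> : h n ^+ 2 * (2 ^+ m * K * s ^+ 2) = 2 ^+ m * (h n ^+ 2 * (K * s ^+ 2)) by ring.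
  apply: iter_fdiff_bound bx => // y by1; exact: uK.
Qed.

End UniformEstimates.

(** * Perron's method on the lattice *)

Section Perron.
Context {R : realType} {N : nat}.
Local Notation lat := 'rV[int]_N.

Lemma holder_continuous (alpha : R) (f : R -> R) : 0 < alpha ->
  loc_holder_halfline alpha f ->
  forall a e : R, 0 <= a -> 0 < e -> exists d : R, 0 < d /\
    forall b, 0 <= b -> `|b - a| < d -> `|f b - f a| < e.
Proof.
move=> al0 hf a e a0 e0.
have a1 : 0 < a + 1 by rewrite ltr_wpDl.
have [C HC] := hf _ a1.
have C1 : 0 < `|C| + 1 by rewrite ltr_wpDl.
pose d := (e / (`|C| + 1)) `^ alpha^-1.
have d0 : 0 < d by rewrite powR_gt0// divr_gt0.
exists (Num.min d 1); split; first by rewrite lt_min d0 ltr01.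
move=> b b0; rewrite lt_min => /andP[bd b1].
have ba : b <= a + 1 by have := ler_norm (b - a); lra.
have aa : a <= a + 1 by lra.
apply: le_lt_trans (HC b a b0 a0 ba aa) _.
apply: (@le_lt_trans _ _ (`|C| * `|b - a| `^ alpha)).
  by rewrite ler_wpM2r ?powR_ge0// ler_norm.
apply: (@le_lt_trans _ _ (`|C| * (e / (`|C| + 1)))).
  rewrite ler_wpM2l//.
  have -> : e / (`|C| + 1) = d `^ alpha.
    by rewrite /d -powRrM mulVf ?gt_eqF// powRr1// divr_ge0// ltW.
  by rewrite ge0_ler_powR ?nnegrE ?(ltW al0) ?(ltW d0) ?(ltW bd).
rewrite mulrA ltr_pdivrMr// mulrC ltr_pM2l//; lra.
Qed.

Variables (tau : R) (P : lat -> R) (f : R -> R) (D E : lat -> Prop) (V W : lat -> R).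
Hypotheses (tau01 : 0 <= tau <= 1) (P0 : forall k, 0 <= P k)
  (f_cont : forall a e : R, 0 <= a -> 0 < e -> exists d : R, 0 < d /\
    forall b, 0 <= b -> `|b - a| < d -> `|f b - f a| < e)
  (DE : forall k, D k -> E k)
  (DEp : forall k i, D k -> E (k + ee i)) (DEm : forall k i, D k -> E (k - ee i))
  (V0 : forall k, E k -> 0 <= V k)
  (VW : forall k, E k -> V k <= W k)
  (subV : forall k, D k -> P k * f (V k) <= dop tau V k)
  (superW : forall k, D k -> dop tau W k <= P k * f (W k)).

(** With [2 * N%:R * z k] added to both sides of the scheme, [rhs] is monotone in [z] and [lhs]
    involves the value at [k] alone. *)
Let rhs (z : lat -> R) (k : lat) : R := dop tau z k + 2 * N%:R * z k.
Let lhs (k : lat) (a : R) : R := 2 * N%:R * a + P k * f a.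

Let rhs_mono (y z : lat -> R) k : D k -> (forall x, E x -> y x <= z x) -> rhs y k <= rhs z k.
Proof.
by move=> Dk yz; apply: dop_mono => // i; apply: yz; [exact: DEp|exact: DEm].
Qed.

Let lhs_cont k a e : 0 <= a -> 0 < e -> exists d : R, 0 < d /\
  forall b, 0 <= b -> `|b - a| < d -> `|lhs k b - lhs k a| < e.
Proof.
move=> a0 e0.
have c0 : 0 < 2 * N%:R + P k + 1 by rewrite ltr_wpDl// addr_ge0// mulr_ge0.
have e1 : 0 < e / (2 * N%:R + P k + 1) by rewrite divr_gt0.
have [d [d0 hd]] := f_cont a0 e1.
exists (Num.min d (e / (2 * N%:R + P k + 1))); split; first by rewrite lt_min d0.
move=> b b0; rewrite lt_min => /andP[bd be].
have -> : lhs k b - lhs k a = 2 * N%:R * (b - a) + P k * (f b - f a).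
  by rewrite /lhs; ring.
apply: le_lt_trans (ler_normD _ _) _; rewrite !normrM.
rewrite (ger0_norm (_ : 0 <= 2))// (ger0_norm (_ : 0 <= N%:R))// (ger0_norm (P0 k)).
apply: (@le_lt_trans _ _ (2 * N%:R * (e / (2 * N%:R + P k + 1)) + P k * (e / (2 * N%:R + P k + 1)))).
  by rewrite lerD// ler_wpM2l ?mulr_ge0// ltW// hd.
rewrite -mulrDl mulrA ltr_pdivrMr// mulrC ltr_pM2l//; lra.
Qed.

(** The solution is the pointwise supremum of the subsolutions between [V] and [W]. If the scheme
    were a strict inequality at some [k], the value at that single point could be raised: the
    inequality survives at [k] by continuity of [lhs], and elsewhere because [rhs] only
    increases. *)
Lemma perron : exists u : lat -> R, (forall k, E k -> V k <= u k <= W k) /\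
  (forall k, D k -> dop tau u k = P k * f (u k)).
Proof.
pose S (z : lat -> R) := (forall k, E k -> V k <= z k <= W k) /\
  (forall k, D k -> lhs k (z k) <= rhs z k).
have SV : S V.
  split=> k Ek; first by rewrite lexx VW.
  by rewrite /lhs /rhs addrC lerD2r subV.
pose A k : set R := [set z k | z in [set z | S z]].
have supA k : E k -> has_sup (A k).
  move=> Ek; split; first by exists (V k), V.
  by exists (W k) => _ [z [zVW _] <-]; case/andP: (zVW k Ek).
pose u k := sup (A k).
have zu z k : S z -> E k -> z k <= u k.
  by move=> Sz Ek; apply: ub_le_sup; [exact: (supA _ Ek).2|exists z].
have uW k : E k -> u k <= W k.
  move=> Ek; apply: ge_sup; first exact: (supA _ Ek).1.
  by move=> _ [z [zVW _] <-]; case/andP: (zVW k Ek).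
have Vu k : E k -> V k <= u k by move=> Ek; exact: zu.
have u0 k : E k -> 0 <= u k by move=> Ek; apply: le_trans (V0 Ek) (Vu _ Ek).
have usub k : D k -> lhs k (u k) <= rhs u k.
  move=> Dk; rewrite leNgt; apply/negP => hlt.
  have Ek := DE Dk.
  have e0 : 0 < lhs k (u k) - rhs u k by rewrite subr_gt0.
  have [d [d0 hd]] := lhs_cont k (u0 _ Ek) e0.
  have [_ [z Sz <-] zk] := sup_adherent d0 (supA _ Ek).
  have zk' : z k <= u k by exact: zu.
  have [zVW zsub] := Sz.
  have z0 : 0 <= z k by apply: le_trans (V0 Ek) _; case/andP: (zVW _ Ek).
  have : `|z k - u k| < d.
    by rewrite ltr_norml; rewrite -/(u k) in zk; apply/andP; split; lra.
  move=> /(hd _ z0); rewrite ltr_norml => /andP[h1 _].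
  have := zsub _ Dk; have := rhs_mono Dk (fun x Ex => zu z x Sz Ex); lra.
exists u; split=> [k Ek|k Dk]; first by rewrite Vu// uW.
suff : lhs k (u k) = rhs u k by rewrite /lhs /rhs => h; lra.
apply: le_anti; rewrite usub// andTb leNgt; apply/negP => hlt.
have Ek := DE Dk.
have e0 : 0 < rhs u k - lhs k (u k) by rewrite subr_gt0.
(* There is room to raise the value: contact with [W] at [k] would make [superW] contradict the
   strict inequality. *)
have ukW : u k < W k.
  rewrite lt_neqAle uW// andbT; apply/eqP => uE.
  have := rhs_mono Dk uW; have := superW Dk.
  move: hlt; rewrite /lhs uE /rhs -uE; lra.
have [d [d0 hd]] := lhs_cont k (u0 _ Ek) e0.
pose a := Num.min (W k) (u k + d / 2).
have ua : u k < a by rewrite lt_min ukW/=; lra.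
have a0 : 0 <= a by apply: le_trans (u0 _ Ek) (ltW ua).
have aW : a <= W k by rewrite ge_min lexx.
have ad : a <= u k + d / 2 by rewrite ge_min lexx orbT.
have la : lhs k a <= rhs u k.
  have : `|a - u k| < d by rewrite ltr_norml; apply/andP; split; lra.
  by move=> /(hd _ a0); rewrite ltr_norml => /andP[_]; lra.
pose z x := if x == k then a else u x.
have uz x : u x <= z x by rewrite /z; case: eqP => // ->; rewrite ltW.
have Sz : S z.
  split=> [x Ex|x Dx].
    by rewrite (le_trans (Vu _ Ex) (uz x))/= /z; case: eqP => [->//|_]; exact: uW.
  apply: (@le_trans _ _ (rhs u x)); last by apply: rhs_mono.
  by rewrite /z; case: eqP => [->//|_]; exact: usub.
have := zu z k Sz Ek; rewrite /z eqxx; lra.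
Qed.

End Perron.

(** * From second differences to derivatives *)

Section Marchaud.
Context {R : realType} {N : nat}.
Local Notation E := 'rV[R]_N.
Implicit Types (v w : E -> R) (a x : E).

Definition inbox (rho : R) (x : E) := forall i, `|x 0 i| <= rho.

Lemma inbox_le (rho rho' : R) x : rho <= rho' -> inbox rho x -> inbox rho' x.
Proof. by move=> rr bx i; apply: le_trans rr. Qed.

Lemma ebasisE (i j : 'I_N) : (ebasis i : E) 0 j = (j == i)%:R.
Proof. by rewrite mxE. Qed.

Lemma inbox_shift (rho t : R) x j : inbox rho x -> inbox (rho + `|t|) (x + t *: ebasis j).
Proof.
move=> bx i; rewrite mxE [X in _ + X]mxE ebasisE.
apply: le_trans (ler_normD _ _) _; rewrite lerD// normrM.
by case: (i == j); rewrite /= ?normr1 ?normr0 ?mulr1 ?mulr0.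
Qed.

Lemma iter_fdiff_fdiff m (V : zmodType) (a b : V) (w : V -> R) :
  iter m (fdiff a) (fdiff b w) = fdiff b (iter m (fdiff a) w).
Proof. by elim: m => //= m ->; rewrite fdiffC. Qed.

Definition fsum a v : E -> R := fun t : E => v (t + a) + v t.

Lemma fdiff_fsum a b v : fdiff b (fsum a v) = fsum a (fdiff b v).
Proof. by apply/funext => t; rewrite /fdiff /fsum (addrAC t a b); ring. Qed.

Lemma fdiff_double a v : fdiff (a + a) v = fsum a (fdiff a v).
Proof. by apply/funext => t; rewrite /fdiff /fsum !addrA; ring. Qed.

(** With [T] the translation by [a], this is (T^2 - 1)^m = (T + 1)^m (T - 1)^m, the identity behind
    Marchaud's inequality. *)
Lemma iter_fdiff_double a m v :
  iter m (fdiff (a + a)) v = iter m (fsum a) (iter m (fdiff a) v).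
Proof.
have comm k w : fdiff a (iter k (fsum a) w) = iter k (fsum a) (fdiff a w).
  by elim: k => //= k IH; rewrite fdiff_fsum IH.
by elim: m => //= m ->; rewrite fdiff_double comm.
Qed.

(** The polynomial (T + 1)^m - 2^m is divisible by T - 1, so replacing the iterated sum by a
    multiple of [w] costs only one more difference of [w]. *)
Lemma iter_fsum_approx a m w x B :
  (forall i, (i < m)%N -> `|fdiff a w (x + a *+ i)| <= B) ->
  `|iter m (fsum a) w x - 2 ^+ m * w x| <= m%:R * 2 ^+ m * B.
Proof.
elim: m x => [|m IH] x hB /=; first by rewrite expr0 mul1r subrr normr0 !mul0r.
have B0 : 0 <= B := le_trans (normr_ge0 _) (hB 0%N isT).
have -> : fsum a (iter m (fsum a) w) x - 2 ^+ m.+1 * w x =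
  (iter m (fsum a) w (x + a) - 2 ^+ m * w (x + a)) +
  (iter m (fsum a) w x - 2 ^+ m * w x) + 2 ^+ m * fdiff a w x.
  by rewrite /fsum /fdiff exprS; ring.
have h2 : `|iter m (fsum a) w (x + a) - 2 ^+ m * w (x + a)| <= m%:R * 2 ^+ m * B.
  by apply: IH => i im; rewrite -addrA -mulrS; exact: hB.
have h3 : `|iter m (fsum a) w x - 2 ^+ m * w x| <= m%:R * 2 ^+ m * B.
  by apply: IH => i im; apply: hB; rewrite ltnW.
have h4 : `|2 ^+ m * fdiff a w x| <= 2 ^+ m * B.
  rewrite normrM ger0_norm ?exprn_ge0// ler_wpM2l ?exprn_ge0//.
  by have := hB 0%N isT; rewrite mulr0n addr0.
apply: le_trans (ler_normD _ _) _; apply: le_trans (lerD (ler_normD _ _) (lexx _)) _.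
have -> : m.+1%:R * 2 ^+ m.+1 * B = m%:R * 2 ^+ m * B + m%:R * 2 ^+ m * B + 2 ^+ m * B + 2 ^+ m * B.
  by rewrite exprS -natr1; ring.
have : 0 <= 2 ^+ m * B by rewrite mulr_ge0// exprn_ge0.
lra.
Qed.

(** The model is a small power of [s]. The constant 3/2 in [e_double], below 2, is what lets the
    descent below close; [e_half] makes the values at dyadic scales summable; [e_lin] keeps the
    modulus from being too small near [s = 1]. *)
Variables (e : R -> R) (theta : R) (j : 'I_N).
Hypotheses (e_ge0 : forall s, 0 < s -> 0 <= e s)
  (e_double : forall s, 0 < s -> e (2 * s) <= 3 / 2 * e s)
  (e_half : forall s, 0 < s -> e (s / 2) <= theta * e s)
  (theta01 : 0 <= theta < 1)
  (e_lin : forall s, 0 < s -> s <= 1 -> s <= e s).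

Definition differences_bounded m v := forall rho : R, exists C : R, 0 < C /\
  forall x s, inbox rho x -> 0 < s -> s <= 1 ->
    `|iter m (fdiff (s *: ebasis j)) v x| <= C * (s * e s).

Definition bounded_on_boxes v := forall rho : R, exists C : R, 0 < C /\
  forall x, inbox rho x -> `|v x| <= C.

Lemma half_pow_below (s : R) : 0 < s -> exists n : nat, 2^-1 ^+ n.+1 < s.
Proof.
move=> s0; exists (Num.truncn s^-1); rewrite exprVn -[X in _ < X]invrK ltf_pV2 ?posrE ?invr_gt0 ?exprn_gt0//.
apply: lt_le_trans (real_truncnS_gt (num_real _)) _.
by rewrite -natrX ler_nat ltnW// ltn_expl.
Qed.

Lemma iter_fdiff_crude m v (rho B : R) :
  (forall x, inbox (rho + m%:R) x -> `|v x| <= B) ->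
  forall x (s : R), inbox rho x -> 0 < s -> s <= 1 ->
  `|iter m (fdiff (s *: ebasis j)) v x| <= 2 ^+ m * B.
Proof.
elim: m rho => [|m IH] rho vB x s bx s0 s1 /=.
  by rewrite expr0 mul1r vB// addr0.
rewrite /fdiff exprS -mulrA mulr_natl mulr2n.
have vB' y : inbox (rho + 1 + m%:R) y -> `|v y| <= B.
  by move=> yb; apply: vB; rewrite -addrA -natr1 (addrC m%:R) in yb *.
apply: le_trans (ler_normB _ _) _; rewrite lerD// (IH (rho + 1))//.
  by apply: inbox_le (inbox_shift s j bx); rewrite lerD2l gtr0_norm.
by apply: inbox_le bx; rewrite lerDl.
Qed.

(* One step of Marchaud's inequality. *)
Lemma differences_descend m v : (2 <= m)%N -> bounded_on_boxes v ->
  differences_bounded m.+1 v -> differences_bounded m v.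
Proof.
move=> m2 vb H rho.
have [C [C0 HC]] := H (rho + m%:R).
have [B [B0 HB]] := vb (rho + m%:R).
have crude := iter_fdiff_crude HB.
(* From scale [2 * s] to scale [s] the modulus costs 2 * 3/2 = 3, and division by [2 ^+ m >= 4]
   leaves [3 / 4 * K]; the error [m%:R * C] fits into the remaining quarter thanks to the second
   term. The first term covers the scales above 1/2, where [s * e s >= 4^-1]. For [m = 1] the
   division would not compensate the 3. *)
pose K := 4 * (2 ^+ m * B) + 4 * m%:R * C.
have K0 : 0 < K.
  by rewrite ltr_wpDr ?mulr_gt0 ?exprn_gt0// !mulr_ge0// ltW.
exists K; split=> //.
have step x s : inbox rho x -> 0 < s -> s <= 2^-1 ->
  `|iter m (fdiff ((2 * s) *: ebasis j)) v x| <= K * (2 * s * e (2 * s)) ->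
  `|iter m (fdiff (s *: ebasis j)) v x| <= K * (s * e s).
  move=> bx s0 s2 IH.
  have s1 : s <= 1 by lra.
  have es0 := e_ge0 s0.
  set a := s *: ebasis j.
  have aa : (2 * s) *: ebasis j = a + a :> E by rewrite mulr_natl mulr2n scalerDl.
  rewrite aa iter_fdiff_double in IH.
  have := @iter_fsum_approx a m (iter m (fdiff a) v) x (C * (s * e s)).
  have pts i : (i < m)%N -> `|fdiff a (iter m (fdiff a) v) (x + a *+ i)| <= C * (s * e s).
    move=> im; apply: (HC (x + a *+ i) s) => //.
    rewrite /a scalerMnl; apply: inbox_le (inbox_shift (s *+ i) j bx).
    rewrite lerD2l ger0_norm ?mulrn_wge0 ?(ltW s0)// -[s *+ i]mulr_natl.
    apply: le_trans (_ : i%:R * 1 <= _); first by rewrite ler_wpM2l.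
    by rewrite mulr1 ler_nat ltnW.
  move=> /(_ pts) happ.
  set W := iter m (fdiff a) v in happ IH *.
  have pm : 0 < 2 ^+ m :> R by rewrite exprn_gt0.
  have h4 : 4 <= 2 ^+ m :> R.
    have -> : 4 = 2 ^+ 2 :> R by rewrite expr2; lra.
    by rewrite ler_weXn2l// ler1n.
  have e2 := e_double s0.
  have b1 : 2 ^+ m * `|W x| <= K * (3 * (s * e s)) + m%:R * 2 ^+ m * (C * (s * e s)).
    have -> : 2 ^+ m * `|W x| = `|2 ^+ m * W x| by rewrite normrM (ger0_norm (ltW pm)).
    have -> : 2 ^+ m * W x = iter m (fsum a) W x - (iter m (fsum a) W x - 2 ^+ m * W x) by ring.
    apply: le_trans (ler_normB _ _) _; apply: lerD happ.
    apply: le_trans IH _; rewrite ler_wpM2l ?(ltW K0)//.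
    have -> : 3 * (s * e s) = 2 * s * (3 / 2 * e s) by field.
    by rewrite ler_wpM2l// mulr_ge0// ltW.
  have se0 : 0 <= s * e s by rewrite mulr_ge0// ltW.
  rewrite -(ler_pM2l pm); apply: le_trans b1 _.
  have -> : m%:R * 2 ^+ m * (C * (s * e s)) = 2 ^+ m * (m%:R * C * (s * e s)) by ring.
  have hk : K * (3 * (s * e s)) <= 2 ^+ m * (3 / 4 * (K * (s * e s))).
    apply: le_trans (_ : 4 * (3 / 4 * (K * (s * e s))) <= _).
      apply: eq_ler; by field.
    by rewrite ler_wpM2r// !mulr_ge0// ltW.
  apply: le_trans (lerD hk (lexx _)) _; rewrite -mulrDr ler_wpM2l ?(ltW pm)//.
  have : m%:R * C * (s * e s) <= 4^-1 * (K * (s * e s)).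
    rewrite [leRHS]mulrA ler_wpM2r// /K mulrDr.
    have -> : 4^-1 * (4 * m%:R * C) = m%:R * C by field.
    by rewrite lerDr !mulr_ge0 ?exprn_ge0// ltW.
  lra.
have base x s : inbox rho x -> 2^-1 < s -> s <= 1 ->
  `|iter m (fdiff (s *: ebasis j)) v x| <= K * (s * e s).
  move=> bx s2 s1; have s0 : 0 < s by lra.
  apply: le_trans (crude x s bx s0 s1) _.
  have es := e_lin s0 s1.
  have h1 : 4^-1 <= s * e s by have : s * s <= s * e s; [rewrite ler_wpM2l ?(ltW s0)|nra].
  apply: le_trans (_ : K * 4^-1 <= _); last by rewrite ler_wpM2l// ltW.
  have -> : K * 4^-1 = 2 ^+ m * B + m%:R * C by rewrite /K; field.
  by rewrite lerDl mulr_ge0// ltW.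
move=> x s bx s0 s1.
have [n] := half_pow_below s0.
elim: n s s0 s1 => [|n IH] s s0 s1 hn; first by apply: base => //; rewrite expr1 in hn.
have [s2|s2] := lerP s 2^-1; last exact: base.
apply: step => //; apply: IH; [lra|lra|].
by move: hn; rewrite exprS; lra.
Qed.

Lemma geometric_limit (r : nat -> R) (c : R) : 0 <= c ->
  (forall k, `|r k.+1 - r k| <= c * theta ^+ k) ->
  cvg (r k @[k --> \oo]) /\
  forall k, `|r k - lim (r k @[k --> \oo])| <= c / (1 - theta) * theta ^+ k.
Proof.
move=> c0 hr; have /andP[t0 t1] := theta01.
have d0 : 0 < 1 - theta by lra.
pose d := c / (1 - theta).
have dE : d - d * theta = c by rewrite /d; field; rewrite gt_eqF.
have d_ge0 : 0 <= d by rewrite divr_ge0// ltW.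
have step n k : `|r (k + n)%N - r k| <= d * theta ^+ k - d * theta ^+ (k + n).
  elim: n => [|n IH]; first by rewrite addn0 !subrr normr0.
  rewrite addnS; have -> : r (k + n).+1 - r k = (r (k + n).+1 - r (k + n)%N) + (r (k + n)%N - r k) by ring.
  apply: le_trans (ler_normD _ _) _.
  have := hr (k + n)%N; rewrite exprS -dE.
  have -> : (d - d * theta) * theta ^+ (k + n) = d * theta ^+ (k + n) - d * (theta * theta ^+ (k + n)) by ring.
  lra.
have le_step n k : (k <= n)%N -> `|r n - r k| <= d * theta ^+ k.
  move=> kn; rewrite -(subnKC kn); apply: le_trans (step _ _) _.
  by rewrite gerBl mulr_ge0// exprn_ge0.
have th : (fun k => d * theta ^+ k) @ \oo --> 0.
  rewrite -[0](mulr0 d); apply: cvgMr; apply: cvg_expr.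
  by rewrite ger0_norm.
have rc : cvg (r k @[k --> \oo]).
  apply/cauchy_cvgP/cauchyP => eps eps0.
  have [n _ hn] : \forall k \near \oo, `|0 - d * theta ^+ k| < eps.
    by move/cvgrPdist_lt : th; apply.
  exists (r n); exists n => // k /= nk; rewrite /ball/= distrC.
  apply: le_lt_trans (le_step _ _ nk) _.
  by have := hn n (leqnn n); rewrite /= sub0r normrN ger0_norm// mulr_ge0// exprn_ge0.
split=> // k.
have hl : `|r k - r n| @[n --> \oo] --> `|r k - lim (r k @[k --> \oo])|.
  by apply: cvg_norm; apply: cvgB; [exact: cvg_cst|exact: rc].
apply: (@closed_cvg _ _ _ eventually_filter (fun n => `|r k - r n|) [set y | y <= d * theta ^+ k]) hl.
  exact: closed_le.
by exists k => // n /= kn; rewrite distrC le_step.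
Qed.

End Marchaud.

(** * Derivatives from dyadic difference quotients *)

Section Differentiation.
Context {R : realType} {N : nat}.
Local Notation E := 'rV[R]_N.
Implicit Types (v w : E -> R) (x y : E).

Definition inball (x : E) (d : R) (y : E) := forall i, `|y 0 i - x 0 i| < d.

Lemma nbhs_inball x (A : set E) : nbhs x A <-> exists d : R, 0 < d /\ forall y, inball x d y -> A y.
Proof.
split=> [/nbhs_ballP[d /= d0 hd]|[d [d0 hd]]].
  exists d; split=> // y yx; apply: hd; split=> // i k; rewrite ord1 /ball/= distrC; exact: yx.
apply/nbhs_ballP; exists d => //= y [_ yx]; apply: hd => i.
by have := yx 0 i; rewrite /ball/= distrC.
Qed.

Lemma rV_cvgP v x (l : R) : (v y @[y --> x] --> l) <->
  forall e : R, 0 < e -> exists d : R, 0 < d /\ forall y, inball x d y -> `|v y - l| < e.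
Proof.
split=> [/cvgrPdist_lt H e e0|H].
  have /nbhs_inball[d [d0 hd]] := H e e0.
  by exists d; split=> // y /hd; rewrite distrC.
apply: (proj2 (@cvgrPdist_lt _ _ _ (nbhs x) (nbhs_filter x) v l)) => e e0; apply/nbhs_inball.
by have [d [d0 hd]] := H e e0; exists d; split=> // y /hd; rewrite distrC.
Qed.

Lemma inball_shift x y d (t : R) j : inball x d y -> inball x (d + `|t|) (y + t *: ebasis j).
Proof.
move=> yx i; rewrite mxE [X in _ + X - _]mxE ebasisE addrAC.
apply: le_lt_trans (ler_normD _ _) _; rewrite ltr_leD// normrM.
by case: (i == j); rewrite /= ?normr1 ?normr0 ?mulr1 ?mulr0.
Qed.

Lemma continuous_fdiff (a : E) v : continuous v -> continuous (fdiff a v).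
Proof.
move=> vc x; apply/rV_cvgP => e e0.
have e2 : 0 < e / 2 by rewrite divr_gt0.
have [d1 [d10 h1]] := (rV_cvgP _ _ _).1 (vc (x + a)) _ e2.
have [d2 [d20 h2]] := (rV_cvgP _ _ _).1 (vc x) _ e2.
exists (Num.min d1 d2); split; first by rewrite lt_min d10.
move=> y xy.
have y1 : inball (x + a) d1 (y + a).
  move=> i; rewrite !mxE opprD addrACA subrr addr0.
  by apply: lt_le_trans (xy i) _; rewrite ge_min lexx.
have y2 : inball x d2 y by move=> i; apply: lt_le_trans (xy i) _; rewrite ge_min lexx orbT.
have := h1 _ y1; have := h2 _ y2; rewrite /fdiff => a2 a1.
have -> : v (y + a) - v y - (v (x + a) - v x) = (v (y + a) - v (x + a)) - (v y - v x) by ring.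
apply: le_lt_trans (ler_normB _ _) _; lra.
Qed.

Lemma continuous_rV_cst (c : R) : continuous (fun _ : E => c).
Proof.
by move=> x; apply/rV_cvgP => e e0; exists 1; split=> // y _; rewrite subrr normr0.
Qed.

Lemma continuous_rV_M v w : continuous v -> continuous w -> continuous (fun x => v x * w x).
Proof. by move=> vc wc x; exact: (@cvgM _ _ (nbhs x) (nbhs_filter x) _ _ _ _ (vc x) (wc x)). Qed.

Lemma continuous_rV_D v w : continuous v -> continuous w -> continuous (fun x => v x + w x).
Proof. by move=> vc wc x; exact: (@cvgD _ _ _ (nbhs x) (nbhs_filter x) _ _ _ _ (vc x) (wc x)). Qed.

Lemma inball_refl x d : 0 < d -> inball x d x.
Proof. by move=> d0 i; rewrite subrr normr0. Qed.

Lemma inball_inbox x y d rho : inbox rho x -> inball x d y -> inbox (rho + d) y.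
Proof.
move=> bx xy i; have -> : y 0 i = x 0 i + (y 0 i - x 0 i) by ring.
by apply: le_trans (ler_normD _ _) _; rewrite lerD// ltW.
Qed.

Lemma inbox_exists x : exists rho : R, inbox rho x.
Proof.
exists (\sum_i `|x 0 i|) => i; rewrite (bigD1 i)//= lerDl.
by apply: sumr_ge0.
Qed.

(** Because the base point [y] may vary, positive increments are enough: a negative increment from
    [x] is a positive one from [x + t *: ebasis j]. *)
Lemma is_derive_criterion v w j x :
  (forall e : R, 0 < e -> exists d : R, 0 < d /\ forall y s, inball x d y -> 0 < s -> s < d ->
    `|fdiff (s *: ebasis j) v y - s * w x| <= e * s) ->
  is_derive x (ebasis j) v (w x).
Proof.
move=> H.
have hc : (fun t : R => t^-1 *: (v (t *: ebasis j + x) - v x)) @ 0^' --> w x.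
  apply/cvgrPdist_le => e e0; have [d [d0 hd]] := H e e0.
  exists d => //= t; rewrite /ball_/= sub0r normrN => td t0.
  have -> : w x - t^-1 *: (v (t *: ebasis j + x) - v x) =
      - ((v (x + t *: ebasis j) - v x - t * w x) / t).
    rewrite (addrC (t *: _)) -[t^-1 *: _]/(t^-1 * (v (x + t *: ebasis j) - v x)).
    by field.
  rewrite normrN normf_div ler_pdivrMr ?normr_gt0//.
  have [tp|tn] := ltrP 0 t.
    by rewrite (gtr0_norm tp) in td *; exact: hd x t (inball_refl x d0) tp td.
  have tn' : t < 0 by rewrite lt_neqAle t0.
  have yx : inball x d (x + t *: ebasis j).
    move=> i; rewrite mxE [X in _ + X - _]mxE ebasisE addrAC subrr add0r normrM.
    by case: (i == j); rewrite /= ?normr1 ?normr0 ?mulr1 ?mulr0.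
  rewrite (ltr0_norm tn') in td *.
  have nt : 0 < - t by rewrite oppr_gt0.
  have := hd _ _ yx nt td; rewrite /fdiff scaleNr addrK.
  by rewrite -normrN; congr (_ <= _); congr (`|_|); ring.
apply: DeriveDef; first by apply/cvg_ex; exists (w x).
exact: cvg_lim hc.
Qed.

Variables (e : R -> R) (theta : R) (j : 'I_N).
Hypotheses (e_ge0 : forall s, 0 < s -> 0 <= e s)
  (e_half : forall s, 0 < s -> e (s / 2) <= theta * e s)
  (theta01 : 0 <= theta < 1).

Let dya (k : nat) : R := 2^-1 ^+ k.
Let dya0 k : 0 < dya k. Proof. by rewrite exprn_gt0. Qed.
Let dya1 k : dya k <= 1.
Proof. by rewrite exprn_ile1// invf_le1// ler1n. Qed.

Let q v (k : nat) : E -> R := fun x => (dya k)^-1 * fdiff (dya k *: ebasis j) v x.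

(** The increment over length [s] is split into [l k] dyadic ones, each equal to the step times
    [q v k] and hence within [c * theta ^+ k] of the step times [w]. As [k] grows, this error
    vanishes and continuity of [v] removes the remainder. *)
Let increment v w (c rho : R) x s W eta : continuous v -> inbox rho x -> 0 < s -> s <= 1 ->
  0 <= c ->
  (forall k y, inbox (rho + 1) y -> `|q v k y - w y| <= c * theta ^+ k) ->
  (forall t, 0 <= t -> t <= s -> `|w (x + t *: ebasis j) - W| <= eta) ->
  `|fdiff (s *: ebasis j) v x - s * W| <= eta * s.
Proof.
move=> vc bx s0 s1 c0 hq hw.
pose l k := Num.truncn (s / dya k).
have sd k : 0 <= s / dya k by rewrite divr_ge0// ltW.
have ls k : (l k)%:R * dya k <= s.
  by rewrite -ler_pdivlMr//; case/andP: (truncn_itv (sd k)).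
have sl k : s - (l k)%:R * dya k <= dya k.
  have /andP[_] := truncn_itv (sd k); rewrite ltr_pdivrMr// -natr1 mulrDl mul1r -/(l k); lra.
have eta0 : 0 <= eta by apply: le_trans (normr_ge0 _) (hw 0 (lexx _) (ltW s0)).
have dlim : dya @ \oo --> (0 : R).
  by apply: cvg_expr; rewrite ger0_norm// invf_lt1// ltr1n.
have slim : (fun k => (l k)%:R * dya k) @ \oo --> s.
  apply: (@squeeze_cvgr _ _ _ _ (fun k => s - dya k) (fun=> s)).
  - by near=> k; rewrite ls andbT; have := sl k; lra.
  - by rewrite -[X in _ --> X]subr0; apply: cvgB; [exact: cvg_cst|].
  - exact: cvg_cst.
have plim : (fun k => v (x + ((l k)%:R * dya k) *: ebasis j)) @ \oo --> v (x + s *: ebasis j).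
  have vs : v y @[y --> x + s *: ebasis j] --> v (x + s *: ebasis j) by exact: vc.
  apply: (cvg_comp _ _ _ vs).
  by apply: cvgD; [exact: cvg_cst|apply: cvgZr_tmp; exact: slim].
have step k : `|v (x + ((l k)%:R * dya k) *: ebasis j) - v x - (l k)%:R * dya k * W|
    <= s * (eta + c * theta ^+ k).
  have th0 : 0 <= eta + c * theta ^+ k.
    by rewrite addr_ge0// mulr_ge0// exprn_ge0//; case/andP: theta01.
  apply: (@le_trans _ _ ((l k)%:R * dya k * (eta + c * theta ^+ k))); last by rewrite ler_wpM2r.
  have : forall m, (m <= l k)%N -> `|v (x + (m%:R * dya k) *: ebasis j) - v x - m%:R * dya k * W|
    <= m%:R * dya k * (eta + c * theta ^+ k); last exact.
  elim=> [_|m IH ml]; first by rewrite !mul0r scale0r addr0 subrr subr0 normr0.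
  set y := x + (m%:R * dya k) *: ebasis j.
  have -> : x + (m.+1%:R * dya k) *: ebasis j = y + dya k *: ebasis j.
    by rewrite /y -addrA -scalerDl -natr1 mulrDl mul1r.
  have -> : v (y + dya k *: ebasis j) - v x - m.+1%:R * dya k * W =
     (v y - v x - m%:R * dya k * W) + dya k * (q v k y - W).
    by rewrite /q /fdiff -natr1; field; rewrite gt_eqF.
  have -> : m.+1%:R * dya k * (eta + c * theta ^+ k) = m%:R * dya k * (eta + c * theta ^+ k) + dya k * (eta + c * theta ^+ k).
    by rewrite -natr1; ring.
  apply: le_trans (ler_normD _ _) _; rewrite lerD ?IH ?(ltnW ml)//.
  rewrite normrM (gtr0_norm (dya0 k)) ler_wpM2l ?(ltW (dya0 k))//.
  have ms : m%:R * dya k <= s.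
    by apply: le_trans (ls k); rewrite ler_wpM2r ?(ltW (dya0 k))// ler_nat ltnW.
  have m0 : 0 <= m%:R * dya k by rewrite mulr_ge0// ltW.
  have yb : inbox (rho + 1) y.
    by apply: inbox_le (inbox_shift _ _ bx); rewrite lerD2l ger0_norm//; lra.
  have -> : q v k y - W = (w y - W) + (q v k y - w y) by ring.
  by apply: le_trans (ler_normD _ _) _; rewrite lerD ?hq// hw.
have lim1 : `|v (x + ((l k)%:R * dya k) *: ebasis j) - v x - (l k)%:R * dya k * W| @[k --> \oo]
   --> `|fdiff (s *: ebasis j) v x - s * W|.
  apply: cvg_norm; apply: cvgB; first by apply: cvgB; [exact: plim|exact: cvg_cst].
  by apply: cvgM; [exact: slim|exact: cvg_cst].
have lim2 : s * (eta + c * theta ^+ k) @[k --> \oo] --> eta * s.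
  rewrite [X in _ --> X](_ : _ = s * (eta + c * 0)); last by rewrite mulr0 addr0 mulrC.
  apply: cvgMr; apply: cvgD; first exact: cvg_cst.
  apply: cvgMr; apply: cvg_expr; have /andP[t0 t1] := theta01; by rewrite ger0_norm.
by apply: (ler_cvg_to lim1 lim2); near=> k; exact: step.
Unshelve. all: by end_near.
Qed.

(** Two consecutive dyadic quotients differ by a second difference divided by the step, hence by a
    multiple of [theta ^+ k], uniformly on boxes. The quotients converge uniformly to a continuous
    limit, which [increment] identifies as the derivative. *)
Lemma second_differences_derivable v : continuous v ->
  differences_bounded e j 2 v ->
  exists w, continuous w /\ forall x, is_derive x (ebasis j) v (w x).
Proof.
move=> vc H; have /andP[t0 t1] := theta01.
have e1 : 0 <= e 1 by exact: e_ge0.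
have edya k : e (dya k) <= theta ^+ k * e 1.
  elim: k => [|k IH]; first by rewrite /dya !expr0 mul1r.
  have -> : dya k.+1 = dya k / 2 by rewrite /dya exprS mulrC.
  apply: le_trans (e_half (dya0 k)) _; rewrite exprS -mulrA ler_wpM2l//.
have hq (rho : R) : exists c : R, 0 <= c /\ forall k x, inbox rho x ->
    cvg (q v k x @[k --> \oo]) /\
    `|q v k x - lim (q v k x @[k --> \oo])| <= c * theta ^+ k.
  have [C [C0 HC]] := H rho.
  have c0 : 0 <= C * e 1 by rewrite mulr_ge0// ltW.
  exists (C * e 1 / (1 - theta)); split; first by rewrite divr_ge0// subr_ge0 ltW.
  move=> k x bx.
  have hd n : `|q v n.+1 x - q v n x| <= C * e 1 * theta ^+ n.
    have dE : dya n = dya n.+1 + dya n.+1 by rewrite /dya exprS; field.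
    have dE2 : dya n = 2 * dya n.+1 by rewrite dE; ring.
    have -> : q v n.+1 x - q v n x = - (dya n)^-1 * iter 2 (fdiff (dya n.+1 *: ebasis j)) v x.
      have xE : x + dya n *: ebasis j = x + dya n.+1 *: ebasis j + dya n.+1 *: ebasis j.
        by rewrite [in LHS]dE scalerDl addrA.
      rewrite /q /= /fdiff xE dE2; field; exact: lt0r_neq0.
    have di : 0 < (dya n)^-1 by rewrite invr_gt0.
    rewrite normrM normrN (gtr0_norm di) ler_pdivrMl//.
    apply: le_trans (HC x (dya n.+1) bx (dya0 _) (dya1 _)) _.
    have -> : dya n * (C * e 1 * theta ^+ n) = C * (dya n * (theta ^+ n * e 1)) by ring.
    rewrite ler_wpM2l ?(ltW C0)//.
    apply: ler_pM; rewrite ?e_ge0 ?(ltW (dya0 _))//.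
      by rewrite dE lerDl ltW.
    apply: le_trans (edya _) _; rewrite ler_wpM2r// exprS ler_piMl// ?exprn_ge0// ltW//.
  have [h1 h2] := geometric_limit theta01 c0 hd.
  by split.
pose w x : R := lim (q v k x @[k --> \oo]).
have qc k : continuous (q v k).
  exact: (continuous_rV_M (@continuous_rV_cst (dya k)^-1) (@continuous_fdiff (dya k *: ebasis j) v vc)).
have wc : continuous w.
  move=> x; apply/rV_cvgP => eps eps0.
  have [rho bx] := inbox_exists x.
  have [c [c0 hc]] := hq (rho + 1).
  have e30 : 0 < eps / 3 by rewrite divr_gt0.
  have th : c * theta ^+ k @[k --> \oo] --> 0.
    rewrite -[X in _ --> X](mulr0 c); apply: cvgMr; apply: cvg_expr.
    by rewrite ger0_norm.
  have [k hk] : exists k, c * theta ^+ k < eps / 3.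
    have [n _ hn] : \forall k \near \oo, `|0 - c * theta ^+ k| < eps / 3.
      by move/cvgrPdist_lt : th; apply.
    exists n; have := hn n (leqnn n); rewrite /= sub0r normrN ger0_norm//.
    by rewrite mulr_ge0// exprn_ge0.
  have [d [d0 hd]] := (rV_cvgP _ _ _).1 (qc k x) _ e30.
  exists (Num.min d 1); split; first by rewrite lt_min d0 ltr01.
  move=> y xy.
  have yd : inball x d y by move=> i; apply: lt_le_trans (xy i) _; rewrite ge_min lexx.
  have y1 : inball x 1 y by move=> i; apply: lt_le_trans (xy i) _; rewrite ge_min lexx orbT.
  have by1 := inball_inbox bx y1.
  have bx1 : inbox (rho + 1) x by apply: inbox_le bx; rewrite lerDl.
  have h1 := (hc k y by1).2; have h2 := (hc k x bx1).2; have h3 := hd y yd.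
  rewrite -/(w y) in h1; rewrite -/(w x) in h2.
  have -> : w y - w x = - (q v k y - w y) + (q v k y - q v k x) + (q v k x - w x) by ring.
  apply: le_lt_trans (ler_normD _ _) _.
  have := ler_normD (- (q v k y - w y)) (q v k y - q v k x); rewrite normrN.
  lra.
exists w; split=> // x; apply: is_derive_criterion => eps eps0.
have [d [d0 hd]] := (rV_cvgP _ _ _).1 (wc x) _ eps0.
have [rho bx] := inbox_exists x.
have [c [c0 hc]] := hq (rho + 1 + 1).
exists (Num.min (d / 2) 1); split; first by rewrite lt_min ltr01 andbT divr_gt0.
move=> y s xy s0; rewrite lt_min => /andP[sd s1].
have yd : inball x (d / 2) y by move=> i; apply: lt_le_trans (xy i) _; rewrite ge_min lexx.
have y1 : inball x 1 y by move=> i; apply: lt_le_trans (xy i) _; rewrite ge_min lexx orbT.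
have by1 := inball_inbox bx y1.
apply: (increment (w := w) vc by1 s0 (ltW s1) c0).
  by move=> k z bz; exact: (hc k z bz).2.
move=> t tt0 ts; apply: ltW; apply: hd => i.
apply: lt_le_trans (inball_shift t j yd i) _; rewrite ger0_norm//; lra.
Qed.

End Differentiation.

(** * Passage to the limit *)

Section UltrafilterLimits.
Context {R : realType} (UF : set_system nat) {UFU : UltraFilter UF}.
Hypothesis UFoo : \oo `<=` UF.
Implicit Types (a b : nat -> R) (l : R).

Lemma near_ultra (P : nat -> Prop) n0 : (forall n, (n0 <= n)%N -> P n) -> \forall n \near UF, P n.
Proof. by move=> h; apply: UFoo; exists n0. Qed.

(** The limit is the supremum of the levels below [a] on a set of the ultrafilter; for a level that
    is not such, the ultrafilter contains the complementary set. *)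
Lemma ultra_cvg_bounded a C n0 : (forall n, (n0 <= n)%N -> `|a n| <= C) ->
  cvg (a n @[n --> UF]).
Proof.
move=> aC; pose S : set R := [set x | UF [set n | x <= a n]].
have nS x : ~ S x -> UF [set n | a n < x].
  move=> nSx; case: (in_ultra_setVsetC [set n | x <= a n] UFU) => // h.
  by apply: filterS h => n /=; rewrite ltNge => /negP.
have S0 : has_sup S.
  split.
    exists (- C); apply: UFoo; exists n0 => // n /= nn.
    by have := aC n nn; rewrite ler_norml => /andP[].
  exists C => x Sx; rewrite leNgt; apply/negP => Cx.
  have h : UF [set n | `|a n| <= C] by apply: UFoo; exists n0.
  have [n [/= h1 h2]] := filter_ex (filterI Sx h).
  have := le_trans h1 (ler_norm _); lra.
apply/cvg_ex; exists (sup S); apply/cvgrPdist_lt => e e0.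
have [x Sx xs] := sup_adherent e0 S0.
have : ~ S (sup S + e / 2).
  move=> h; have := ub_le_sup S0.2 h; lra.
move=> /nS h; apply: filterS (filterI Sx h) => n /= [h1 h2].
rewrite ltr_norml; apply/andP; split; lra.
Qed.

Lemma ultra_cvg_close a b l : b n @[n --> UF] --> l ->
  (forall e : R, 0 < e -> exists n0, forall n, (n0 <= n)%N -> `|a n - b n| <= e) ->
  a n @[n --> UF] --> l.
Proof.
move=> /cvgrPdist_lt bl ab; apply/cvgrPdist_lt => e e0.
have e2 : 0 < e / 2 by rewrite divr_gt0.
have [n0 hn0] := ab _ e2.
have h : UF [set n | `|a n - b n| <= e / 2] by apply: UFoo; exists n0.
apply: filterS (filterI (bl _ e2) h) => n /= [h1 h2].
have -> : l - a n = (l - b n) - (a n - b n) by ring.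
apply: le_lt_trans (ler_normB _ _) _; lra.
Qed.

Lemma ultra_le a b l l' n0 : a n @[n --> UF] --> l -> b n @[n --> UF] --> l' ->
  (forall n, (n0 <= n)%N -> a n <= b n) -> l <= l'.
Proof. by move=> al bl ab; apply: ler_cvg_to al bl _; exact: near_ultra ab. Qed.

Lemma ultra_norm_le a l C n0 : a n @[n --> UF] --> l ->
  (forall n, (n0 <= n)%N -> `|a n| <= C) -> `|l| <= C.
Proof. by move=> al aC; apply: ultra_le (cvg_norm al) (cvg_cst C) aC. Qed.

End UltrafilterLimits.

Section LatticePaths.
Context {R : realType} {N : nat}.
Local Notation lat := 'rV[int]_N.

(** The coordinates are changed one at a time. Every hybrid of [k] and [k'] stays in the box, as the
    box is a product, and each move is a difference in one direction. *)
Lemma lattice_path (z : lat -> R) (k k' : lat) (rho m d F : R) : 0 < m ->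
  (forall (x : lat) j (l : nat), box rho m x -> (0 < l)%N -> l%:R * m <= d ->
     `|fdiff (ee j *+ l) z x| <= F) ->
  0 <= F -> box rho m k -> box rho m k' -> (forall j, `|m * (k' 0 j - k 0 j)%:~R| <= d) ->
  `|z k' - z k| <= N%:R * F.
Proof.
move=> m0 zF F0 bk bk' kk'.
pose hyb (i : nat) : lat := \row_j (if (j < i)%N then k' 0 j else k 0 j).
have bh i : box rho m (hyb i) by move=> j; rewrite mxE; case: ifP => _; [exact: bk'|exact: bk].
have h0 : hyb 0%N = k by apply/rowP => j; rewrite mxE.
have hN : hyb N = k' by apply/rowP => j; rewrite mxE ltn_ord.
suff H i : (i <= N)%N -> `|z (hyb i) - z k| <= i%:R * F by rewrite -hN H.
elim: i => [_|i IH iN]; first by rewrite h0 subrr normr0 mul0r.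
pose j := Ordinal iN.
have hybS (c : int) : c = k' 0 j - k 0 j -> hyb i.+1 = hyb i + c *: ee j.
  move=> ->; apply/rowP => j'; rewrite [in RHS]mxE [X in _ = _ + X]mxE eeE !mxE ltnS leq_eqVlt.
  have -> : (nat_of_ord j' == i) = (j' == j) by [].
  case: (eqVneq j' j) => [->|_]/=; rewrite ?ltnn ?mulr1 ?mulr0 ?addr0//.
  by rewrite addrC subrK.
have posR (l : nat) : (l%:Z)%:~R = l%:R :> R by [].
have step : `|z (hyb i.+1) - z (hyb i)| <= F.
  have := kk' j; rewrite normrM (gtr0_norm m0).
  set c := k' 0 j - k 0 j => hc.
  have [l [lc|lc]] : exists l : nat, c = l%:Z \/ c = - l%:Z.
    by exists `|c|%N; clear; lia.
  - case: l lc => [|l] lc.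
      by rewrite (hybS c erefl) lc scale0r addr0 subrr normr0.
    have -> : hyb i.+1 = hyb i + ee j *+ l.+1.
      by rewrite (hybS c erefl) lc -scaler_nat natz.
    apply: zF => //; apply: le_trans hc; rewrite lc posR mulrC.
    by rewrite ger0_norm.
  - case: l lc => [|l] lc.
      by rewrite (hybS c erefl) lc oppr0 scale0r addr0 subrr normr0.
    have hE : hyb i = hyb i.+1 + ee j *+ l.+1.
      by rewrite (hybS c erefl) lc scaleNr -[ee j *+ _]scaler_nat natz subrK.
    rewrite distrC hE; apply: zF => //; apply: le_trans hc; rewrite lc rmorphN/= normrN posR mulrC.
    by rewrite ger0_norm.
have -> : z (hyb i.+1) - z k = (z (hyb i.+1) - z (hyb i)) + (z (hyb i) - z k) by ring.
apply: le_trans (ler_normD _ _) _; rewrite -natr1 mulrDl mul1r addrC.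
by rewrite lerD// IH// ltnW.
Qed.

End LatticePaths.

(** * The limit of the discrete solutions and its derivatives *)

Section Limit.
Context {R : realType} {N : nat} (UF : set_system nat) {UFU : UltraFilter UF}.
Local Notation lat := 'rV[int]_N.
Local Notation E := 'rV[R]_N.
Variables (h : nat -> R) (u : nat -> lat -> R) (q : nat).
Hypotheses (UFoo : \oo `<=` UF) (h0 : forall n, 0 < h n) (hn : forall n, h n <= n.+1%:R^-1)
  (q2 : (2 <= q)%N).
Hypothesis u_bound : locally_uniformly h (fun (C : R) n k => `|u n k| <= C).
Hypothesis u_grad : locally_uniformly h (fun (C : R) n k =>
  forall i, `|fdiff (ee i) (u n) k| <= h n * C).
Hypothesis u_grad_holder : locally_uniformly h (fun (C : R) n k =>
  forall i j (l : nat) (t : R), (0 < l)%N -> 0 < t -> t <= 1 -> l%:R * h n = t ^+ 2 ->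
   `|fdiff (ee i) (fdiff (ee j *+ l) (u n)) k| <= h n * (C * t)).
Hypothesis u_higher : locally_uniformly h (fun (C : R) n k =>
  forall i j (l : nat) (s : R), (0 < l)%N -> 0 < s -> s <= 1 -> l%:R * h n = s ^+ (2 * q) ->
   `|fdiff (ee i) (iter (2 * q).+1 (fdiff (ee j *+ l)) (u n)) k| <= h n * (C * s ^+ (2 * q).+1)).

Let h1 n : h n <= 1.
Proof. by apply: le_trans (hn n) _; rewrite invf_le1// ler1n. Qed.

Lemma mesh_small (e : R) : 0 < e -> exists n0 : nat, forall n, (n0 <= n)%N -> h n <= e.
Proof.
move=> e0; have [n0 hn0] := nat_above e^-1; exists n0 => n nn.
apply: le_trans (hn n) _; rewrite -[e]invrK lef_pV2 ?posrE ?invr_gt0//.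
by apply: le_trans (hn0 n nn) _; rewrite ler_nat.
Qed.

Lemma mesh_small_mul (c e : R) : 0 <= c -> 0 < e ->
  exists n0 : nat, forall n, (n0 <= n)%N -> c * h n <= e.
Proof.
move=> c0 e0; have c1 : 0 < c + 1 by rewrite ltr_wpDl.
have [n0 hn0] := mesh_small (divr_gt0 e0 c1); exists n0 => n nn.
have := hn0 n nn; rewrite ler_pdivlMr//; have := h0 n; nra.
Qed.

Definition fl n (x : E) : lat := \row_j Num.floor (x 0 j / h n).

Definition near_mesh n (k : lat) (x : E) (c : R) :=
  forall j, `|h n * (k 0 j)%:~R - x 0 j| <= c * h n.

Lemma fl_near n x : near_mesh n (fl n x) x 1.
Proof.
move=> j; rewrite mxE mul1r; have hp := h0 n.
have /andP[f1 f2] := real_floor_itv (num_real (x 0 j / h n)).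
rewrite ler_pdivlMr// in f1; rewrite intrD ltr_pdivrMr// in f2.
by rewrite ler_norml mulrC; apply/andP; split; lra.
Qed.

Lemma near_mesh_box n k x c rho : 0 <= c -> near_mesh n k x c -> inbox rho x ->
  box (rho + c) (h n) k.
Proof.
move=> c0 kx bx j; have -> : h n * (k 0 j)%:~R = x 0 j + (h n * (k 0 j)%:~R - x 0 j) by ring.
apply: le_trans (ler_normD _ _) _; rewrite lerD//.
by apply: le_trans (kx j) _; rewrite ler_piMr.
Qed.

Lemma near_mesh_dist n k k' x y c c' d : near_mesh n k x c -> near_mesh n k' y c' ->
  (forall j, `|y 0 j - x 0 j| <= d) -> forall j, `|h n * (k' 0 j - k 0 j)%:~R| <= d + (c + c') * h n.
Proof.
move=> kx ky xy j.
have -> : h n * (k' 0 j - k 0 j)%:~R =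
  (y 0 j - x 0 j) + ((h n * (k' 0 j)%:~R - y 0 j) - (h n * (k 0 j)%:~R - x 0 j)).
  by rewrite intrB; ring.
apply: le_trans (ler_normD _ _) _; rewrite lerD//.
apply: le_trans (ler_normB _ _) _; have := kx j; have := ky j; lra.
Qed.

Lemma discrete_lipschitz (rho : R) : exists (C : R) (n0 : nat), 0 < C /\
  forall n (k k' : lat) (d : R), (n0 <= n)%N -> box rho (h n) k -> box rho (h n) k' ->
    0 <= d -> d <= 1 -> (forall j, `|h n * (k' 0 j - k 0 j)%:~R| <= d) ->
    `|u n k' - u n k| <= C * d.
Proof.
have [G [n0 [G0 uG]]] := u_grad (rho + 1).
exists (N%:R * G + 1), n0; split; first by rewrite ltr_wpDl// mulr_ge0// ltW.
move=> n k k' d nn bk bk' d0 d1 kk'.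
apply: (@le_trans _ _ (N%:R * (d * G))); last first.
  have -> : N%:R * (d * G) = N%:R * G * d by ring.
  by rewrite ler_wpM2r// lerDl.
apply: (lattice_path (h0 n) _ _ bk bk' kk'); last by rewrite mulr_ge0// ltW.
move=> x j l bx l0 ld.
apply: (@le_trans _ _ (l%:R * (h n * G))); last by rewrite mulrA ler_wpM2r// ltW.
apply: fdiff_path => m ml; apply: uG => //.
apply: box_le (box_eeMn j m (ltW (h0 n)) bx); rewrite lerD2l.
by apply: le_trans d1; apply: le_trans ld; rewrite ler_wpM2r ?(ltW (h0 n))// ler_nat ltnW.
Qed.

Lemma discrete_gradient_holder (rho : R) : exists (C : R) (n0 : nat), 0 < C /\
  forall n (k k' : lat) (d : R), (n0 <= n)%N -> box rho (h n) k -> box rho (h n) k' ->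
    0 <= d -> d <= 1 -> (forall j, `|h n * (k' 0 j - k 0 j)%:~R| <= d) ->
    forall i, `|(h n)^-1 * fdiff (ee i) (u n) k' - (h n)^-1 * fdiff (ee i) (u n) k| <= C * Num.sqrt d.
Proof.
have [G [n0 [G0 uG]]] := u_grad_holder rho.
exists (N%:R * G + 1), n0; split; first by rewrite ltr_wpDl// mulr_ge0// ltW.
move=> n k k' d nn bk bk' d0 d1 kk' i.
have hp := h0 n; have hi : 0 < (h n)^-1 by rewrite invr_gt0.
rewrite -mulrBr normrM (gtr0_norm hi) ler_pdivrMl//.
apply: (@le_trans _ _ (N%:R * (h n * (G * Num.sqrt d)))); last first.
  have -> : N%:R * (h n * (G * Num.sqrt d)) = h n * (N%:R * G * Num.sqrt d) by ring.
  by rewrite ler_wpM2l ?(ltW hp)// ler_wpM2r ?sqrtr_ge0// lerDl.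
apply: (lattice_path hp _ _ bk bk' kk'); last by rewrite !mulr_ge0 ?sqrtr_ge0// ltW.
move=> x j l bx l0 ld.
have lh0 : 0 < l%:R * h n by rewrite mulr_gt0// ltr0n.
rewrite fdiffC; apply: (@le_trans _ _ (h n * (G * Num.sqrt (l%:R * h n)))); last first.
  by rewrite !ler_wpM2l ?(ltW hp) ?(ltW G0)// ler_wsqrtr.
apply: uG => //; first by rewrite sqrtr_gt0.
  by rewrite -[leRHS]sqrtr1 ler_wsqrtr// (le_trans ld).
by rewrite sqr_sqrtr// ltW.
Qed.

(* Limits along an ultrafilter replace the extraction of convergent subsequences. *)
Definition ulim (x : E) : R := lim (u n (fl n x) @[n --> UF]).
Definition vlim i (x : E) : R := lim ((h n)^-1 * fdiff (ee i) (u n) (fl n x) @[n --> UF]).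

Let box_fl n x rho : inbox rho x -> box (rho + 1) (h n) (fl n x).
Proof. by move=> bx; apply: near_mesh_box (fl_near n x) bx. Qed.

Let ulim_cvg x : u n (fl n x) @[n --> UF] --> ulim x.
Proof.
have [rho bx] := inbox_exists x; have [C [n0 [C0 uC]]] := u_bound (rho + 1).
apply: (ultra_cvg_bounded UFoo (C := C) (n0 := n0)) => n nn.
by apply: uC => //; exact: box_fl.
Qed.

Let vlim_cvg i x : (h n)^-1 * fdiff (ee i) (u n) (fl n x) @[n --> UF] --> vlim i x.
Proof.
have [rho bx] := inbox_exists x; have [C [n0 [C0 uC]]] := u_grad (rho + 1).
apply: (ultra_cvg_bounded UFoo (C := C) (n0 := n0)) => n nn.
have hi : 0 < (h n)^-1 by rewrite invr_gt0.
rewrite normrM (gtr0_norm hi) ler_pdivrMl//.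
by apply: uC => //; exact: box_fl.
Qed.

Let close_data x c (k : nat -> lat) : (forall n, near_mesh n (k n) x c) -> 0 <= c ->
  exists rho : R, [/\ forall n, box rho (h n) (k n), forall n, box rho (h n) (fl n x) &
   forall n j, `|h n * (k n 0 j - fl n x 0 j)%:~R| <= (1 + c) * h n].
Proof.
move=> kx c0; have [rho bx] := inbox_exists x; exists (rho + (c + 1)); split=> n.
- apply: box_le (near_mesh_box c0 (kx n) bx); lra.
- apply: box_le (box_fl n bx); lra.
move=> j; have := near_mesh_dist (fl_near n x) (kx n) (d := 0) _ j; rewrite add0r; apply.
by move=> j'; rewrite subrr normr0.
Qed.

(** Rounding to the lattice does not commute with shifts, so the limit must not depend on which
    lattice point within a fixed number of cells is used; the discrete Lipschitz bound provides
    this. *)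
Lemma ulim_near x c (k : nat -> lat) : 0 <= c -> (forall n, near_mesh n (k n) x c) ->
  u n (k n) @[n --> UF] --> ulim x.
Proof.
move=> c0 kx; have [rho [b1 b2 hd]] := close_data kx c0.
have [C [n0 [C0 uC]]] := discrete_lipschitz rho.
apply: (ultra_cvg_close UFoo (ulim_cvg (x := x))) => e e0.
have c1 : 0 <= 1 + c by lra.
have [n1 hn1] := mesh_small_mul c1 (ltr01 : 0 < 1 :> R).
have [n2 hn2] := mesh_small_mul (mulr_ge0 (ltW C0) c1) e0.
exists (maxn n0 (maxn n1 n2)) => n; rewrite !geq_max => /andP[nn0 /andP[nn1 nn2]].
apply: le_trans (hn2 n nn2); rewrite -mulrA.
by apply: uC => //; [rewrite mulr_ge0// ltW|exact: hn1].
Qed.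

Lemma vlim_near i x c (k : nat -> lat) : 0 <= c -> (forall n, near_mesh n (k n) x c) ->
  (h n)^-1 * fdiff (ee i) (u n) (k n) @[n --> UF] --> vlim i x.
Proof.
move=> c0 kx; have [rho [b1 b2 hd]] := close_data kx c0.
have [C [n0 [C0 uC]]] := discrete_gradient_holder rho.
apply: (ultra_cvg_close UFoo (vlim_cvg (i := i) (x := x))) => e e0.
have c1 : 0 <= 1 + c by lra.
have [n1 hn1] := mesh_small_mul c1 (ltr01 : 0 < 1 :> R).
have e2 : 0 < (e / C) ^+ 2 by rewrite exprn_gt0// divr_gt0.
have [n2 hn2] := mesh_small_mul c1 e2.
exists (maxn n0 (maxn n1 n2)) => n; rewrite !geq_max => /andP[nn0 /andP[nn1 nn2]].
have ch0 : 0 <= (1 + c) * h n by rewrite mulr_ge0// ltW.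
apply: le_trans (uC n _ _ _ nn0 (b2 n) (b1 n) ch0 (hn1 n nn1) (hd n) i) _.
rewrite -ler_pdivlMl// [leRHS]mulrC.
have ec0 : 0 <= e / C by rewrite divr_ge0// ltW.
rewrite -[leRHS](ger0_norm ec0) -sqrtr_sqr ler_wsqrtr//.
exact: hn2.
Qed.

Let fl_dist (rho : R) x y d : inbox rho x -> inbox rho y -> 0 < d -> d <= 2^-1 ->
  (forall j, `|y 0 j - x 0 j| <= d) -> exists n1, forall n, (n1 <= n)%N ->
  forall j, `|h n * (fl n y 0 j - fl n x 0 j)%:~R| <= 2 * d.
Proof.
move=> bx by1 d0 d1 xy.
have [n1 hn1] := mesh_small_mul (ler0n R 2) d0.
exists n1 => n nn j; apply: le_trans (near_mesh_dist (fl_near n x) (fl_near n y) xy j) _.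
have := hn1 n nn; lra.
Qed.

Lemma ulim_lipschitz (rho : R) : exists C : R, 0 < C /\ forall x y d, inbox rho x -> inbox rho y ->
  0 < d -> d <= 2^-1 -> (forall j, `|y 0 j - x 0 j| <= d) -> `|ulim y - ulim x| <= C * d.
Proof.
have [C [n0 [C0 uC]]] := discrete_lipschitz (rho + 1).
exists (C * 2); split; first by rewrite mulr_gt0.
move=> x y d bx by1 d0 d1 xy; rewrite -mulrA.
have [n1 hn1] := fl_dist bx by1 d0 d1 xy.
apply: (ultra_norm_le UFoo (n0 := maxn n0 n1) (cvgB (ulim_cvg (x := y)) (ulim_cvg (x := x)))).
move=> n; rewrite geq_max => /andP[nn0 nn1].
by apply: uC => //; [exact: box_fl|exact: box_fl|lra|lra|exact: hn1].
Qed.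

Lemma vlim_holder (rho : R) : exists C : R, 0 < C /\ forall i x y d, inbox rho x -> inbox rho y ->
  0 < d -> d <= 2^-1 -> (forall j, `|y 0 j - x 0 j| <= d) -> `|vlim i y - vlim i x| <= C * Num.sqrt (2 * d).
Proof.
have [C [n0 [C0 uC]]] := discrete_gradient_holder (rho + 1).
exists C; split=> // i x y d bx by1 d0 d1 xy.
have [n1 hn1] := fl_dist bx by1 d0 d1 xy.
apply: (ultra_norm_le UFoo (n0 := maxn n0 n1) (cvgB (vlim_cvg (i := i) (x := y)) (vlim_cvg (i := i) (x := x)))).
move=> n; rewrite geq_max => /andP[nn0 nn1].
by apply: uC => //; [exact: box_fl|exact: box_fl|lra|lra|exact: hn1].
Qed.

Lemma continuous_ulim : continuous ulim.
Proof.
move=> x; apply/rV_cvgP => e e0.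
have [rho bx] := inbox_exists x; have [C [C0 HC]] := ulim_lipschitz (rho + 1).
have ec : 0 < e / (2 * C) by rewrite divr_gt0// mulr_gt0.
pose d := Num.min 2^-1 (e / (2 * C)).
have d0 : 0 < d by rewrite lt_min ec invr_gt0 ltr0n.
have d1 : d <= 2^-1 by rewrite ge_min lexx.
have d2 : d <= e / (2 * C) by rewrite ge_min lexx orbT.
exists d; split=> // y xy.
have by1 : inbox (rho + 1) y by apply: inbox_le (inball_inbox bx xy); lra.
have bx1 : inbox (rho + 1) x by apply: inbox_le bx; lra.
apply: le_lt_trans (HC x y d bx1 by1 d0 d1 (fun j => ltW (xy j))) _.
have : C * d <= C * (e / (2 * C)) by rewrite ler_wpM2l// ltW.
have -> : C * (e / (2 * C)) = e / 2 by field; rewrite gt_eqF.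
lra.
Qed.

Let sqrt_small (C e : R) : 0 < C -> 0 < e -> exists d : R, [/\ 0 < d, d <= 2^-1 & C * Num.sqrt (2 * d) <= e].
Proof.
move=> C0 e0; have ec : 0 < (e / C) ^+ 2 / 2 by rewrite divr_gt0// exprn_gt0// divr_gt0.
pose d := Num.min 2^-1 ((e / C) ^+ 2 / 2); exists d; split.
- by rewrite lt_min ec invr_gt0 ltr0n.
- by rewrite ge_min lexx.
have d2 : 2 * d <= (e / C) ^+ 2.
  have : d <= (e / C) ^+ 2 / 2 by rewrite ge_min lexx orbT.
  lra.
rewrite -ler_pdivlMl// [leRHS]mulrC.
have ec0 : 0 <= e / C by rewrite divr_ge0// ltW.
by rewrite -[leRHS](ger0_norm ec0) -sqrtr_sqr ler_wsqrtr.
Qed.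

Lemma continuous_vlim i : continuous (vlim i).
Proof.
move=> x; apply/rV_cvgP => e e0.
have [rho bx] := inbox_exists x; have [C [C0 HC]] := vlim_holder (rho + 1).
have e2 : 0 < e / 2 by lra.
have [d [d0 d1 d2]] := sqrt_small C0 e2.
exists d; split=> // y xy.
have by1 : inbox (rho + 1) y by apply: inbox_le (inball_inbox bx xy); lra.
have bx1 : inbox (rho + 1) x by apply: inbox_le bx; lra.
apply: le_lt_trans (HC i x y d bx1 by1 d0 d1 (fun j => ltW (xy j))) _; lra.
Qed.

Lemma vlim_bounded i : bounded_on_boxes (vlim i).
Proof.
move=> rho; have [C [n0 [C0 uC]]] := u_grad (rho + 1); exists C; split=> // x bx.
apply: (ultra_norm_le UFoo (n0 := n0) (vlim_cvg (i := i) (x := x))) => n nn.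
have hi : 0 < (h n)^-1 by rewrite invr_gt0.
by rewrite normrM (gtr0_norm hi) ler_pdivrMl// uC//; exact: box_fl.
Qed.

Let ln (s : R) n := Num.truncn (s / h n).

Let ln_le s n : 0 <= s -> (ln s n)%:R * h n <= s.
Proof.
move=> s0; rewrite -ler_pdivlMr//.
by case/andP: (truncn_itv (divr_ge0 s0 (ltW (h0 n)))).
Qed.

Let ln_ge s n : 0 <= s -> s - h n <= (ln s n)%:R * h n.
Proof.
move=> s0; have /andP[_] := truncn_itv (divr_ge0 s0 (ltW (h0 n))).
rewrite ltr_pdivrMr// -natr1 mulrDl mul1r -/(ln s n); lra.
Qed.

Let ln_gt0 s n : h n <= s -> (0 < ln s n)%N.
Proof. by move=> hs; rewrite truncn_gt0 ler_pdivlMr// mul1r. Qed.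

Let near_shift n k x c s j : 0 <= s -> near_mesh n k x c ->
  near_mesh n (k + ee j *+ ln s n) (x + s *: ebasis j) (c + 1).
Proof.
move=> s0 kx i.
have -> : (k + ee j *+ ln s n) 0 i = k 0 i + (ln s n * (i == j))%N%:R by rewrite mxE eeMnE.
have -> : (x + s *: ebasis j) 0 i = x 0 i + s * (i == j)%:R.
  by rewrite mxE [X in _ + X]mxE ebasisE.
rewrite intrD mulrz_nat natrM.
have := kx i; have := ln_le n s0; have := ln_ge n s0; have hp := h0 n.
case: (i == j) => /=; rewrite ?mulr1 ?mulr0 => l1 l2 kxi.
  have -> : h n * ((k 0 i)%:~R + (ln s n)%:R) - (x 0 i + s) =
    (h n * (k 0 i)%:~R - x 0 i) + ((ln s n)%:R * h n - s) by ring.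
  apply: le_trans (ler_normD _ _) _; rewrite mulrDl mul1r lerD//.
  by rewrite ler_norml; apply/andP; split; lra.
rewrite !addr0; lra.
Qed.

(** Along a lattice segment of length [s] the difference quotients stay within [C * Num.sqrt s] of
    the first one. Summing them and passing to the limit gives the first-order expansion. *)
Lemma ulim_increment (rho : R) : exists C : R, 0 < C /\ forall i x (s : R), inbox rho x ->
  0 < s -> s <= 1 -> `|fdiff (s *: ebasis i) ulim x - s * vlim i x| <= C * Num.sqrt s * s.
Proof.
have [C [n0 [C0 uC]]] := discrete_gradient_holder (rho + 1 + 1).
exists C; split=> // i x s bx s0 s1.
have c1 : ((ln s n)%:R * h n) @[n --> UF] --> s.
  apply: (ultra_cvg_close UFoo (cvg_cst s)) => e e0.
  have [n1 hn1] := mesh_small e0; exists n1 => n nn.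
  have := hn1 n nn; have := ln_le n (ltW s0); have := ln_ge n (ltW s0).
  by rewrite ler_norml => *; apply/andP; split; have := h0 n; lra.
have c2 : u n (fl n x + ee i *+ ln s n) - u n (fl n x)
    - (ln s n)%:R * h n * ((h n)^-1 * fdiff (ee i) (u n) (fl n x)) @[n --> UF]
    --> ulim (x + s *: ebasis i) - ulim x - s * vlim i x.
  apply: cvgB; last by apply: cvgM; [exact: c1|exact: vlim_cvg].
  apply: cvgB; last exact: ulim_cvg.
  by apply: (@ulim_near _ (1 + 1)); [lra|move=> n; exact: near_shift (ltW s0) (fl_near n x)].
apply: (ultra_norm_le UFoo (n0 := n0) c2) => n nn.
have hp := h0 n.
pose B := C * Num.sqrt s * h n.
have bf := box_fl n bx.
have path l : (l <= ln s n)%N -> `|u n (fl n x + ee i *+ l) - u n (fl n x) - l%:R * fdiff (ee i) (u n) (fl n x)| <= l%:R * B.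
  elim: l => [_|l IH ll]; first by rewrite mulr0n addr0 subrr mul0r subr0 normr0 mul0r.
  have ls : l%:R * h n <= s.
    by apply: le_trans (ln_le n (ltW s0)); rewrite ler_wpM2r ?(ltW hp)// ler_nat ltnW.
  have -> : u n (fl n x + ee i *+ l.+1) - u n (fl n x) - l.+1%:R * fdiff (ee i) (u n) (fl n x) =
    (u n (fl n x + ee i *+ l) - u n (fl n x) - l%:R * fdiff (ee i) (u n) (fl n x)) +
    h n * ((h n)^-1 * fdiff (ee i) (u n) (fl n x + ee i *+ l) - (h n)^-1 * fdiff (ee i) (u n) (fl n x)).
    by rewrite mulrSr addrA -natr1 /fdiff; field; rewrite gt_eqF.
  apply: le_trans (ler_normD _ _) _; rewrite -natr1 mulrDl mul1r lerD ?IH ?(ltnW ll)//.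
  rewrite normrM (gtr0_norm hp) mulrC /B ler_wpM2r ?(ltW hp)//.
  apply: uC => //; [by apply: box_le bf; lra| |exact: ltW|].
    by apply: box_le (box_eeMn i l (ltW hp) bf); lra.
  move=> j; rewrite mxE addrAC subrr add0r eeMnE mulrz_nat natrM ger0_norm ?mulr_ge0// ?(ltW hp)//.
  by rewrite mulrC; case: (j == i); rewrite ?mulr1// mulr0 mul0r ltW.
have := path _ (leqnn _).
have -> : (ln s n)%:R * h n * ((h n)^-1 * fdiff (ee i) (u n) (fl n x)) = (ln s n)%:R * fdiff (ee i) (u n) (fl n x).
  by field; rewrite gt_eqF.
move=> /le_trans; apply; rewrite /B mulrCA ler_wpM2l//.
  by rewrite mulr_ge0 ?sqrtr_ge0// ltW.
exact: ln_le (ltW s0).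
Qed.

Lemma is_derive_ulim i x : is_derive x (ebasis i) ulim (vlim i x).
Proof.
apply: is_derive_criterion => e e0.
have [rho bx] := inbox_exists x; have [C [C0 HC]] := ulim_increment (rho + 1).
have e2 : 0 < e / 2 by lra.
have [d [d0 d1 d2]] := sqrt_small C0 e2.
have [d' [d'0 hd']] := (rV_cvgP _ _ _).1 (@continuous_vlim i x) _ e2.
exists (Num.min d d'); split; first by rewrite lt_min d0.
move=> y s xy s0 sd.
have [sd1 sd2] : s < d /\ s < d' by move: sd; rewrite lt_min => /andP.
have yd : inball x d y by move=> j; apply: lt_le_trans (xy j) _; rewrite ge_min lexx.
have yd' : inball x d' y by move=> j; apply: lt_le_trans (xy j) _; rewrite ge_min lexx orbT.
have by1 : inbox (rho + 1) y by apply: inbox_le (inball_inbox bx yd); lra.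
have s1 : s <= 1 by lra.
have -> : fdiff (s *: ebasis i) ulim y - s * vlim i x =
  (fdiff (s *: ebasis i) ulim y - s * vlim i y) + s * (vlim i y - vlim i x) by ring.
apply: le_trans (ler_normD _ _) _.
have h2 : C * Num.sqrt s * s <= e / 2 * s.
  rewrite ler_wpM2r ?(ltW s0)//; apply: le_trans d2; rewrite ler_wpM2l ?(ltW C0)//.
  rewrite ler_wsqrtr//; lra.
have h3 : `|s * (vlim i y - vlim i x)| <= e / 2 * s.
  by rewrite normrM (gtr0_norm s0) mulrC ler_wpM2r ?(ltW s0)// ltW// hd'.
have := HC i y s by1 s0 s1; lra.
Qed.

Let gam : R := (2 * q)%:R^-1.
Let q0 : (0 < 2 * q)%N. Proof. by rewrite muln_gt0 (ltnW q2). Qed.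
Let qR : 0 < (2 * q)%:R :> R. Proof. by rewrite ltr0n. Qed.
Let gam0 : 0 < gam. Proof. by rewrite invr_gt0. Qed.
Let gam_le1 : gam <= 1. Proof. by rewrite invf_le1// ler1n. Qed.

Let root_pow (s : R) : 0 <= s -> (s `^ gam) ^+ (2 * q) = s.
Proof.
move=> s0; rewrite -powR_mulrn ?powR_ge0// -powRrM /gam mulVf ?gt_eqF//.
by rewrite powRr1.
Qed.

(** For an increment [t], the parameter of [u_higher] is the root t^gam with gam = 1/(2q), and its
    power of exponent 2q + 1 is [t] times t^gam: the increment times the modulus. *)
Lemma vlim_differences i j : differences_bounded (fun s => s `^ gam) j (2 * q).+1 (vlim i).
Proof.
move=> rho; have [C [n0 [C0 uC]]] := u_higher (rho + 1).
exists C; split=> // x s bx s0 s1.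
pose w n : lat -> R := fun k => (h n)^-1 * fdiff (ee i) (u n) k.
(* A lattice shift matches the true shift up to one cell, so the rounding constant [c] grows by 1
   with each difference. *)
have lim m y c (k : nat -> lat) : 0 <= c -> (forall n, near_mesh n (k n) y c) ->
   iter m (fdiff (ee j *+ ln s n)) (w n) (k n) @[n --> UF] --> iter m (fdiff (s *: ebasis j)) (vlim i) y.
  elim: m y c k => [|m IH] y c k c0 ky /=; first exact: vlim_near c0 ky.
  apply: cvgB; last exact: IH c0 ky.
  apply: (IH _ (c + 1)); first by lra.
  by move=> n; apply: near_shift => //; exact: ltW.
have := lim (2 * q).+1 x 1 (fun n => fl n x) ler01 (fun n => fl_near n x).
have [n1 hn1] := mesh_small s0.
move=> /(ultra_norm_le UFoo (n0 := maxn n0 n1)); apply => n.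
rewrite geq_max => /andP[nn0 nn1].
have hp := h0 n; have hi : 0 < (h n)^-1 by rewrite invr_gt0.
have l0 := ln_gt0 (hn1 n nn1).
set t := (ln s n)%:R * h n.
have t0 : 0 < t by rewrite mulr_gt0// ltr0n.
have ts : t <= s := ln_le n (ltW s0).
have t1 : t <= 1 := le_trans ts s1.
have iterZ m k (v : lat -> R) : iter m (fdiff (ee j *+ ln s n)) (fun k => (h n)^-1 * v k) k =
   (h n)^-1 * iter m (fdiff (ee j *+ ln s n)) v k.
  by elim: m k => //= m IH k; rewrite /fdiff !IH; ring.
rewrite /w iterZ normrM (gtr0_norm hi) ler_pdivrMl// iter_fdiff_fdiff.
have tg0 : 0 < t `^ gam by rewrite powR_gt0.
have tg1 : t `^ gam <= 1.
  by have := ge0_ler_powR (ltW gam0); move=> /(_ t 1); rewrite powR1; apply; rewrite ?nnegrE// ltW.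
apply: le_trans (uC n _ nn0 (box_fl n bx) i j (ln s n) (t `^ gam) l0 tg0 tg1 _) _.
  by rewrite root_pow// ltW.
rewrite ler_wpM2l ?(ltW hp)// ler_wpM2l ?(ltW C0)// exprSr root_pow ?(ltW t0)//.
rewrite ler_pM ?(ltW t0) ?powR_ge0//.
by rewrite ge0_ler_powR ?nnegrE ?(ltW gam0) ?(ltW t0) ?(ltW s0).
Qed.

Lemma vlim_derivable i j : exists w : E -> R, continuous w /\
  forall x, is_derive x (ebasis j) (vlim i) (w x).
Proof.
pose e (s : R) := s `^ gam.
have e_ge0 (s : R) : 0 < s -> 0 <= e s by move=> _; exact: powR_ge0.
(* Equivalent to [2 <= (3 / 2) ^+ (2 * q)], which holds since [q >= 2] and (3/2)^4 = 81/16. *)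
have g2 : 2 `^ gam <= 3 / 2 :> R.
  have : 2 <= (3 / 2) ^+ (2 * q) :> R.
    have : (3 / 2) ^+ 4 <= (3 / 2) ^+ (2 * q) :> R.
      by apply: ler_weXn2l; [lra|rewrite (leq_pmul2l (m := 2) (n1 := 2))].
    have -> : (3 / 2) ^+ 4 = 81 / 16 :> R by field.
    lra.
  move=> h2; apply: (@le_trans _ _ (((3 / 2) ^+ (2 * q)) `^ gam)).
    by rewrite ge0_ler_powR ?nnegrE ?(ltW gam0) ?exprn_ge0// divr_ge0.
  rewrite -powR_mulrn ?divr_ge0// -powRrM /gam mulfV ?gt_eqF// powRr1// divr_ge0//.
have e_double (s : R) : 0 < s -> e (2 * s) <= 3 / 2 * e s.
  by move=> s0; rewrite /e powRM ?(ltW s0)// ler_wpM2r// powR_ge0.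
have e_half (s : R) : 0 < s -> e (s / 2) <= 2^-1 `^ gam * e s.
  by move=> s0; rewrite /e mulrC powRM ?(ltW s0)// invr_ge0.
have th : 0 <= (2^-1 : R) `^ gam < 1.
  rewrite powR_ge0/=.
  have := @gt0_ltr_powR R gam gam0 2^-1 1; rewrite powR1; apply; rewrite ?nnegrE ?invr_ge0//.
  by rewrite invf_lt1// ltr1n.
have e_lin (s : R) : 0 < s -> s <= 1 -> s <= e s.
  by move=> s0 s1; apply: ger1_powR => //; rewrite s0.
(* Descending induction on the order of the differences, from 2q + 1 down to 2, with [d] the number
   of steps already taken downwards. *)
have H d : forall m, (2 <= m)%N -> (m + d = (2 * q).+1)%N -> differences_bounded e j m (vlim i).
  elim: d => [|d IH] m m2 md; first by rewrite addn0 in md; rewrite md; exact: vlim_differences.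
  apply: (differences_descend e_ge0 e_double e_lin m2); first exact: vlim_bounded.
  by apply: IH; [exact: ltnW|rewrite addSn -addnS].
apply: (second_differences_derivable e_ge0 e_half th (@continuous_vlim i)).
by apply: (H (2 * q).-1) => //; rewrite add2n prednK.
Qed.

End Limit.

(** * Uniformity on boxes by compactness *)

Section LocalUniformity.
Context {R : realType} {N : nat}.
Local Notation E := 'rV[R]_N.
Implicit Types (v : E -> R) (x y : E).

Lemma compact_inbox (rho : R) : compact [set x : E | inbox rho x].
Proof.
have := @rV_compact R N (fun=> `[- rho, rho]%classic) (fun=> @segment_compact R (- rho) rho).
congr compact; apply/seteqP; split=> x /= h i; have := h i; rewrite in_itv/= ler_norml//.
Qed.

(** Compactness for an arbitrary filter: what holds eventually near each point of a box holds
    eventually on the whole box. It serves for small radii, for large bounds and for the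
    ultrafilter. *)
Lemma box_cover (I : Type) (F : set_system I) {FF : Filter F} (rho : R) (P : I -> E -> Prop) :
  (forall x, inbox rho x -> exists d : R, 0 < d /\ F [set i | forall y, inball x d y -> P i y]) ->
  F [set i | forall x, inbox rho x -> P i x].
Proof.
move=> H.
have /compact_near_coveringP/(_ I F P FF) := @compact_inbox rho; apply => x /H[d [d0 hd]].
exists ([set y | inball x d y], [set i | forall y, inball x d y -> P i y]) => /=.
  by split=> //; apply/nbhs_inball; exists d.
by move=> [y i] /= [xy]; exact.
Qed.

Lemma inball_trans x y z (d d' : R) : inball x d y -> inball y d' z -> inball x (d + d') z.
Proof.
move=> xy yz i; have -> : z 0 i - x 0 i = (y 0 i - x 0 i) + (z 0 i - y 0 i) by ring.
by apply: le_lt_trans (ler_normD _ _) _; rewrite ltrD.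
Qed.

Lemma inball_le x y (d d' : R) : d <= d' -> inball x d y -> inball x d' y.
Proof. by move=> dd xy i; apply: lt_le_trans dd. Qed.

Lemma box_uniform_continuous v (rho e : R) : continuous v -> 0 < e ->
  exists d : R, 0 < d /\ forall x y, inbox rho x -> inball x d y -> `|v y - v x| < e.
Proof.
move=> vc e0; have e2 : 0 < e / 2 by lra.
have : (0 : R)^'+ [set d : R | forall x, inbox rho x -> forall y, inball x d y -> `|v y - v x| < e].
  apply: box_cover => x _; have [d [d0 hd]] := (rV_cvgP _ _ _).1 (vc x) _ e2.
  exists (d / 2); split; first by lra.
  have : (0 : R)^'+ [set t : R | t < d / 2] by apply: nbhs_right_lt; lra.
  apply: filterS => t /= td y xy z yz.
  have h1 := hd y (inball_le (_ : d / 2 <= d) xy).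
  have h2 := hd z (inball_le (_ : d / 2 + t <= d) (inball_trans xy yz)).
  have -> : v z - v y = (v z - v x) - (v y - v x) by ring.
  apply: le_lt_trans (ler_normB _ _) _.
  have : `|v y - v x| < e / 2 by apply: h1; lra.
  have : `|v z - v x| < e / 2 by apply: h2; lra.
  lra.
move=> h; have h' : (0 : R)^'+ [set t : R | 0 < t] by exact: nbhs_right_gt.
by have [d /= [d0 hd]] := filter_ex (filterI h' h); exists d; split=> // x y bx xy; exact: hd.
Qed.

Lemma continuous_bounded_box v (rho : R) : continuous v ->
  exists M : R, 0 < M /\ forall x, inbox rho x -> `|v x| <= M.
Proof.
move=> vc.
have : (+oo_R : set_system R) [set M : R | forall x, inbox rho x -> `|v x| <= M].
  apply: box_cover => x _; have [d [d0 hd]] := (rV_cvgP _ _ _).1 (vc x) _ ltr01.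
  exists d; split=> //.
  have : (+oo_R : set_system R) [set M : R | `|v x| + 1 < M] by exact: nbhs_pinfty_gt (num_real _).
  apply: filterS => M /= hM y /hd; have := ler_normD (v y - v x) (v x); rewrite subrK; lra.
move=> h; have h' : (+oo_R : set_system R) [set M : R | 0 < M] by exact: nbhs_pinfty_gt (num_real _).
by have [M /= [M0 hM]] := filter_ex (filterI h' h); exists M.
Qed.

End LocalUniformity.

(** * Consistency of the scheme with the differential operator *)

Section Consistency.
Context {R : realType} {N : nat}.
Local Notation E := 'rV[R]_N.
Local Notation lat := 'rV[int]_N.
Implicit Types (x y : E).

Lemma is_derive_line (P : E -> R) (d : R) x i (t : R) :
  is_derive (x + t *: ebasis i) (ebasis i) P d ->
  is_derive t 1 (fun s : R => P (x + s *: ebasis i)) d.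
Proof.
move=> [dP dE].
have eq : (fun s : R => s^-1 *: (P (x + (s *: 1 + t) *: ebasis i) - P (x + t *: ebasis i))) =
    (fun s : R => s^-1 *: (P (s *: ebasis i + (x + t *: ebasis i)) - P (x + t *: ebasis i))).
  apply/funext => s; rewrite [s *: 1]mulr1 scalerDl.
  by rewrite (addrCA x).
by apply: DeriveDef; [rewrite /derivable eq|rewrite -dE /derive eq].
Qed.

Lemma is_derive_translate (P : E -> R) (d : R) (a x : E) (w : E) :
  is_derive (x + a) w P d -> is_derive x w (fun y => P (y + a)) d.
Proof.
move=> [dP dE].
have eq : (fun s : R => s^-1 *: (P (s *: w + x + a) - P (x + a))) =
    (fun s : R => s^-1 *: (P (s *: w + (x + a)) - P (x + a))).
  by apply/funext => s; rewrite addrA.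
by apply: DeriveDef; [rewrite /derivable eq|rewrite -dE /derive eq].
Qed.

Lemma mean_value_bound (P D1 : E -> R) x i (s A e : R) : 0 < s ->
  (forall y, is_derive y (ebasis i) P (D1 y)) ->
  (forall t, 0 <= t -> t <= s -> `|D1 (x + t *: ebasis i) - A| <= e) ->
  `|fdiff (s *: ebasis i) P x - s * A| <= e * s.
Proof.
move=> s0 dP hD.
have dl (t : R) : is_derive t 1 (fun r : R => P (x + r *: ebasis i)) (D1 (x + t *: ebasis i)).
  exact: is_derive_line.
have [c] := @MVT R (fun r : R => P (x + r *: ebasis i)) (fun t => D1 (x + t *: ebasis i)) 0 s s0
  (fun t _ => dl t) (derivable_within_continuous (fun t _ => @ex_derive _ _ _ _ _ _ _ (dl t))).
rewrite in_itv/= => /andP[c0 cs]; rewrite scale0r addr0 subr0 /fdiff => ->.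
by rewrite (mulrC s) -mulrBl normrM (gtr0_norm s0) ler_wpM2r ?(ltW s0)// hD// ltW.
Qed.

Lemma at_mesh_ee (h : R) (k : lat) i : at_mesh h (k + ee i) = at_mesh h k + h *: ebasis i.
Proof. by apply/rowP => j; rewrite !mxE intrD mulrDr; congr (_ + _ * _); case: (_ && _). Qed.

Lemma at_meshBee (h : R) (k : lat) i : at_mesh h (k - ee i) = at_mesh h k - h *: ebasis i.
Proof. by apply/rowP => j; rewrite !mxE intrB mulrBr; congr (_ - _ * _); case: (_ && _). Qed.

(** No modulus of continuity is required, only that the derivatives stay within [e] of fixed numbers
    along the axes near the point. The Laplacian and the gradient each contribute [N%:R * e]. *)
Lemma consistency (P : E -> R) (D1 D2 : 'I_N -> E -> R) (A1 A2 : 'I_N -> R) (h e : R) (k : lat) :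
  0 < h ->
  (forall i y, is_derive y (ebasis i) P (D1 i y)) ->
  (forall i y, is_derive y (ebasis i) (D1 i) (D2 i y)) ->
  (forall i t, `|t| <= h -> `|D1 i (at_mesh h k + t *: ebasis i) - A1 i| <= e /\
                           `|D2 i (at_mesh h k + t *: ebasis i) - A2 i| <= e) ->
  `|dop (h / 2) (fun l => P (at_mesh h l)) k - h ^+ 2 * (\sum_i A2 i + l2norm A1)|
     <= h ^+ 2 * (2 * N%:R * e).
Proof.
move=> h0 dP dD hA; set x := at_mesh h k in hA *.
have first i : `|P (x + h *: ebasis i) - P (x - h *: ebasis i) - 2 * h * A1 i| <= 2 * h * e.
  have h1 := @mean_value_bound P (D1 i) x i h (A1 i) e h0 (dP i).
  have h2 := @mean_value_bound P (D1 i) (x - h *: ebasis i) i h (A1 i) e h0 (dP i).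
  have e1 : `|fdiff (h *: ebasis i) P x - h * A1 i| <= e * h.
    by apply: h1 => t t0 th; apply: (hA i t _).1; rewrite ger0_norm.
  have e2 : `|fdiff (h *: ebasis i) P (x - h *: ebasis i) - h * A1 i| <= e * h.
    apply: h2 => t t0 th; rewrite -addrA -scaleNr -scalerDl; apply: (hA i _ _).1.
    by rewrite ler_norml; apply/andP; split; lra.
  rewrite /fdiff subrK in e2; rewrite /fdiff in e1.
  have -> : P (x + h *: ebasis i) - P (x - h *: ebasis i) - 2 * h * A1 i =
    (P (x + h *: ebasis i) - P x - h * A1 i) + (P x - P (x - h *: ebasis i) - h * A1 i) by ring.
  apply: le_trans (ler_normD _ _) _; lra.
have second i : `|P (x + h *: ebasis i) + P (x - h *: ebasis i) - 2 * P x - h ^+ 2 * A2 i| <= h ^+ 2 * e.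
  (* The second difference is the first difference of [Q], so the mean value theorem applied twice
     gives it. The zero shift makes both terms translates of [P], differentiated by the same
     lemma. *)
  pose Q y := P (y + 0 *: ebasis i) - P (y + - h *: ebasis i).
  have dQ y : is_derive y (ebasis i) Q (D1 i (y + 0 *: ebasis i) - D1 i (y + - h *: ebasis i)).
    by apply: is_deriveB; apply: is_derive_translate; exact: dP.
  have := @mean_value_bound Q (fun y => D1 i (y + 0 *: ebasis i) - D1 i (y + - h *: ebasis i)) x i h (h * A2 i) (e * h) h0 dQ.
  rewrite /fdiff /Q !scale0r !addr0 scaleNr addrK.
  have -> : P (x + h *: ebasis i) - P x - (P x - P (x - h *: ebasis i)) - h * (h * A2 i) =
    P (x + h *: ebasis i) + P (x - h *: ebasis i) - 2 * P x - h ^+ 2 * A2 i by ring.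
  have -> : e * h * h = h ^+ 2 * e by ring.
  apply => t t0 th; rewrite addr0 -[x + _ - _]addrA -scalerBl.
  have := @mean_value_bound (D1 i) (D2 i) (x + (t - h) *: ebasis i) i h (A2 i) e h0 (dD i).
  rewrite /fdiff -[x + _ + h *: _]addrA -scalerDl subrK; apply => r r0 rh.
  rewrite -addrA -scalerDl; apply: (hA i _ _).2.
  by rewrite ler_norml; apply/andP; split; lra.
rewrite /dop.
have -> : dlap (fun l => P (at_mesh h l)) k + h / 2 * dgrad (fun l => P (at_mesh h l)) k -
   h ^+ 2 * (\sum_i A2 i + l2norm A1) =
   (dlap (fun l => P (at_mesh h l)) k - h ^+ 2 * \sum_i A2 i) +
   h / 2 * (dgrad (fun l => P (at_mesh h l)) k - 2 * h * l2norm A1) by field.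
have -> : h ^+ 2 * (2 * N%:R * e) = N%:R * (h ^+ 2 * e) + h / 2 * (N%:R * (2 * h * e)) by field.
apply: le_trans (ler_normD _ _) _; apply: lerD.
  rewrite /dlap mulr_sumr -sumrB.
  apply: (@le_trans _ _ (\sum_(i < N) h ^+ 2 * e)); last by rewrite sumr_const card_ord mulr_natl.
  by apply: le_trans (ler_norm_sum _ _ _) _; apply: ler_sum => i _; rewrite at_mesh_ee at_meshBee; exact: second.
rewrite normrM ger0_norm ?divr_ge0 ?(ltW h0)// ler_wpM2l ?divr_ge0 ?(ltW h0)//.
have -> : 2 * h * l2norm A1 = l2norm (fun i => 2 * h * A1 i).
  by rewrite l2normZ ger0_norm// mulr_ge0// ltW.
apply: le_trans (l2norm_lip _ _) _; apply: l2norm_le_max => i.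
by rewrite at_mesh_ee at_meshBee.
Qed.

Lemma dop_perturb tau (a b : lat -> R) k : 0 <= tau ->
  `|dop tau (fun l => a l + b l) k - dop tau a k| <= `|dlap b k| + tau * dgrad b k.
Proof.
move=> t0; rewrite /dop.
have -> : dlap (fun l => a l + b l) k + tau * dgrad (fun l => a l + b l) k - (dlap a k + tau * dgrad a k) =
   dlap b k + tau * (dgrad (fun l => a l + b l) k - dgrad a k).
  have -> : dlap (fun l => a l + b l) k = dlap a k + dlap b k.
    by rewrite /dlap -big_split/=; apply: eq_bigr => i _; ring.
  ring.
apply: le_trans (ler_normD _ _) _; rewrite lerD2l normrM ger0_norm// ler_wpM2l//.
apply: le_trans (l2norm_lip _ _) _; apply: eq_ler; apply: eq_l2norm => i; ring.
Qed.

End Consistency.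

(** * Comparison against a small quadratic *)

Section Touching.
Context {R : realType} {N : nat}.
Local Notation E := 'rV[R]_N.
Local Notation lat := 'rV[int]_N.

Definition quad (m : R) (x0 : E) : lat -> R := fun k => \sum_j (m * (k 0 j)%:~R - x0 0 j) ^+ 2.

Lemma quad_ge0 (m : R) (x0 : E) (k : lat) : 0 <= quad m x0 k.
Proof. by apply: sumr_ge0 => j _; exact: sqr_ge0. Qed.

Lemma quad_ge (m : R) (x0 : E) (k : lat) j : (m * (k 0 j)%:~R - x0 0 j) ^+ 2 <= quad m x0 k.
Proof. by rewrite /quad (bigD1 j)//= lerDl; apply: sumr_ge0 => i _; exact: sqr_ge0. Qed.

Lemma quad_le (m : R) (x0 : E) (k : lat) (c : R) : (forall j, `|m * (k 0 j)%:~R - x0 0 j| <= c) ->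
  quad m x0 k <= N%:R * c ^+ 2.
Proof.
move=> h; rewrite mulr_natl -[in leRHS](card_ord N) -sumr_const.
apply: ler_sum => j _; rewrite -real_normK ?num_real//.
by rewrite lerXn2r ?nnegrE// (le_trans _ (h j)).
Qed.

Lemma quad_dop (m : R) (x0 : E) (s d : R) (k : lat) : 0 <= m -> d <= 1 ->
  (forall j, `|m * (k 0 j)%:~R - x0 0 j| <= d) ->
  `|dlap (fun l => s * quad m x0 l) k| + m / 2 * dgrad (fun l => s * quad m x0 l) k
    <= m ^+ 2 * (4 * N%:R * `|s|).
Proof.
move=> m0 d1 kd.
have quadE : (fun l => s * quad m x0 l) = separable (fun j t => s * (m * t - x0 0 j) ^+ 2).
  by apply/funext => l; rewrite /quad mulr_sumr.
have -> : m ^+ 2 * (4 * N%:R * `|s|) = m ^+ 2 * (2 * N%:R * `|s|) + m / 2 * (N%:R * (4 * m * `|s|)) by field.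
rewrite quadE; apply: lerD.
  rewrite dlap_separable (eq_bigr (fun=> 2 * s * m ^+ 2)); last by move=> j _; ring.
  have -> : \sum_(i < N) 2 * s * m ^+ 2 = (2 * N%:R * m ^+ 2) * s.
    by rewrite sumr_const card_ord -[_ *+ N]mulr_natl; ring.
  have c0 : 0 <= 2 * N%:R * m ^+ 2 by rewrite mulr_ge0 ?sqr_ge0// mulr_ge0.
  by rewrite normrM (ger0_norm c0); apply: eq_ler; ring.
rewrite ler_wpM2l ?divr_ge0// dgrad_separable; apply: l2norm_le_max => j.
have -> : s * (m * ((k 0 j)%:~R + 1) - x0 0 j) ^+ 2 - s * (m * ((k 0 j)%:~R - 1) - x0 0 j) ^+ 2 =
  (4 * m * s) * (m * (k 0 j)%:~R - x0 0 j) by ring.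
rewrite !normrM (ger0_norm m0) (ger0_norm (_ : 0 <= 4))//.
by rewrite ler_piMr ?mulr_ge0// (le_trans (kd j)).
Qed.

(** Since [a - b] is within [eta] of [- s * quad], it is at most [eta - s * d ^+ 2 / 4] just outside
    the half-size box, and comparison carries this bound to the centre. There [a - b] is at least
    [- eta - s * d ^+ 2 / 16], so [2 * eta >= 3 / 16 * s * d ^+ 2], against the choice of [eta]. *)
Lemma no_touch (m d s eta kap : R) (x0 : E) (k0 : lat) (a b : lat -> R) :
  0 < m -> m <= 1 -> 2 * m <= d -> 0 < kap -> 0 < s -> N%:R * m ^+ 2 <= d ^+ 2 / 16 ->
  eta <= s * d ^+ 2 / 16 ->
  (forall j, `|m * (k0 0 j)%:~R - x0 0 j| <= m) ->
  (forall k : lat, (forall j, `|m * (k 0 j)%:~R - x0 0 j| <= d) -> `|a k + s * quad m x0 k - b k| <= eta) ->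
  (forall k : lat, (forall j, `|m * (k 0 j)%:~R - x0 0 j| <= d / 2) ->
    dop (m / 2) b k + kap <= dop (m / 2) a k) -> False.
Proof.
move=> m0 m1 md kap0 s0 mN etas k0x ab hop.
have d0 : 0 < d by lra.
have d20 : 0 < d ^+ 2 by rewrite exprn_gt0.
pose D (k : lat) := forall j, `|m * (k 0 j)%:~R - x0 0 j| <= d / 2.
have Dd k : D k -> forall j, `|m * (k 0 j)%:~R - x0 0 j| <= d.
  by move=> Dk j; apply: le_trans (Dk j) _; lra.
have tau01 : 0 <= m / 2 <= 1 by apply/andP; split; lra.
have Dk0 : D k0 by move=> j; apply: le_trans (k0x j) _; lra.
have H := @discrete_comparison R N D (m / 2) a b (eta - s * (d ^+ 2 / 4)) eta kap tau01 kap0.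
have : a k0 - b k0 <= eta - s * (d ^+ 2 / 4).
  apply: H Dk0 => [k Dk|k Dk|k y Dk _ nDy hy].
  - have := ler_norm (a k + s * quad m x0 k - b k).
    have := ab k (Dd _ Dk); have : 0 <= s * quad m x0 k by rewrite mulr_ge0 ?quad_ge0// ltW.
    lra.
  - exact: hop.
  have yd j : `|m * (y 0 j)%:~R - x0 0 j| <= d.
    have hb : `|m * (y 0 j)%:~R - m * (k 0 j)%:~R| <= m.
      rewrite -mulrBr -intrB normrM (gtr0_norm m0) ler_piMr ?(ltW m0)// -intr_norm.
      rewrite -[1]/(1%:~R) ler_int.
      case: hy => i [->|->]; rewrite mxE addrAC subrr add0r; last rewrite mxE normrN.
        by rewrite eeE; case: (j == i).
      by rewrite eeE; case: (j == i).
    have -> : m * (y 0 j)%:~R - x0 0 j = (m * (y 0 j)%:~R - m * (k 0 j)%:~R) + (m * (k 0 j)%:~R - x0 0 j) by ring.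
    by apply: le_trans (ler_normD _ _) _; have := Dk j; lra.
  have [j hj] : exists j, d / 2 < `|m * (y 0 j)%:~R - x0 0 j|.
    apply: contrapT => hn; apply: nDy => j; rewrite leNgt; apply/negP => hj.
    by apply: hn; exists j.
  have q4 : d ^+ 2 / 4 <= quad m x0 y.
    apply: le_trans (quad_ge m x0 y j).
    have -> : d ^+ 2 / 4 = (d / 2) ^+ 2 by field.
    rewrite -(real_normK (num_real (_ - x0 0 j))).
    by rewrite lerXn2r ?nnegrE ?divr_ge0 ?(ltW d0)// ltW.
  have : s * (d ^+ 2 / 4) <= s * quad m x0 y by rewrite ler_wpM2l// ltW.
  have := ler_norm (a y + s * quad m x0 y - b y); have := ab y yd; lra.
have : s * quad m x0 k0 <= s * (d ^+ 2 / 16).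
  by rewrite ler_wpM2l ?(ltW s0)//; apply: le_trans mN; exact: quad_le.
have := ab k0 (Dd _ Dk0); rewrite ler_norml => /andP[h1 _].
have sd : 0 < s * d ^+ 2 by rewrite mulr_gt0.
lra.
Qed.

End Touching.

(** Errors of a quarter, an eighth and a quarter use five eighths of the gap [H * (g - L)], so a
    margin of at least one eighth is left for the strict comparison. *)
Lemma touching_arith (R : realType) (H L g A B C : R) : 0 <= H * (g - L) -> A - B <= H * ((g - L) / 4) ->
  B - H * L <= H * ((g - L) / 8) -> - (H * ((g - L) / 4)) <= C - H * g ->
  A + H * ((g - L) / 8) <= C.
Proof. by lra. Qed.

Lemma touching_arith' (R : realType) (H L g A B C : R) : 0 <= H * (L - g) -> - (H * ((L - g) / 4)) <= A - B ->
  - (H * ((L - g) / 8)) <= B - H * L -> C - H * g <= H * ((L - g) / 4) ->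
  C + H * ((L - g) / 8) <= A.
Proof. by lra. Qed.

(** * The equation satisfied by the limit *)

Section Equation.
Context {R : realType} {N : nat} (UF : set_system nat) {UFU : UltraFilter UF}.
Local Notation lat := 'rV[int]_N.
Local Notation E := 'rV[R]_N.
Variables (h : nat -> R) (u : nat -> lat -> R) (p : E -> R) (f : R -> R)
  (U : E -> R) (V V2 : 'I_N -> E -> R).
Hypotheses (UFoo : \oo `<=` UF) (h0 : forall n, 0 < h n) (hn : forall n, h n <= n.+1%:R^-1).
Hypothesis u_lim : forall (x : E) (c : R) (k : nat -> lat), 0 <= c -> (forall n, near_mesh h n (k n) x c) ->
  u n (k n) @[n --> UF] --> U x.
Hypothesis u_lip : forall rho : R, exists (C : R) (n0 : nat), 0 < C /\
  forall n (k k' : lat) (d : R), (n0 <= n)%N -> box rho (h n) k -> box rho (h n) k' ->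
    0 <= d -> d <= 1 -> (forall j, `|h n * (k' 0 j - k 0 j)%:~R| <= d) ->
    `|u n k' - u n k| <= C * d.
Hypotheses (U_cont : continuous U) (V_cont : forall i, continuous (V i))
  (V2_cont : forall i, continuous (V2 i))
  (dU : forall i x, is_derive x (ebasis i) U (V i x))
  (dV : forall i x, is_derive x (ebasis i) (V i) (V2 i x)).
Hypotheses (p0 : forall x, 0 <= p x) (p_cont : continuous p)
  (f_ge0 : forall s, 0 <= s -> 0 <= f s)
  (f_cont : forall a e : R, 0 <= a -> 0 < e -> exists d : R, 0 < d /\
    forall b, 0 <= b -> `|b - a| < d -> `|f b - f a| < e)
  (u_ge0 : forall n k, box n%:R (h n) k -> 0 <= u n k) (U_ge0 : forall x, 0 <= U x)
  (u_eq : forall n k, box n%:R (h n) k ->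
     dop (h n / 2) (u n) k = h n ^+ 2 * (p (at_mesh (h n) k) * f (u n k))).

(** Pointwise convergence along the ultrafilter becomes uniform on boxes, because the [u n] are
    equi-Lipschitz and [U] is continuous. *)
Lemma uniformly_close (rho eta : R) : 0 < eta ->
  UF [set n | forall k : lat, box rho (h n) k -> `|u n k - U (at_mesh (h n) k)| <= eta].
Proof.
move=> eta0.
have : UF [set n | forall x, inbox rho x -> forall k, at_mesh (h n) k = x -> `|u n k - U x| <= eta].
  apply: box_cover => x bx.
  have [C [n0 [C0 HC]]] := u_lip (rho + 1).
  have e3 : 0 < eta / 3 by lra.
  have [d1 [d10 hd1]] := (rV_cvgP _ _ _).1 (@U_cont x) _ e3.
  have eC : 0 < eta / 6 / C by rewrite !divr_gt0.
  pose d := Num.min d1 (Num.min (eta / 6 / C) 2^-1).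
  have d0 : 0 < d by rewrite !lt_min d10 eC invr_gt0 ltr0n.
  have dd1 : d <= d1 by rewrite ge_min lexx.
  have dC : d <= eta / 6 / C by rewrite !ge_min lexx orbT.
  have d2 : d <= 2^-1 by rewrite !ge_min lexx !orbT.
  exists d; split=> //.
  have [n1 hn1] := mesh_small hn d0.
  have := u_lim (ler01 : 0 <= (1 : R)) (fun n => fl_near h0 n x).
  move=> /cvgrPdist_lt/(_ _ e3) hc.
  have hoo : UF [set n | (maxn n0 n1 <= n)%N] by apply: UFoo; exists (maxn n0 n1).
  apply: filterS (filterI hc hoo) => n /= [h3]; rewrite geq_max => /andP[nn0 nn1] y xy k ky.
  have hp := h0 n.
  have hk : near_mesh h n k y 0.
    by move=> j; rewrite -ky mxE subrr normr0 mul0r.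
  have h1 : h n <= 1 by apply: le_trans (hn1 n nn1) _; lra.
  have bf : box (rho + 1) (h n) (fl h n x) by apply: near_mesh_box (fl_near h0 n x) bx => //.
  have bk : box (rho + 1) (h n) k.
    move=> j; have := inball_inbox bx xy j; rewrite -ky mxE => /le_trans; apply; lra.
  have := HC n (fl h n x) k (2 * d) nn0 bf bk.
  have -> : 0 <= 2 * d by lra.
  have -> : 2 * d <= 1 by lra.
  move=> /(_ isT isT) hu.
  have {}hu : `|u n k - u n (fl h n x)| <= C * (2 * d).
    apply: hu => j; apply: le_trans (near_mesh_dist (fl_near h0 n x) hk (d := d) _ j) _.
      by move=> j'; rewrite ltW.
    have := hn1 n nn1; lra.
  have hCd : C * (2 * d) <= eta / 3.
    rewrite mulrC -ler_pdivlMr//; apply: le_trans (_ : 2 * (eta / 6 / C) <= _).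
      by rewrite ler_wpM2l.
    by apply: eq_ler; field; rewrite gt_eqF.
  have h2 := hd1 y (inball_le dd1 xy).
  have -> : u n k - U y = (u n k - u n (fl h n x)) - (U x - u n (fl h n x)) - (U y - U x) - 0 + 2 * (U x - U x) by ring.
  rewrite subr0 subrr mulr0 addr0.
  apply: le_trans (ler_normB _ _) _; apply: le_trans (lerD (ler_normB _ _) (lexx _)) _.
  lra.
apply: filterS => n /= H k bk; apply: (H (at_mesh (h n) k)) => //.
by move=> j; rewrite mxE.
Qed.

Let common_ball (x0 : E) (e : R) : 0 < e -> exists d : R, 0 < d /\
  forall y, inball x0 d y -> forall i, `|V i y - V i x0| < e /\ `|V2 i y - V2 i x0| < e.
Proof.
move=> e0; apply/nbhs_inball.
apply: (@filter_forall E _ (fun i y => `|V i y - V i x0| < e /\ `|V2 i y - V2 i x0| < e) (nbhs x0) (nbhs_filter x0)) => i; apply/nbhs_inball.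
have [d1 [d10 h1]] := (rV_cvgP _ _ _).1 (@V_cont i x0) _ e0.
have [d2 [d20 h2]] := (rV_cvgP _ _ _).1 (@V2_cont i x0) _ e0.
exists (Num.min d1 d2); split; first by rewrite lt_min d10.
by move=> y xy; split; [apply: h1|apply: h2]; apply: inball_le xy; rewrite ge_min lexx ?orbT.
Qed.

Let rhs_ball (x0 : E) (g : R) : 0 < g -> exists d eta : R, [/\ 0 < d, 0 < eta &
  forall y r, inball x0 d y -> 0 <= r -> `|r - U y| <= eta ->
    `|p y * f r - p x0 * f (U x0)| <= g].
Proof.
move=> g0.
have c0 : 0 < p x0 + f (U x0) + 1 by rewrite ltr_wpDl// addr_ge0 ?f_ge0.
pose e := Num.min 1 (g / (p x0 + f (U x0) + 1)).
have e0 : 0 < e by rewrite lt_min ltr01 divr_gt0.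
have e1 : e <= 1 by rewrite ge_min lexx.
have eg : e * (p x0 + f (U x0) + 1) <= g.
  by rewrite -ler_pdivlMr// ge_min lexx orbT.
have [df [df0 hf]] := f_cont (U_ge0 x0) e0.
have df2 : 0 < df / 2 by lra.
have [d1 [d10 h1]] := (rV_cvgP _ _ _).1 (@p_cont x0) _ e0.
have [d2 [d20 h2]] := (rV_cvgP _ _ _).1 (@U_cont x0) _ df2.
exists (Num.min d1 d2), (df / 4); split; [by rewrite lt_min d10|lra|].
move=> y r xy r0 ry.
have hp := h1 y (inball_le (_ : Num.min d1 d2 <= d1) xy).
have hu := h2 y (inball_le (_ : Num.min d1 d2 <= d2) xy).
have {}hp : `|p y - p x0| < e by apply: hp; rewrite ge_min lexx.
have {}hu : `|U y - U x0| < df / 2 by apply: hu; rewrite ge_min lexx orbT.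
have hr : `|f r - f (U x0)| < e.
  apply: hf => //; have -> : r - U x0 = (r - U y) + (U y - U x0) by ring.
  by apply: le_lt_trans (ler_normD _ _) _; lra.
have -> : p y * f r - p x0 * f (U x0) = p y * (f r - f (U x0)) + (p y - p x0) * f (U x0) by ring.
apply: le_trans (ler_normD _ _) _; rewrite !normrM (ger0_norm (p0 y)) (ger0_norm (f_ge0 (U_ge0 x0))).
have py : p y <= p x0 + 1 by have := ler_norm (p y - p x0); lra.
have a1 : p y * `|f r - f (U x0)| <= (p x0 + 1) * e by rewrite ler_pM// ltW.
have a2 : `|p y - p x0| * f (U x0) <= e * f (U x0) by rewrite ler_wpM2r ?f_ge0// ltW.
lra.
Qed.

Let setting (x0 : E) (gap : R) : 0 < gap -> exists n (d s eta : R), 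
  [/\ [/\ 2 * h n <= d, 0 < s, N%:R * h n ^+ 2 <= d ^+ 2 / 16 & eta <= s * d ^+ 2 / 16],
   h n <= 1,
   forall k : lat, (forall j, `|h n * (k 0 j)%:~R - x0 0 j| <= d) ->
     `|u n k - U (at_mesh (h n) k)| <= eta &
   forall k : lat, (forall j, `|h n * (k 0 j)%:~R - x0 0 j| <= d / 2) ->
    [/\ `|dop (h n / 2) (u n) k - h n ^+ 2 * (p x0 * f (U x0))| <= h n ^+ 2 * (gap / 4),
     `|dop (h n / 2) (fun l => U (at_mesh (h n) l)) k -
       h n ^+ 2 * (\sum_i V2 i x0 + l2norm (fun i => V i x0))| <= h n ^+ 2 * (gap / 8) &
     `|dlap (fun l => s * quad (h n) x0 l) k| + h n / 2 * dgrad (fun l => s * quad (h n) x0 l) k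
      <= h n ^+ 2 * (gap / 4)]].
Proof.
move=> gap0.
have N1 : 0 < N%:R + 1 :> R by rewrite ltr_wpDl.
(* One number plays two roles. As the coefficient of the quadratic it costs
   [4 * N%:R * s <= gap / 4]; as the tolerated oscillation of [V] and [V2] it gives a consistency
   error [2 * N%:R * s <= gap / 8]. *)
pose s := gap / 16 / (N%:R + 1).
have s0 : 0 < s by rewrite !divr_gt0.
have sN : N%:R * s <= gap / 16.
  have -> : gap / 16 = (N%:R + 1) * s by rewrite /s; field; rewrite gt_eqF.
  by rewrite ler_wpM2r ?(ltW s0)// lerDl.
have [d1 [d10 h1]] := common_ball x0 s0.
have g4 : 0 < gap / 4 by lra.
have [d2 [eta2 [d20 eta20 h2]]] := rhs_ball x0 g4.
pose d := Num.min (d1 / 2) (Num.min (d2 / 2) 1).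
have d0 : 0 < d by rewrite !lt_min ltr01 !divr_gt0.
have dd1 : d <= d1 / 2 by rewrite !ge_min lexx.
have dd2 : d <= d2 / 2 by rewrite !ge_min lexx orbT.
have dd3 : d <= 1 by rewrite !ge_min lexx !orbT.
have [rho bx] := inbox_exists x0.
pose eta := Num.min eta2 (s * d ^+ 2 / 16).
have eta0 : 0 < eta by rewrite lt_min eta20 divr_gt0// mulr_gt0// exprn_gt0.
have d2' : 0 < d / 2 by lra.
have [n1 hn1] := mesh_small hn d2'.
have d16 : 0 < d ^+ 2 / 16 by rewrite divr_gt0// exprn_gt0.
have [n2 hn2] := mesh_small_mul h0 hn (ler0n R N) d16.
have [n3 hn3] := nat_above (rho + 1).
have hoo : UF [set n | (maxn n1 (maxn n2 n3) <= n)%N] by apply: UFoo; exists (maxn n1 (maxn n2 n3)).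
have [n [/= uc]] := filter_ex (filterI (uniformly_close (rho + 1) eta0) hoo).
rewrite !geq_max => /andP[nn1 /andP[nn2 nn3]].
have hp := h0 n.
have hd := hn1 n nn1.
have hle1 : h n <= 1 by lra.
have bk (k : lat) : (forall j, `|h n * (k 0 j)%:~R - x0 0 j| <= d) -> box (rho + 1) (h n) k.
  move=> kd j; have -> : h n * (k 0 j)%:~R = x0 0 j + (h n * (k 0 j)%:~R - x0 0 j) by ring.
  by apply: le_trans (ler_normD _ _) _; rewrite lerD//; have := kd j; lra.
exists n, d, s, eta; split=> //.
- split=> //; first by lra.
    apply: le_trans (hn2 n nn2); rewrite ler_wpM2l// expr2 ler_piMl// ltW//.
  by rewrite ge_min lexx orbT.
- by move=> k kd; apply: uc; exact: bk.
move=> k kd2.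
have kd j : `|h n * (k 0 j)%:~R - x0 0 j| <= d by apply: le_trans (kd2 j) _; lra.
have bkk := bk k kd.
have bn := box_le (hn3 n nn3) bkk.
split.
- rewrite u_eq// -mulrBr normrM (ger0_norm (sqr_ge0 _)) ler_wpM2l ?sqr_ge0//.
  apply: h2 (u_ge0 bn) _.
    by move=> j; rewrite mxE; apply: le_lt_trans (kd2 j) _; lra.
  by apply: le_trans (uc k bkk) _; rewrite ge_min lexx.
- have := @consistency R N U V V2 (fun i => V i x0) (fun i => V2 i x0) (h n) s k hp dU dV.
  move=> H; apply: le_trans (H _) _; last first.
    rewrite ler_wpM2l ?sqr_ge0//; lra.
  move=> i t th.
  have hy : inball x0 d1 (at_mesh (h n) k + t *: ebasis i).
    have k0 : inball x0 (d1 / 2) (at_mesh (h n) k).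
      by move=> j; rewrite mxE; apply: le_lt_trans (kd2 j) _; lra.
    by apply: inball_le (inball_shift t i k0); lra.
  by have [/ltW ? /ltW ?] := h1 _ hy i.
apply: le_trans (quad_dop s (ltW hp) dd3 kd) _.
rewrite gtr0_norm// ler_wpM2l ?sqr_ge0//; lra.
Qed.

(* If the equation failed at [x0], then [U] plus or minus [s |x - x0|^2] would touch [u n]
   from one side while being a strict discrete super- or subsolution. *)
Lemma limit_equation x0 :
  \sum_i V2 i x0 + l2norm (fun i => V i x0) = p x0 * f (U x0).
Proof.
set L := _ + _; set g := p x0 * f (U x0).
have [gL|Lg|//] := ltrgtP L g.
- have gap0 : 0 < g - L by lra.
  have [n [d [s [eta [[e1 e2 e3 e4] e5 hu hD]]]]] := setting x0 gap0.
  have hp := h0 n; have h2 : 0 < h n ^+ 2 by rewrite exprn_gt0.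
  exfalso; apply: (@no_touch R N (h n) d s eta (h n ^+ 2 * ((g - L) / 8)) x0 (fl h n x0)
    (u n) (fun l => U (at_mesh (h n) l) + s * quad (h n) x0 l)) => //.
  + by rewrite mulr_gt0//; lra.
  + by move=> j; have := fl_near h0 n x0 j; rewrite mul1r.
  + by move=> k kd; rewrite [X in `|X|](_ : _ = u n k - U (at_mesh (h n) k)); [exact: hu|ring].
  move=> k kd; have [a1 a2 a3] := hD k kd.
  have t0 : 0 <= h n / 2 by lra.
  have a4 := dop_perturb (fun l => U (at_mesh (h n) l)) (fun l => s * quad (h n) x0 l) k t0.
  have b1 := le_trans (ler_norm _) (le_trans a4 a3).
  have b2 := le_trans (ler_norm _) a2.
  move: a1; rewrite ler_norml => /andP[b3 _].
  exact: touching_arith (mulr_ge0 (ltW h2) (ltW gap0)) b1 b2 b3.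
- have gap0 : 0 < L - g by lra.
  have [n [d [s [eta [[e1 e2 e3 e4] e5 hu hD]]]]] := setting x0 gap0.
  have hp := h0 n; have h2 : 0 < h n ^+ 2 by rewrite exprn_gt0.
  exfalso; apply: (@no_touch R N (h n) d s eta (h n ^+ 2 * ((L - g) / 8)) x0 (fl h n x0)
    (fun l => U (at_mesh (h n) l) + (- (s * quad (h n) x0 l))) (u n)) => //.
  + by rewrite mulr_gt0//; lra.
  + by move=> j; have := fl_near h0 n x0 j; rewrite mul1r.
  + move=> k kd; rewrite distrC [X in `|X|](_ : _ = u n k - U (at_mesh (h n) k)); [exact: hu|ring].
  move=> k kd; have [a1 a2 a3] := hD k kd.
  have t0 : 0 <= h n / 2 by lra.
  have := dop_perturb (fun l => U (at_mesh (h n) l)) (fun l => - (s * quad (h n) x0 l)) k t0.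
  have -> : dlap (fun l => - (s * quad (h n) x0 l)) k = - dlap (fun l => s * quad (h n) x0 l) k.
    by rewrite /dlap -sumrN; apply: eq_bigr => i _; ring.
  have -> : dgrad (fun l => - (s * quad (h n) x0 l)) k = dgrad (fun l => s * quad (h n) x0 l) k.
    by rewrite /dgrad -l2normN; apply: eq_l2norm => i; ring.
  rewrite normrN => a4.
  have := le_trans a4 a3; rewrite ler_norml => /andP[b1 _].
  move: a2; rewrite ler_norml => /andP[b2 _].
  have b3 := le_trans (ler_norm _) a1.
  exact: touching_arith' (mulr_ge0 (ltW h2) (ltW gap0)) b1 b2 b3.
Qed.

End Equation.

(** * Radial potentials *)

Section Primitive.
Context {R : realType}.
Implicit Types (f g : R -> R) (t : R).
Local Notation mu := (@lebesgue_measure R).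

Definition prim f t : R := Rintegral mu `[0, t] f.

Lemma continuous_within_any f (A : set R) : continuous f -> {within A, continuous f}.
Proof. exact: continuous_subspaceT. Qed.

Lemma prim_integrable f t : continuous f -> mu.-integrable `[0, t] (EFin \o f).
Proof.
move=> fc; apply: continuous_compact_integrable; first exact: segment_compact.
exact: continuous_within_any.
Qed.

Lemma prim0 f : prim f 0 = 0.
Proof. by rewrite /prim set_itv1 Rintegral_set1. Qed.

Lemma eq_prim f g t : (forall s : R, 0 <= s -> s <= t -> f s = g s) -> prim f t = prim g t.
Proof.
by move=> fg; apply: eq_Rintegral => s; rewrite inE/= in_itv/= => /andP[s0 st]; exact: fg.
Qed.

Lemma prim_le f g t : continuous f -> continuous g ->
  (forall s : R, 0 <= s -> s <= t -> f s <= g s) -> prim f t <= prim g t.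
Proof.
move=> fc gc fg; apply: le_Rintegral => //; try exact: prim_integrable.
by move=> s /=; rewrite in_itv/= => /andP[s0 st]; exact: fg.
Qed.

Lemma primD f g t : continuous f -> continuous g ->
  prim (fun s => f s + g s) t = prim f t + prim g t.
Proof. by move=> fc gc; apply: RintegralD => //; exact: prim_integrable. Qed.

Lemma primB f g t : continuous f -> continuous g ->
  prim (fun s => f s - g s) t = prim f t - prim g t.
Proof. by move=> fc gc; apply: RintegralB => //; exact: prim_integrable. Qed.

Lemma primZ c f t : continuous f -> prim (fun s => c * f s) t = c * prim f t.
Proof. by move=> fc; apply: RintegralZl => //; exact: prim_integrable. Qed.

Lemma prim_cst c t : 0 <= t -> prim (fun=> c) t = c * t.
Proof.
move=> t0; rewrite /prim Rintegral_cst//.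
by rewrite /= lebesgue_measure_itv/= lte_fin; case: ltrgtP t0 => // [t0 _|<- _]; rewrite /= ?oppr0 ?addr0 ?mulr0.
Qed.

Lemma prim_bound f M t : continuous f -> 0 <= t ->
  (forall s : R, 0 <= s -> s <= t -> `|f s| <= M) -> `|prim f t| <= M * t.
Proof.
move=> fc t0 fM.
have cc : continuous (fun _ : R => M) by move=> x; exact: cvg_cst.
have cn : continuous (fun _ : R => - M) by move=> x; exact: cvg_cst.
rewrite ler_norml -mulNr -!prim_cst//; apply/andP; split; apply: prim_le => // s s0 st.
  by have := fM s s0 st; rewrite ler_norml => /andP[].
by have := fM s s0 st; rewrite ler_norml => /andP[].
Qed.

Lemma prim_derive f t : continuous f -> 0 < t -> is_derive t 1 (prim f) (f t).
Proof.
move=> fc t0; have [] := @continuous_FTC1_closed R f 0 t (t + 1) _ (prim_integrable (t + 1) fc) t0 (fc t).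
  by rewrite ltrDl.
by move=> d1 d2; apply: DeriveDef; [exact: d1|rewrite -derive1E].
Qed.

Lemma prim_right0 f : continuous f -> prim f x @[x --> 0^'+] --> prim f 0.
Proof.
move=> fc; rewrite prim0; apply/cvgrPdist_le => e e0.
have [c _ hc] := @EVT_max R (fun s => `|f s|) 0 1 ler01 (continuous_within_any (A := `[0, 1])
  (fun x => @cvg_norm _ _ _ _ _ _ _ (fc x))).
pose M := `|f c| + 1; have M0 : 0 < M by rewrite ltr_wpDl.
near=> t; rewrite sub0r normrN.
have t0 : 0 < t by near: t; exact: nbhs_right_gt.
have t1 : t <= 1 by near: t; apply: nbhs_right_le.
have te : t <= e / M by near: t; apply: nbhs_right_le; rewrite divr_gt0.
apply: le_trans (_ : M * t <= _); last by rewrite mulrC -ler_pdivlMr.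
apply: prim_bound (ltW t0) _ => // s s0 st.
apply: le_trans (hc s _) _; first by rewrite in_itv/= s0 (le_trans st).
by rewrite lerDl.
Unshelve. all: by end_near. Qed.

(** [prim f] is zero on the negative half-line, where the interval is empty, so it need not be
    differentiable at 0. Calculus on the ray uses derivatives at positive points and a right limit
    at the origin. *)
Lemma within_continuous_ray (F dF : R -> R) (s t : R) : 0 <= s -> s < t ->
  F x @[x --> 0^'+] --> F 0 -> (forall r : R, 0 < r -> is_derive r 1 F (dF r)) ->
  {within `[s, t], continuous F}.
Proof.
move=> s0 st F0 dFr.
have cF (r : R) : 0 < r -> {for r, continuous F}.
  move=> r0; apply/differentiable_continuous/derivable1_diffP.
  exact: @ex_derive _ _ _ _ _ _ _ (dFr r r0).
apply/(continuous_within_itvP _ st); split.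
- by move=> r; rewrite in_itv/= => /andP[sr _]; apply: cF; exact: le_lt_trans sr.
- move: s0 st; rewrite le_eqVlt => /predU1P[<- _//|s0 st].
  by apply: cvg_at_right_filter; exact: cF.
- by apply: cvg_at_left_filter; apply: cF; exact: le_lt_trans st.
Qed.

Lemma ray_MVT (F dF : R -> R) (s t : R) : 0 <= s -> s < t ->
  F x @[x --> 0^'+] --> F 0 -> (forall r : R, 0 < r -> is_derive r 1 F (dF r)) ->
  exists c, [/\ s < c, c < t & F t - F s = dF c * (t - s)].
Proof.
move=> s0 st F0 dFr.
have [|c] := @MVT R F dF s t st _ (within_continuous_ray s0 st F0 dFr).
  by move=> r; rewrite in_itv/= => /andP[sr _]; apply: dFr; exact: le_lt_trans sr.
by rewrite in_itv/= => /andP[sc ct] hc; exists c.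
Qed.

Lemma ray_nondecreasing (F dF : R -> R) (s t : R) : 0 <= s -> s <= t ->
  F x @[x --> 0^'+] --> F 0 -> (forall r : R, 0 < r -> is_derive r 1 F (dF r)) ->
  (forall r : R, 0 < r -> 0 <= dF r) -> F s <= F t.
Proof.
move=> s0; rewrite le_eqVlt => /predU1P[->//|st] F0 dFr dF0.
have [c [sc ct h]] := ray_MVT s0 st F0 dFr.
rewrite -subr_ge0 h mulr_ge0 ?subr_ge0 ?(ltW st)// dF0//; exact: le_lt_trans sc.
Qed.

Lemma prim_mono f s t : continuous f -> (forall r : R, 0 <= r -> 0 <= f r) -> 0 <= s -> s <= t ->
  prim f s <= prim f t.
Proof.
move=> fc f0 s0 st; apply: (ray_nondecreasing (dF := f) s0 st); first exact: prim_right0.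
  by move=> r r0; exact: prim_derive.
by move=> r r0; exact: f0 (ltW r0).
Qed.

Lemma prim_ge0 f t : (forall r : R, 0 <= r -> 0 <= f r) -> 0 <= prim f t.
Proof.
by move=> f0; apply: Rintegral_ge0 => s /=; rewrite in_itv/= => /andP[s0 _]; exact: f0.
Qed.

Lemma prim_eq (F f : R -> R) t : continuous f -> 0 <= t ->
  F x @[x --> 0^'+] --> F 0 -> (forall r : R, 0 < r -> is_derive r 1 F (f r)) ->
  prim f t = F t - F 0.
Proof.
move=> fc; rewrite le_eqVlt => /predU1P[<- _ _|t0 F0 dF]; first by rewrite prim0 subrr.
have := @ray_MVT (fun r => prim f r - F r) (fun r => f r - f r) 0 t (lexx 0) t0.
case=> [||c [_ _]].
- by apply: cvgB => //; exact: prim_right0.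
- by move=> r r0; apply: is_deriveB; [exact: prim_derive|exact: dF].
rewrite subrr mul0r prim0 sub0r opprK => /eqP h.
by apply/eqP; rewrite -subr_eq0 -{2}(eqP h); apply/eqP; ring.
Qed.

End Primitive.

Section RadialPotential.
Context {R : realType} (N : nat).
Hypothesis N0 : (0 < N)%N.
Implicit Types (q : R -> R) (t : R).

Definition density q : R -> R := fun s => expR s * s ^+ N.-1 * q s.

(** This is [G' / r] rather than [G']: it extends continuously to the origin with the value
    [q 0 / N%:R], and the partial derivatives of the radial function are then [slope] times a
    coordinate, without singularity. *)
Definition slope q t : R :=
  if t == 0 then q 0 / N%:R else expR (- t) * (t ^+ N)^-1 * prim (density q) t.

(* [pot q] vanishes at 0 and solves [G'' + (N - 1) / r G' + G' = q], with [G' r = r * slope q r]. *)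
Definition pot q t : R := prim (fun s => s * slope q `|s|) t.

Let NR : 0 < N%:R :> R. Proof. by rewrite ltr0n. Qed.

Lemma continuous_density q : continuous q -> continuous (density q).
Proof.
move=> qc t; apply: cvgM; last exact: qc.
by apply: cvgM; [exact: continuous_expR|exact: exprn_continuous].
Qed.

Lemma slope_pos q t : t != 0 -> slope q t = expR (- t) * (t ^+ N)^-1 * prim (density q) t.
Proof. by rewrite /slope => /negPf ->. Qed.

Lemma slope_ge0 q t : 0 <= t -> (forall s : R, 0 <= s -> 0 <= q s) -> 0 <= slope q t.
Proof.
move=> t0 q0; rewrite /slope; case: ifP => _; first by rewrite divr_ge0 ?q0.
rewrite !mulr_ge0 ?expR_ge0 ?invr_ge0 ?exprn_ge0 ?prim_ge0// => r r0.
by rewrite !mulr_ge0 ?expR_ge0 ?exprn_ge0 ?q0.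
Qed.

Lemma slope_le q1 q2 t : continuous q1 -> continuous q2 -> 0 <= t ->
  (forall s : R, 0 <= s -> s <= t -> q1 s <= q2 s) -> slope q1 t <= slope q2 t.
Proof.
move=> c1 c2 t0 q12; rewrite /slope; case: eqP => [t00|_].
  by rewrite ler_pM2r ?invr_gt0// q12.
rewrite ler_wpM2l ?mulr_ge0 ?expR_ge0 ?invr_ge0 ?exprn_ge0//.
apply: prim_le; [exact: continuous_density|exact: continuous_density|].
by move=> s s0 st; rewrite ler_wpM2l ?mulr_ge0 ?expR_ge0 ?exprn_ge0 ?q12.
Qed.

Lemma slopeD q1 q2 t : continuous q1 -> continuous q2 ->
  slope (fun s => q1 s + q2 s) t = slope q1 t + slope q2 t.
Proof.
move=> c1 c2; rewrite /slope; case: ifP => _; first by rewrite mulrDl.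
rewrite -mulrDr -primD; try exact: continuous_density.
by congr (_ * _); apply: eq_prim => s _ _; rewrite /density mulrDr.
Qed.

Lemma slopeZ c q t : continuous q -> slope (fun s => c * q s) t = c * slope q t.
Proof.
move=> c1; rewrite /slope; case: ifP => _; first by rewrite mulrA.
rewrite mulrCA -(primZ c); last exact: continuous_density.
by congr (_ * _); apply: eq_prim => s _ _; rewrite /density; ring.
Qed.

(** With [G' = r * slope q r], this is the radial equation for [G] solved for the derivative of
    [slope]. *)
Lemma is_derive_slope q t : continuous q -> 0 < t ->
  is_derive t 1 (slope q) ((q t - (N%:R + t) * slope q t) / t).
Proof.
move=> qc t0; have tn0 : t != 0 by rewrite gt_eqF.
pose g (s : R) : R := expR (- s) * (s ^+ N)^-1 * prim (density q) s.
have d3 := prim_derive (continuous_density qc) t0.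
have d1 : is_derive t 1 (fun s : R => expR (- s)) (expR (- t) * (- 1)).
  exact: (@is_derive1_comp R expR -%R t (expR (- t)) (- 1) (is_derive_expR (- t)) (is_deriveNid t 1)).
have d2 : is_derive t 1 (fun s : R => (s ^+ N)^-1) (- (t ^+ N) ^- 2 * (N%:R * t ^+ N.-1)).
  have dX : is_derive t 1 (fun s : R => s ^+ N) (N%:R * t ^+ N.-1).
    by apply: DeriveDef; [exact: exprn_derivable|rewrite exp_derive [LHS]mulr1].
  have tN : t ^+ N != 0 by rewrite expf_neq0.
  apply: DeriveDef; first by apply: derivableV => //; exact: @ex_derive _ _ _ _ _ _ _ dX.
  by rewrite deriveV// (@derive_val _ _ _ _ _ _ _ dX).
have dg : is_derive t 1 g ((q t - (N%:R + t) * slope q t) / t).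
  have dg' := is_deriveM (is_deriveM d1 d2) d3.
  apply: (is_derive_eq dg').
  rewrite slope_pos// -/(g t).
  transitivity (expR (- t) * (t ^+ N)^-1 * density q t + prim (density q) t *
    (expR (- t) * (- (t ^+ N) ^- 2 * (N%:R * t ^+ N.-1)) + (t ^+ N)^-1 * (expR (- t) * -1))) => //.
  rewrite /g expRN; set P := prim _ _; rewrite /density.
  have -> : t ^+ N = t * t ^+ N.-1 by rewrite -exprS prednK.
  have tp : t ^+ N.-1 != 0 by rewrite expf_neq0.
  have ep : expR t != 0 by rewrite gt_eqF// expR_gt0.
  by field; rewrite tn0 tp ep.
apply: near_eq_is_derive dg; near=> s.
by rewrite slope_pos// gt_eqF//; near: s; exact: lt_nbhsr.
Unshelve. all: by end_near. Qed.

Lemma slope_near0 q (e : R) : continuous q -> 0 < e -> exists d : R, 0 < d /\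
  forall t, 0 <= t -> t < d -> `|slope q t - q 0 / N%:R| <= e.
Proof.
move=> qc e0.
have e2 : 0 < e / 2 by lra.
have := qc 0; move=> /cvgrPdist_lt/(_ _ e2)[d /= d0 hd].
have M0 : 0 < `|q 0| + e / 2 by rewrite ltr_wpDl.
(* The second entry controls the exponential weight: [1 - expR (s - t)] is at most [t], and [q] is
   at most [|q 0| + e / 2] in absolute value, so their product is at most [e / 2]. *)
pose d' := Num.min d (e / 2 / (`|q 0| + e / 2)).
have d'0 : 0 < d' by rewrite lt_min d0 divr_gt0.
exists d'; split=> // t t0 td.
have [td1 td2] : t < d /\ t < e / 2 / (`|q 0| + e / 2) by move: td; rewrite lt_min => /andP.
move: t0; rewrite le_eqVlt => /predU1P[<-|t0].
  by rewrite /slope eqxx subrr normr0 ltW.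
have tn0 : t != 0 by rewrite gt_eqF.
have hq s : 0 <= s -> s <= t -> `|q s - q 0| <= e / 2.
  move=> s0 st; rewrite distrC ltW// hd//= sub0r normrN ger0_norm//.
  exact: le_lt_trans td1.
have hc : continuous (fun s : R => expR (- t) * density q s - q 0 * s ^+ N.-1).
  move=> s; apply: cvgB; apply: cvgM; try exact: cvg_cst; last exact: exprn_continuous.
  exact: continuous_density.
have xc : continuous (fun s : R => s ^+ N.-1) by exact: exprn_continuous.
have pX : prim (fun s : R => s ^+ N.-1) t = t ^+ N / N%:R.
  have dF (r : R) : 0 < r -> is_derive r 1 (fun s : R => s ^+ N / N%:R) (r ^+ N.-1).
    move=> r0.
    have dX : is_derive r 1 (fun s : R => s ^+ N) (N%:R * r ^+ N.-1).
      by apply: DeriveDef; [exact: exprn_derivable|rewrite exp_derive [LHS]mulr1].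
    have dg' := is_deriveM dX (is_derive_cst (N%:R^-1 : R) r 1).
    apply: (is_derive_eq dg').
    transitivity (r ^+ N * 0 + N%:R^-1 * (N%:R * r ^+ N.-1)) => //.
    by rewrite mulr0 add0r mulKf// gt_eqF.
  have F0 : (s ^+ N / N%:R : R) @[s --> (0 : R)^'+] --> (0 ^+ N / N%:R : R).
    by apply: cvg_at_right_filter; apply: cvgM; [exact: exprn_continuous|exact: cvg_cst].
  have := prim_eq xc (ltW t0) F0 dF.
  by rewrite expr0n gtn_eqF// mul0r subr0.
(* By [pX] the constant [q 0 / N%:R] is itself a normalized integral of [q 0 * s ^+ N.-1], so the
   difference is one integral with a small integrand. *)
have -> : slope q t - q 0 / N%:R =
   (t ^+ N)^-1 * prim (fun s => expR (- t) * density q s - q 0 * s ^+ N.-1) t.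
  rewrite primB; last 2 first.
  - by move=> s; apply: cvgM; [exact: cvg_cst|exact: continuous_density].
  - by move=> s; apply: cvgM; [exact: cvg_cst|exact: exprn_continuous].
  rewrite primZ; last exact: continuous_density.
  rewrite primZ// pX slope_pos//; set P := prim _ _; field.
  by rewrite gt_eqF//= expf_neq0.
have tN : 0 < t ^+ N by rewrite exprn_gt0.
rewrite normrM gtr0_norm ?invr_gt0// ler_pdivrMl//.
have -> : t ^+ N * e = e * t ^+ N.-1 * t by rewrite -{1}(prednK N0) exprS; ring.
apply: prim_bound (ltW t0) _ => // s s0 st.
have -> : expR (- t) * density q s - q 0 * s ^+ N.-1 =
    s ^+ N.-1 * ((q s - q 0) - (1 - expR (s - t)) * q s).
  by rewrite /density expRB expRN; ring.
rewrite normrM ger0_norm ?exprn_ge0// mulrC ler_pM ?exprn_ge0//; last first.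
  by rewrite lerXn2r ?nnegrE// ltW.
apply: le_trans (ler_normB _ _) _.
have b1 : `|(1 - expR (s - t)) * q s| <= e / 2.
  have x1 : expR (s - t) <= 1 by rewrite expR_le1; lra.
  have x2 := expR_ge1Dx (s - t).
  rewrite normrM ger0_norm ?subr_ge0//.
  apply: (@le_trans _ _ (t * (`|q 0| + e / 2))).
    apply: ler_pM => //; [lra|lra|].
    by have := hq s s0 st; have := ler_normD (q s - q 0) (q 0); rewrite subrK; lra.
  by rewrite -ler_pdivlMr// ltW.
have := hq s s0 st; lra.
Qed.

Definition even_slope q t := slope q `|t|.

Lemma continuous_even_slope q : continuous q -> continuous (even_slope q).
Proof.
move=> qc t; have [->|t0] := eqVneq t 0.
  apply/cvgrPdist_le => e e0; have [d [d0 hd]] := slope_near0 qc e0.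
  exists d => //= s; rewrite /ball_/= sub0r normrN => sd.
  by rewrite distrC /even_slope normr0 [slope q 0]/slope eqxx; apply: hd.
have nt : 0 < `|t| by rewrite normr_gt0.
have sc : {for `|t|, continuous (slope q)}.
  apply/differentiable_continuous/derivable1_diffP.
  exact: @ex_derive _ _ _ _ _ _ _ (is_derive_slope qc nt).
apply: (cvg_comp (fun s : R => `|s|) (slope q) _ sc).
exact: cvg_norm cvg_id.
Qed.

Lemma continuous_pot_integrand q : continuous q -> continuous (fun s : R => s * slope q `|s|).
Proof. by move=> qc s; apply: cvgM; [exact: cvg_id|exact: continuous_even_slope]. Qed.

Lemma is_derive_pot q t : continuous q -> 0 < t -> is_derive t 1 (pot q) (t * slope q t).
Proof.
move=> qc t0; have := prim_derive (continuous_pot_integrand qc) t0.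
by rewrite (gtr0_norm t0).
Qed.

Lemma pot0 q : pot q 0 = 0.
Proof. exact: prim0. Qed.

Lemma pot_right0 q : continuous q -> pot q x @[x --> 0^'+] --> pot q 0.
Proof. by move=> qc; exact: prim_right0 (continuous_pot_integrand qc). Qed.

Lemma pot_mono q s t : continuous q -> (forall s : R, 0 <= s -> 0 <= q s) -> 0 <= s -> s <= t ->
  pot q s <= pot q t.
Proof.
move=> qc q0; apply: prim_mono; first exact: continuous_pot_integrand.
by move=> r r0; rewrite mulr_ge0// slope_ge0.
Qed.

Lemma pot_ge0 q t : (forall s : R, 0 <= s -> 0 <= q s) -> 0 <= pot q t.
Proof. by move=> q0; apply: prim_ge0 => r r0; rewrite mulr_ge0// slope_ge0. Qed.

Lemma potD q1 q2 t : continuous q1 -> continuous q2 ->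
  pot (fun s => q1 s + q2 s) t = pot q1 t + pot q2 t.
Proof.
move=> c1 c2; rewrite /pot -primD; try exact: continuous_pot_integrand.
by apply: eq_prim => s _ _; rewrite slopeD// mulrDr.
Qed.

Lemma potZ c q t : continuous q -> pot (fun s => c * q s) t = c * pot q t.
Proof.
move=> c1; rewrite /pot -primZ; last exact: continuous_pot_integrand.
by apply: eq_prim => s _ _; rewrite slopeZ// mulrCA.
Qed.

Lemma pot_le q1 q2 t : continuous q1 -> continuous q2 ->
  (forall s : R, 0 <= s -> q1 s <= q2 s) -> pot q1 t <= pot q2 t.
Proof.
move=> c1 c2 q12; apply: prim_le; try exact: continuous_pot_integrand.
by move=> s s0 _; rewrite ler_wpM2l// slope_le// => r r0 _; exact: q12.
Qed.

(* [r G' + (N - 2) G - int_0^r s q] has derivative [- r G'] times a nonnegative factor, which is where Lambda_N comes from. *)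
Lemma pot_bound q t : continuous q -> (forall s : R, 0 <= s -> 0 <= q s) -> (2 <= N)%N -> 0 <= t ->
  (N%:R - 2) * pot q t <= prim (fun s => s * q s) t.
Proof.
move=> qc q0 N2 t0.
have sqc : continuous (fun s : R => s * q s) by move=> s; apply: cvgM; [exact: cvg_id|exact: qc].
pose F (r : R) := prim (fun s => s * q s) r - (N%:R - 2) * pot q r - (r * r) * slope q r.
have : F 0 <= F t.
  apply: (@ray_nondecreasing _ F (fun r => r * (r * slope q r)) 0 t (lexx 0) t0).
  - apply: cvgB; first apply: cvgB.
    + exact: prim_right0.
    + by apply: cvgM; [exact: cvg_cst|exact: pot_right0].
    + rewrite !mul0r; apply/cvgrPdist_le => e e0.
      have [d [d0 hd]] := slope_near0 qc ltr01.
      have M0 : 0 < `|q 0 / N%:R| + 1 by rewrite ltr_wpDl.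
      near=> r.
      have r0 : 0 < r by near: r; exact: nbhs_right_gt.
      have rd : r < d by near: r; apply: nbhs_right_lt.
      have r1 : r <= 1 by near: r; apply: nbhs_right_le.
      have re : r <= e / (`|q 0 / N%:R| + 1) by near: r; apply: nbhs_right_le; rewrite divr_gt0.
      rewrite sub0r normrN normrM ger0_norm ?mulr_ge0 ?(ltW r0)//.
      have sl : `|slope q r| <= `|q 0 / N%:R| + 1.
        by have := hd r (ltW r0) rd; have := ler_normD (slope q r - q 0 / N%:R) (q 0 / N%:R); rewrite subrK; lra.
      apply: (@le_trans _ _ (r * (`|q 0 / N%:R| + 1))); last by rewrite -ler_pdivlMr.
      by apply: ler_pM => //; [rewrite mulr_ge0 ?ltW|rewrite ler_piMr ?(ltW r0)].
  - move=> r r0.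
    have d1 := prim_derive sqc r0.
    have d2 := is_derive_pot qc r0.
    have d3 := is_derive_slope qc r0.
    have d4 := is_deriveB (is_deriveB d1 (is_deriveM (is_derive_cst (N%:R - 2 : R) r 1) d2))
      (is_deriveM (is_deriveM (is_derive_id r 1) (is_derive_id r 1)) d3).
    apply: (is_derive_eq d4).
    transitivity (r * q r - ((N%:R - 2) * (r * slope q r) + pot q r * 0) -
      (r * r * ((q r - (N%:R + r) * slope q r) / r) + slope q r * (r * 1 + r * 1))) => //.
    by field; rewrite gt_eqF.
  - by move=> r r0; rewrite !mulr_ge0 ?(ltW r0)// slope_ge0// ltW.
rewrite /F prim0 pot0 !mul0r mulr0 !subr0 => h.
have : 0 <= t * t * slope q t by rewrite !mulr_ge0// slope_ge0.
lra.
Unshelve. all: by end_near. Qed.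

End RadialPotential.

(** * Radial functions on Euclidean space *)

Section EuclideanSpace.
Context {R : realType} {N : nat}.
Local Notation E := 'rV[R]_N.
Implicit Types (x y : E).

Lemma enorm_ge0 x : 0 <= enorm x.
Proof. exact: sqrtr_ge0. Qed.

Lemma enorm0 : enorm (0 : E) = 0.
Proof. by rewrite /enorm big1 ?sqrtr0// => i _; rewrite mxE expr0n. Qed.

Lemma sqr_enorm x : enorm x ^+ 2 = \sum_i x 0 i ^+ 2.
Proof. exact: sqr_l2norm. Qed.

Lemma coord_le_enorm x i : `|x 0 i| <= enorm x.
Proof. exact: coord_le_l2norm (fun i => x 0 i) i. Qed.

Lemma enorm0_eq0 x : enorm x = 0 -> x = 0.
Proof.
move=> x0; apply/rowP => i; rewrite mxE; apply/eqP.
by rewrite -normr_le0 -x0 coord_le_enorm.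
Qed.

Lemma enorm_inbox x (rho : R) : inbox rho x -> enorm x <= N%:R * rho.
Proof. by move=> bx; apply: l2norm_le_max. Qed.

Lemma inbox_enorm x (rho : R) : enorm x <= rho -> inbox rho x.
Proof. by move=> xr i; apply: le_trans (coord_le_enorm x i) xr. Qed.

Lemma enorm_lip x y : `|enorm x - enorm y| <= enorm (x - y).
Proof.
apply: le_trans (l2norm_lip (fun i => x 0 i) (fun i => y 0 i)) _.
by apply: eq_ler; apply: eq_l2norm => i; rewrite !mxE.
Qed.

Lemma enormZ (c : R) x : enorm (c *: x) = `|c| * enorm x.
Proof. by rewrite -[RHS](l2normZ c (fun i => x 0 i)); apply: eq_l2norm => i; rewrite mxE. Qed.

Lemma enorm_ebasis i : enorm (ebasis i : E) = 1.
Proof.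
rewrite /enorm (bigD1 i)//= big1 ?addr0 ?ebasisE ?eqxx ?expr1n ?sqrtr1//.
by move=> j ji; rewrite ebasisE (negPf ji) expr0n.
Qed.

Lemma continuous_enorm : continuous (enorm : E -> R).
Proof.
move=> x; apply/rV_cvgP => e e0; have N1 : 0 < N%:R + 1 :> R by rewrite ltr_wpDl.
exists (e / (N%:R + 1)); split; first by rewrite divr_gt0.
move=> y xy; apply: le_lt_trans (enorm_lip y x) _.
apply: (@le_lt_trans _ _ (N%:R * (e / (N%:R + 1)))).
  by apply: enorm_inbox => i; rewrite !mxE ltW//; exact: xy.
rewrite mulrA ltr_pdivrMr// mulrC ltr_pM2l//; lra.
Qed.

Lemma continuous_coord (i : 'I_N) : continuous (fun x : E => x 0 i).
Proof. by move=> x; apply/rV_cvgP => e e0; exists e; split=> // y; exact. Qed.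

Lemma rV_cvgM (v w : E -> R) x (a b : R) : v y @[y --> x] --> a -> w y @[y --> x] --> b ->
  (v y * w y) @[y --> x] --> a * b.
Proof. exact: (@cvgM _ _ (nbhs x) (nbhs_filter x)). Qed.

Lemma continuous_radial (g : R -> R) : continuous g -> continuous (fun x : E => g (enorm x)).
Proof. by move=> gc x; apply: (cvg_comp (enorm : E -> R) g (@continuous_enorm x) (gc _)). Qed.

Lemma is_derive_of_line (P : E -> R) (d : R) x i :
  is_derive (0 : R) 1 (fun s : R => P (x + s *: ebasis i)) d -> is_derive x (ebasis i) P d.
Proof.
move=> [dP dE].
have eq : (fun s : R => s^-1 *: (P (x + (s *: 1 + 0) *: ebasis i) - P (x + 0 *: ebasis i))) =
    (fun s : R => s^-1 *: (P (s *: ebasis i + x) - P x)).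
  by apply/funext => s; rewrite [s *: 1]mulr1 addr0 scale0r addr0 (addrC x).
by apply: DeriveDef; [rewrite /derivable -eq|rewrite -dE /derive eq].
Qed.

Lemma is_derive1_quotient (g : R -> R) (d : R) :
  (forall e : R, 0 < e -> exists c : R, 0 < c /\
     forall s, s != 0 -> `|s| < c -> `|s^-1 * (g s - g 0) - d| <= e) -> is_derive (0 : R) 1 g d.
Proof.
move=> H.
have hc : (fun t : R => t^-1 *: (g (t *: 1 + 0) - g 0)) @ 0^' --> d.
  apply/cvgrPdist_le => e e0; have [c [c0 hd]] := H e e0.
  exists c => //= t; rewrite /ball_/= sub0r normrN => tc t0.
  by rewrite distrC [t *: 1]mulr1 addr0; exact: hd.
by apply: DeriveDef; [apply/cvg_ex; exists d|exact: cvg_lim hc].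
Qed.

Lemma enorm_line x i (s : R) : enorm (x + s *: ebasis i) = Num.sqrt (enorm x ^+ 2 + (2 * x 0 i + s) * s).
Proof.
rewrite sqr_enorm /enorm; congr (Num.sqrt _).
have lineE j : (x + s *: ebasis i) 0 j = x 0 j + s * (j == i)%:R.
  by rewrite mxE [X in _ + X]mxE ebasisE.
rewrite (bigD1 i)//= [in RHS](bigD1 i)//= lineE eqxx mulr1.
rewrite (eq_bigr (fun j => x 0 j ^+ 2)); first by ring.
by move=> j ji; rewrite lineE (negPf ji) mulr0 addr0.
Qed.

Lemma is_derive_enorm_line x i : 0 < enorm x ->
  is_derive (0 : R) 1 (fun s : R => enorm (x + s *: ebasis i)) (x 0 i / enorm x).
Proof.
move=> x0.
have -> : (fun s : R => enorm (x + s *: ebasis i)) =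
    Num.sqrt \o (fun s : R => enorm x ^+ 2 + (2 * x 0 i + s) * s).
  by apply/funext => s; rewrite enorm_line.
pose g (s : R) := enorm x ^+ 2 + (2 * x 0 i + s) * s.
have dg : is_derive (0 : R) 1 g (2 * x 0 i).
  have d1 := is_deriveD (is_derive_cst (enorm x ^+ 2 : R) (0 : R) 1)
    (is_deriveM (is_deriveD (is_derive_cst (2 * x 0 i : R) (0 : R) 1) (is_derive_id (0 : R) 1)) (is_derive_id (0 : R) 1)).
  apply: (is_derive_eq d1).
  transitivity (0 + ((2 * x 0 i + 0) * 1 + 0 * (0 + 1))) => //; by ring.
have g0 : g 0 = enorm x ^+ 2 by rewrite /g mulr0 addr0.
have ds : is_derive (g 0) 1 Num.sqrt (2 * Num.sqrt (g 0))^-1.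
  by apply: is_derive1_sqrt; rewrite g0 exprn_gt0.
have dc := is_derive1_comp ds dg; apply: (is_derive_eq dc).
rewrite g0 sqrtr_sqr gtr0_norm//; field; exact: lt0r_neq0.
Qed.

End EuclideanSpace.

(** * Potentials as functions on the Euclidean space *)

Section RadialFunction.
Context {R : realType} {N : nat}.
Hypothesis N0 : (0 < N)%N.
Local Notation E := 'rV[R]_N.
Variable q : R -> R.
Hypothesis qc : continuous q.

Let NR : 0 < N%:R :> R. Proof. by rewrite ltr0n. Qed.

Definition radial_d1 (i : 'I_N) (x : E) : R := slope N q (enorm x) * x 0 i.
Definition radial_d2 (i : 'I_N) (x : E) : R := slope N q (enorm x) +
  (q (enorm x) - (N%:R + enorm x) * slope N q (enorm x)) * (x 0 i / enorm x) ^+ 2.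

Let cross (t : R) : R := q `|t| - (N%:R + `|t|) * slope N q `|t|.

Let cross_cont : continuous cross.
Proof.
have ac : continuous (fun t : R => `|t|) by move=> t; exact: cvg_norm cvg_id.
move=> t; apply: cvgB; first exact: (cvg_comp (fun t : R => `|t|) q (ac t) (@qc _)).
apply: cvgM; last exact: continuous_even_slope.
by apply: cvgD; [exact: cvg_cst|exact: ac].
Qed.

Let cross0 : cross 0 = 0.
Proof. by rewrite /cross normr0 addr0 /slope eqxx mulrC divfK ?subrr// gt_eqF. Qed.

Let slope_enorm_cont : continuous (fun x : E => slope N q (enorm x)).
Proof.
rewrite (_ : (fun x : E => _) = (fun x : E => even_slope N q (enorm x))).
  exact: continuous_radial (continuous_even_slope N0 qc).
by apply/funext => x; rewrite /even_slope ger0_norm ?enorm_ge0.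
Qed.

Lemma continuous_radial_d1 i : continuous (radial_d1 i).
Proof. exact: continuous_rV_M slope_enorm_cont (@continuous_coord R N i). Qed.

(** The factor [x 0 i / enorm x] is bounded, but discontinuous at the origin. It is multiplied by
    [cross], which is continuous and vanishes there because [slope] starts at [q 0 / N%:R]. *)
Lemma continuous_radial_d2 i : continuous (radial_d2 i).
Proof.
have cc := continuous_radial cross_cont : continuous (fun x : E => cross (enorm x)).
suff H : continuous (fun x : E => cross (enorm x) * (x 0 i / enorm x) ^+ 2).
  rewrite (_ : radial_d2 i = (fun x : E => slope N q (enorm x) + cross (enorm x) * (x 0 i / enorm x) ^+ 2)).
    exact: continuous_rV_D slope_enorm_cont H.
  by apply/funext => x; rewrite /radial_d2 /cross ger0_norm ?enorm_ge0.
move=> x; have [x0|x0] := eqVneq (enorm x) 0.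
  apply/rV_cvgP => e e0; rewrite x0 cross0 mul0r.
  have := (rV_cvgP _ _ _).1 (cc x) _ e0; rewrite x0 cross0 => -[d [d0 hd]].
  exists d; split=> // y /hd; rewrite !subr0; apply: le_lt_trans.
  rewrite normrM ler_piMr// normrX expr_le1// normrM normfV.
  rewrite (ger0_norm (enorm_ge0 y)).
  have [->|y0] := eqVneq (enorm y) 0; first by rewrite invr0 mulr0.
  by rewrite ler_pdivrMr ?mul1r ?coord_le_enorm// lt_neqAle eq_sym y0 enorm_ge0.
have hq : (fun y : E => y 0 i / enorm y) @ x --> x 0 i / enorm x.
  apply: (@rV_cvgM _ _ (fun y : E => y 0 i) (fun y : E => (enorm y)^-1)); first exact: continuous_coord.
  have iv : {for enorm x, continuous (@GRing.inv R)} by exact: inv_continuous.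
  exact: (cvg_comp (enorm : E -> R) (@GRing.inv R) (@continuous_enorm R N x) iv).
apply: (@rV_cvgM _ _ (fun y : E => cross (enorm y)) (fun y : E => (y 0 i / enorm y) ^+ 2)); first exact: cc.
rewrite expr2 (_ : (fun y : E => _) = (fun y : E => y 0 i / enorm y * (y 0 i / enorm y))).
  exact: (rV_cvgM hq hq).
by apply/funext => y; rewrite expr2.
Qed.

Let pot_small : exists M c : R, [/\ 0 < M, 0 < c & forall t, 0 <= t -> t < c -> `|pot N q t| <= M * t * t].
Proof.
have [d [d0 hd]] := slope_near0 N0 qc ltr01.
exists (`|q 0 / N%:R| + 1), d; split=> //.
move=> t t0 td; apply: prim_bound (continuous_pot_integrand N0 qc) t0 _ => s s0 st.
rewrite normrM !(ger0_norm s0) mulrC ler_pM//.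
have := hd s s0 (le_lt_trans st td); have := ler_normD (slope N q s - q 0 / N%:R) (q 0 / N%:R).
rewrite subrK; lra.
Qed.

Let line0 i (s : R) : enorm ((0 : E) + s *: ebasis i) = `|s|.
Proof. by rewrite add0r enormZ enorm_ebasis mulr1. Qed.

Lemma is_derive_radial i x : is_derive x (ebasis i) (fun y : E => pot N q (enorm y)) (radial_d1 i x).
Proof.
apply: is_derive_of_line.
have [x0|x0] := eqVneq (enorm x) 0.
  have -> := enorm0_eq0 x0; rewrite /radial_d1 mxE mulr0.
  apply: is_derive1_quotient => e e0; have [M [c [M0 c0 hM]]] := pot_small.
  exists (Num.min c (e / M)); split; first by rewrite lt_min c0 divr_gt0.
  move=> s s0; rewrite lt_min => /andP[sc se].
  rewrite !line0 normr0 pot0 !subr0 normrM normfV mulrC ler_pdivrMr ?normr_gt0//.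
  apply: le_trans (hM _ (normr_ge0 s) sc) _; rewrite ler_wpM2r//.
  by rewrite mulrC -ler_pdivlMr// ltW.
have xp : 0 < enorm x by rewrite lt_neqAle eq_sym x0 enorm_ge0.
have dl := is_derive_enorm_line i xp.
have dp : is_derive (enorm (x + 0 *: ebasis i)) 1 (pot N q) (enorm x * slope N q (enorm x)).
  by rewrite scale0r addr0; exact: is_derive_pot.
have dc := @is_derive1_comp R (pot N q) (fun s : R => enorm (x + s *: ebasis i)) 0 _ _ dp dl; apply: (is_derive_eq dc).
rewrite /radial_d1; field; exact: lt0r_neq0.
Qed.

Lemma is_derive_radial2 i x : is_derive x (ebasis i) (radial_d1 i) (radial_d2 i x).
Proof.
apply: is_derive_of_line.
have lineE (s : R) : (x + s *: ebasis i) 0 i = x 0 i + s.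
  by rewrite mxE [X in _ + X]mxE ebasisE eqxx mulr1.
have [x0|x0] := eqVneq (enorm x) 0.
  have xE := enorm0_eq0 x0; rewrite /radial_d2 x0 xE invr0 mulr0 expr0n mulr0 addr0.
  apply: is_derive1_quotient => e e0; have [c [c0 hc]] := slope_near0 N0 qc e0.
  exists c; split=> // s s0 sc.
  rewrite /radial_d1 -xE !lineE xE !line0 mxE !add0r mulr0 subr0.
  have -> : s^-1 * (slope N q `|s| * s) = slope N q `|s| by field.
  by rewrite [slope N q 0]/slope eqxx; exact: hc.
have xp : 0 < enorm x by rewrite lt_neqAle eq_sym x0 enorm_ge0.
have dl := is_derive_enorm_line i xp.
have dp : is_derive (enorm (x + 0 *: ebasis i)) 1 (slope N q)
    ((q (enorm x) - (N%:R + enorm x) * slope N q (enorm x)) / enorm x).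
  by rewrite scale0r addr0; exact: is_derive_slope.
have dc := @is_derive1_comp R (slope N q) (fun s : R => enorm (x + s *: ebasis i)) 0 _ _ dp dl.
have dd := is_deriveM dc (is_deriveD (is_derive_cst (x 0 i : R) (0 : R) 1) (is_derive_id (0 : R) 1)).
have -> : (fun s : R => radial_d1 i (x + s *: ebasis i)) =
   (slope N q \o (fun s : R => enorm (x + s *: ebasis i))) * (cst (x 0 i) + id).
  by apply/funext => s; rewrite /radial_d1 lineE.
apply: (is_derive_eq dd).
transitivity (slope N q (enorm (x + 0 *: ebasis i)) * (0 + 1) +
  (x 0 i + 0) * ((q (enorm x) - (N%:R + enorm x) * slope N q (enorm x)) / enorm x * (x 0 i / enorm x))) => //.
rewrite scale0r addr0 /radial_d2; field; exact: lt0r_neq0.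
Qed.

Lemma radial_laplacian x : \sum_i radial_d2 i x = q (enorm x) - enorm x * slope N q (enorm x).
Proof.
rewrite /radial_d2 big_split/= sumr_const card_ord -mulr_sumr.
have [x0|x0] := eqVneq (enorm x) 0.
  rewrite x0 mul0r addr0 subr0 big1 ?mulr0 ?addr0; last by move=> i _; rewrite invr0 mulr0 expr0n.
  by rewrite /slope eqxx/= -[LHS]mulr_natr divfK// gt_eqF.
have -> : \sum_i (x 0 i / enorm x) ^+ 2 = 1.
  under eq_bigr do rewrite exprMn.
  by rewrite -mulr_suml -sqr_enorm -exprMn divff// expr1n.
rewrite mulr1 -[_ *+ N]mulr_natl; ring.
Qed.

(** Nonnegativity of the slope turns the modulus of [G'] into [G'] itself; this is what makes the
    radial equation linear. *)
Lemma radial_gradient x : 0 <= slope N q (enorm x) ->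
  l2norm (fun i => radial_d1 i x) = enorm x * slope N q (enorm x).
Proof.
by move=> s0; rewrite /radial_d1 l2normZ ger0_norm// mulrC.
Qed.

End RadialFunction.

(** * Extremes of a Hoelder function over spheres *)

Section SphereExtrema.
Context {R : realType} {N : nat}.
Hypothesis N0 : (0 < N)%N.
Local Notation E := 'rV[R]_N.
Variables (alpha : R) (p : E -> R).
Hypotheses (alpha0 : 0 < alpha) (p_holder : loc_holder_on alpha setT p).

(** Radial projection onto the sphere, in an arbitrary direction if [x] is the origin. It transfers
    the Hoelder modulus of [p] to the maximum and the minimum over spheres. *)
Lemma sphere_move x (r : R) : 0 <= r -> exists y : E, enorm y = r /\ enorm (x - y) = `|enorm x - r|.
Proof.
move=> r0; have [x0|x0] := eqVneq (enorm x) 0.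
  exists (r *: ebasis (Ordinal N0)); have -> := enorm0_eq0 x0.
  by rewrite sub0r -scaleNr !enormZ enorm_ebasis !mulr1 enorm0 sub0r normrN ger0_norm.
have xp : 0 < enorm x by rewrite lt_neqAle eq_sym x0 enorm_ge0.
exists ((r / enorm x) *: x); split.
  by rewrite enormZ ger0_norm ?divr_ge0 ?enorm_ge0// divfK.
have -> : x - (r / enorm x) *: x = (1 - r / enorm x) *: x by rewrite scalerBl scale1r.
rewrite enormZ -{2}[enorm x](gtr0_norm xp) -normrM; congr (`|_|); field; exact: x0.
Qed.

Lemma ball_bounded (r : R) : 0 < r -> exists C : R, forall x, enorm x <= r -> `|p x| <= C.
Proof.
move=> r0; have [C HC] := p_holder r0.
exists (`|C| * r `^ alpha + `|p 0|) => x xr.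
have := HC x 0 I I xr; rewrite enorm0 => /(_ (ltW r0)); rewrite subr0 => hx.
have : C * enorm x `^ alpha <= `|C| * r `^ alpha.
  apply: (@le_trans _ _ (`|C| * enorm x `^ alpha)).
    by rewrite ler_wpM2r ?powR_ge0// ler_norm.
  by rewrite ler_wpM2l// ge0_ler_powR ?nnegrE ?(ltW alpha0) ?(ltW r0)// enorm_ge0.
have := ler_normD (p x - p 0) (p 0); rewrite subrK; lra.
Qed.

Lemma sphere_has_sup (r : R) : 0 <= r -> has_sup (p @` sphere r) /\ has_inf (p @` sphere r).
Proof.
move=> r0; have [C HC] := ball_bounded (ltr_wpDl r0 ltr01).
have [y [yr _]] := sphere_move 0 r0.
have ne : (p @` sphere r) !=set0 by exists (p y), y.
split; split=> //; [exists C|exists (- C)] => _ [x xr <-].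
  by apply: le_trans (ler_norm _) (HC x _); rewrite xr lerDl.
by have := HC x; rewrite xr lerDl => /(_ ler01); rewrite ler_norml => /andP[].
Qed.

Lemma phi_max_ge x : p x <= phi_max p (enorm x).
Proof. by apply: ub_le_sup; [exact: (sphere_has_sup (enorm_ge0 x)).1.2|exists x]. Qed.

Lemma psi_min_le x : psi_min p (enorm x) <= p x.
Proof. by apply: ge_inf; [exact: (sphere_has_sup (enorm_ge0 x)).2.2|exists x]. Qed.

Lemma psi_le_phi (r : R) : 0 <= r -> psi_min p r <= phi_max p r.
Proof.
move=> r0; have [y [yr _]] := sphere_move 0 r0; rewrite -yr.
exact: le_trans (psi_min_le y) (phi_max_ge y).
Qed.

Lemma psi_min_ge0 (r : R) : (forall x, 0 <= p x) -> 0 <= r -> 0 <= psi_min p r.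
Proof.
move=> p0 r0; apply: lb_le_inf; first exact: (sphere_has_sup r0).2.1.
by move=> _ [x _ <-].
Qed.

Let modulus (rho : R) : 0 < rho -> exists C : R, 0 < C /\ forall r s, 0 <= r -> r <= rho -> 0 <= s -> s <= rho ->
  `|phi_max p r - phi_max p s| <= C * `|r - s| `^ alpha /\
  `|psi_min p r - psi_min p s| <= C * `|r - s| `^ alpha.
Proof.
move=> rho0; have [C HC] := p_holder rho0.
exists (`|C| + 1); split; first by rewrite ltr_wpDl.
have key x s : enorm x <= rho -> 0 <= s -> s <= rho -> exists y : E, enorm y = s /\
    `|p x - p y| <= (`|C| + 1) * `|enorm x - s| `^ alpha.
  move=> xr s0 sr; have [y [ys xy]] := sphere_move x s0; exists y; split=> //.
  apply: le_trans (HC x y I I xr _) _; first by rewrite ys.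
  rewrite xy ler_wpM2r ?powR_ge0//; have := ler_norm C; lra.
have phi1 r s : 0 <= r -> r <= rho -> 0 <= s -> s <= rho ->
    phi_max p r <= phi_max p s + (`|C| + 1) * `|r - s| `^ alpha.
  move=> r0 rr s0 sr; apply: ge_sup; first exact: (sphere_has_sup r0).1.1.
  move=> _ [x xr <-]; have xr' : enorm x = r := xr.
  have [y [ys]] := key x s (le_trans (eq_ler xr') rr) s0 sr; rewrite xr' => h.
  have := phi_max_ge y; have := ler_norm (p x - p y); rewrite ys; lra.
have psi1 r s : 0 <= r -> r <= rho -> 0 <= s -> s <= rho ->
    psi_min p s <= psi_min p r + (`|C| + 1) * `|r - s| `^ alpha.
  move=> r0 rr s0 sr; rewrite -lerBlDr; apply: lb_le_inf; first exact: (sphere_has_sup r0).2.1.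
  move=> _ [x xr <-]; have xr' : enorm x = r := xr.
  have [y [ys]] := key x s (le_trans (eq_ler xr') rr) s0 sr; rewrite xr' => h.
  have := psi_min_le y; have := ler_norm (p y - p x); rewrite distrC ys; lra.
move=> r s r0 rr s0 sr.
have h1 := phi1 r s r0 rr s0 sr; have h2 := phi1 s r s0 sr r0 rr.
have h3 := psi1 r s r0 rr s0 sr; have h4 := psi1 s r s0 sr r0 rr.
rewrite (distrC s r) in h2 h4.
by split; rewrite ler_norml; apply/andP; split; lra.
Qed.

Let continuous_of_modulus (g : R -> R) : (forall rho : R, 0 < rho -> exists C : R, 0 < C /\
    forall r s, 0 <= r -> r <= rho -> 0 <= s -> s <= rho -> `|g r - g s| <= C * `|r - s| `^ alpha) ->
  continuous (fun t : R => g `|t|).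
Proof.
move=> H t; apply/cvgrPdist_le => e e0.
have rho0 : 0 < `|t| + 1 by rewrite ltr_wpDl.
have [C [C0 HC]] := H _ rho0.
pose d := Num.min 1 ((e / C) `^ alpha^-1).
have d0 : 0 < d by rewrite lt_min ltr01 powR_gt0// divr_gt0.
exists d => //= s; rewrite /ball_/= => ts.
have [ts1 ts2] : `|t - s| < 1 /\ `|t - s| < (e / C) `^ alpha^-1 by move: ts; rewrite lt_min => /andP.
have hh := ler_dist_dist t s.
have sr : `|s| <= `|t| + 1.
  have := ler_normD (s - t) t; rewrite subrK (distrC s t); lra.
apply: le_trans (HC `|t| `|s| (normr_ge0 _) _ (normr_ge0 _) sr) _; first by lra.
rewrite mulrC -ler_pdivlMr//.
have ec : 0 <= e / C by rewrite divr_ge0// ltW.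
apply: (@le_trans _ _ (((e / C) `^ alpha^-1) `^ alpha)).
  rewrite ge0_ler_powR ?nnegrE ?(ltW alpha0) ?powR_ge0//.
  exact: le_trans hh (ltW ts2).
by rewrite -powRrM mulVf ?gt_eqF// powRr1.
Qed.

Lemma continuous_phi_max : continuous (fun t : R => phi_max p `|t|).
Proof.
apply: continuous_of_modulus => rho rho0; have [C [C0 HC]] := modulus rho0.
by exists C; split=> // r s r0 rr s0 sr; exact: (HC r s r0 rr s0 sr).1.
Qed.

Lemma continuous_psi_min : continuous (fun t : R => psi_min p `|t|).
Proof.
apply: continuous_of_modulus => rho rho0; have [C [C0 HC]] := modulus rho0.
by exists C; split=> // r s r0 rr s0 sr; exact: (HC r s r0 rr s0 sr).2.
Qed.

End SphereExtrema.

(** * Improper integrals *)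

Section ImproperIntegral.
Context {R : realType}.
Implicit Types (f g F dF : R -> R) (t : R).
Local Notation mu := (@lebesgue_measure R).

Lemma continuous_even_ray F dF : F x @[x --> 0^'+] --> F 0 ->
  (forall r : R, 0 < r -> is_derive r 1 F (dF r)) -> continuous (fun t : R => F `|t|).
Proof.
move=> F0 dFr t; have [->|t0] := eqVneq t 0.
  apply/cvgrPdist_le => e e0; have /cvgrPdist_le/(_ _ e0)[d /= d0 hd] := F0.
  exists d => //= s; rewrite /ball_/= sub0r normrN => sd; rewrite normr0.
  have [->|s0] := eqVneq s 0; first by rewrite normr0 subrr normr0 ltW.
  by apply: hd; rewrite ?normr_gt0//= sub0r normrN normr_id.
apply: (cvg_comp (fun t : R => `|t|) F); first exact: cvg_norm cvg_id.
have cF : {for `|t|, continuous F}.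
  apply/differentiable_continuous/derivable1_diffP.
  by apply: (@ex_derive _ _ _ _ _ _ _ (dFr `|t| _)); rewrite normr_gt0.
exact: cF.
Qed.

Lemma continuous_even_prim f : continuous f -> continuous (fun t => prim f `|t|).
Proof.
move=> fc; apply: (continuous_even_ray (dF := f)); first exact: prim_right0.
by move=> r r0; exact: prim_derive.
Qed.

Lemma measurable_continuous (A : set R) f : continuous f -> measurable_fun A (EFin \o f).
Proof.
move=> fc; apply/measurable_EFinP; apply: (@measurable_funS _ _ _ _ setT) => //.
exact: continuous_measurable_fun.
Qed.

Lemma ray_integral_ge f (a b : R) : continuous f -> (forall s : R, a <= s -> 0 <= f s) ->
  (\int[mu]_(x in `[a, b]) (f x)%:E <= \int[mu]_(x in `[a, +oo[) (f x)%:E)%E.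
Proof.
move=> fc f0; apply: ge0_subset_integral => //.
- exact: measurable_continuous.
- by move=> x /=; rewrite in_itv/= andbT lee_fin; exact: f0.
- by move=> x /=; rewrite !in_itv/= => /andP[-> _].
Qed.

Lemma prim_bounded f : continuous f -> (forall s : R, 0 <= s -> 0 <= f s) ->
  (\int[mu]_(x in `[0%R, +oo[) (f x)%:E < +oo)%E ->
  exists M : R, forall t, prim f t <= M.
Proof.
move=> fc f0 fin; exists (fine (\int[mu]_(x in `[0%R, +oo[) (f x)%:E)%E) => t.
rewrite /prim /Rintegral; apply: fine_le; last exact: ray_integral_ge.
- exact: integrable_fin_num (prim_integrable t fc).
- rewrite ge0_fin_numE//; apply: integral_ge0 => x /=.
  by rewrite in_itv/= andbT lee_fin; exact: f0.
Qed.

(** The integral over [[a, b]] is [F b - F a]. If [F] is bounded it converges by monotonicity, and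
    the improper integral is then its finite limit minus [F a]. *)
Lemma ray_integral_infinite F dF (a : R) : continuous dF -> (forall s, a <= s -> 0 <= dF s) ->
  (forall t, a <= t -> is_derive t 1 F (dF t)) ->
  ((\int[mu]_(x in `[a, +oo[) (dF x)%:E = +oo)%E <->
   (forall M : R, exists t, a <= t /\ M < F t)).
Proof.
move=> fc f0 dFr.
have cF t : a <= t -> {for t, continuous F}.
  move=> at_; apply/differentiable_continuous/derivable1_diffP.
  exact: @ex_derive _ _ _ _ _ _ _ (dFr t at_).
have FTC b : a < b -> (\int[mu]_(x in `[a, b]) (dF x)%:E = (F b)%:E - (F a)%:E)%E.
  move=> ab; apply: continuous_FTC2 => //.
  - exact: continuous_within_any.
  - split.
    + move=> x; rewrite in_itv/= => /andP[ax _].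
      exact: @ex_derive _ _ _ _ _ _ _ (dFr x (ltW ax)).
    + by apply: cvg_at_right_filter; exact: cF.
    + by apply: cvg_at_left_filter; apply: cF; exact: ltW.
  - move=> x; rewrite in_itv/= => /andP[ax _]; rewrite derive1E.
    exact: @derive_val _ _ _ _ _ _ _ (dFr x (ltW ax)).
have mono s t : a <= s -> s <= t -> F s <= F t.
  move=> as_; rewrite le_eqVlt => /predU1P[->//|st].
  have [||c] := @MVT R F dF s t st.
  - move=> x; rewrite in_itv/= => /andP[sx _]; apply: dFr; lra.
  - apply/(continuous_within_itvP _ st); split.
    + move=> x; rewrite in_itv/= => /andP[sx _]; apply: cF; lra.
    + by apply: cvg_at_right_filter; exact: cF.
    + by apply: cvg_at_left_filter; apply: cF; lra.
  rewrite in_itv/= => /andP[sc _] h; rewrite -subr_ge0 h mulr_ge0 ?f0 ?subr_ge0 ?(ltW st)//; lra.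
split=> [infty M|H].
  apply: contrapT => nM.
  have bM t : a <= t -> F t <= M.
    by move=> at_; rewrite leNgt; apply/negP => Mt; apply: nM; exists t.
  pose S := [set F t | t in [set t | a <= t]].
  have Sne : S !=set0 by exists (F a), a => //=.
  have Sub : has_ubound S by exists M => _ [t at_ <-]; exact: bM.
  have cl : F x @[x --> +oo] --> sup S.
    apply/cvgrPdist_le => e e0.
    have [_ [t0 at0 <-] ht0] := sup_adherent e0 (conj Sne Sub).
    exists t0; split; first exact: num_real.
    move=> t tt0; have at_ : a <= t by apply: le_trans at0 (ltW tt0).
    have : F t <= sup S by apply: ub_le_sup => //; exists t.
    have := mono t0 t at0 (ltW tt0) => h1 h2.
    rewrite ger0_norm; lra.
  have := @ge0_continuous_FTC2y R dF F a (sup S) f0 _ cl.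
  rewrite infty => h.
  have : (+oo = (sup S)%:E - (F a)%:E :> \bar R)%E.
    apply: h.
    - exact: continuous_within_any.
    - by move=> x ax; exact: @ex_derive _ _ _ _ _ _ _ (dFr x (ltW ax)).
    - by apply: cvg_at_right_filter; exact: cF.
    - move=> x; rewrite in_itv/= andbT => ax; rewrite derive1E.
      exact: @derive_val _ _ _ _ _ _ _ (dFr x (ltW ax)).
  by [].
apply/eqyP => M M0.
have [t [at_ Mt]] := H (M + F a).
have ta : a < t.
  rewrite lt_neqAle at_ andbT; apply/eqP => ta; move: Mt; rewrite -ta; lra.
apply: le_trans (ray_integral_ge t fc f0); rewrite FTC// -EFinB lee_fin; lra.
Qed.

End ImproperIntegral.

(** * Comparison at a minimum point *)

Section Minimum.
Context {R : realType}.

Lemma second_derivative_test (g g1 : R -> R) (d : R) : (forall s : R, is_derive s 1 g (g1 s)) ->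
  is_derive (0 : R) 1 g1 d -> (forall s : R, g 0 <= g s) -> g1 0 = 0 /\ 0 <= d.
Proof.
move=> dg dg1 gmin.
have g10 : g1 0 = 0.
  have [||||_ h] := @derive1_at_min R g (-1) 1 0.
  - by lra.
  - by move=> t _; exact: @ex_derive _ _ _ _ _ _ _ (dg t).
  - by rewrite in_itv/=; apply/andP; split; lra.
  - by move=> t _; exact: gmin.
  by have [_ h'] := dg 0; rewrite -h' h.
split=> //; rewrite leNgt; apply/negP => d0.
have [dd dE] := dg1; have e0 : 0 < - d / 2 by lra.
have : (fun t : R => t^-1 *: (g1 (t *: 1 + 0) - g1 0)) @ 0^' --> d by rewrite -dE.
move=> /cvgrPdist_lt/(_ _ e0)[r /= r0 hr].
have rp : 0 < r / 2 by lra.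
have [|c cr] := @MVT R g g1 0 (r / 2) rp (fun x _ => dg x).
  apply: continuous_within_any => x; apply/differentiable_continuous/derivable1_diffP.
  exact: @ex_derive _ _ _ _ _ _ _ (dg x).
move: cr; rewrite in_itv/= => /andP[c0 cr] gE.
have := gmin (r / 2); rewrite -subr_ge0 gE subr0 leNgt => /negP; apply.
rewrite pmulr_llt0//.
have := hr c; rewrite /ball_/= sub0r normrN gtr0_norm// => /(_ _ (lt0r_neq0 c0)).
have cr' : c < r by lra.
move=> /(_ cr'); rewrite [c *: 1]mulr1 addr0 g10 subr0 => h.
have : c^-1 * g1 c < 0 by move: h; rewrite ltr_norml => /andP[h1 h2]; rewrite -[c^-1 * _]/(c^-1 *: g1 c); lra.
by rewrite pmulr_rlt0// invr_gt0.
Qed.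

(** The difference [v - c * expR g] has a minimum at 0. The first-order condition gives the
    equality; the second-order one holds with [g2 + g1 0 ^+ 2], and the square has the favourable
    sign. *)
Lemma touching_exponential (c : R) (v v1 g g1 : R -> R) (v2 g2 : R) : 0 < c ->
  (forall s : R, is_derive s 1 v (v1 s)) -> is_derive (0 : R) 1 v1 v2 ->
  (forall s : R, is_derive s 1 g (g1 s)) -> is_derive (0 : R) 1 g1 g2 ->
  (forall s : R, c * expR (g s) <= v s) -> c * expR (g 0) = v 0 ->
  v1 0 = c * expR (g 0) * g1 0 /\ c * expR (g 0) * g2 <= v2.
Proof.
move=> c0 dv dv1 dg dg1 above at0.
have dX (s : R) : is_derive s 1 (fun s => expR (g s)) (expR (g s) * g1 s).
  exact: (@is_derive1_comp R expR g s _ _ (is_derive_expR _) (dg s)).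
have dz (s : R) : is_derive s 1 (fun s => v s - c * expR (g s)) (v1 s - c * (expR (g s) * g1 s)).
  have d1 := is_deriveB (dv s) (is_deriveM (is_derive_cst (c : R) s 1) (dX s)).
  apply: (is_derive_eq d1).
  transitivity (v1 s - (c * (expR (g s) * g1 s) + expR (g s) * 0)) => //.
  by rewrite mulr0 addr0.
have dz1 : is_derive (0 : R) 1 (fun s => v1 s - c * (expR (g s) * g1 s))
    (v2 - c * (expR (g 0) * g2 + g1 0 * (expR (g 0) * g1 0))).
  have d1 := is_deriveB dv1 (is_deriveM (is_derive_cst (c : R) (0 : R) 1) (is_deriveM (dX 0) dg1)).
  apply: (is_derive_eq d1).
  transitivity (v2 - (c * (expR (g 0) * g2 + g1 0 * (expR (g 0) * g1 0)) +
       (expR (g 0) * g1 0) * 0)) => //.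
  by rewrite mulr0 addr0.
have [s|h1 h2] := second_derivative_test dz dz1.
  by rewrite at0 subrr subr_ge0.
split; first by lra.
have : 0 <= c * (g1 0 * (expR (g 0) * g1 0)).
  by rewrite pmulr_rge0// mulrCA mulr_ge0 ?expR_ge0// -expr2 sqr_ge0.
move: h2; rewrite mulrDr; lra.
Qed.

Lemma coercive_minimum (N : nat) (z : 'rV[R]_N -> R) : continuous z ->
  (exists R0 : R, forall x, R0 < enorm x -> z 0 < z x) -> exists x0, forall x, z x0 <= z x.
Proof.
move=> zc [R0 hR].
have b0 : inbox `|R0| (0 : 'rV[R]_N) by move=> i; rewrite mxE normr0.
have [|x0 x0B hx] := @EVT_min_rV R N z [set x | inbox `|R0| x] _ (@compact_inbox R N `|R0|) (continuous_subspaceT zc).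
  by exists 0.
exists x0 => x; have [xR|xR] := leP (enorm x) `|R0|.
  by apply: hx; rewrite inE; exact: inbox_enorm.
apply: (@le_trans _ _ (z 0)); first by apply: hx; rewrite inE.
apply: ltW; apply: hR; exact: le_lt_trans (ler_norm _) xR.
Qed.

End Minimum.

Section Comparison.
Context {R : realType} {N : nat}.
Hypothesis N0 : (0 < N)%N.
Local Notation E := 'rV[R]_N.

Lemma continuous_pot_enorm (q : R -> R) : continuous q -> continuous (fun x : E => pot N q (enorm x)).
Proof.
move=> qc; rewrite (_ : (fun x : E => _) = (fun x : E => pot N q `|enorm x|)).
  exact: (continuous_radial (continuous_even_ray (pot_right0 N0 qc) (fun r r0 => is_derive_pot N0 qc r0))).
by apply/funext => x; rewrite (ger0_norm (enorm_ge0 x)).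
Qed.

(* Otherwise [(1 + u) / exp (pot q)] tends to infinity and the equation is violated at its minimum. *)
Lemma bounded_supersolution_barrier (p u : E -> R) (f q : R -> R) (B : R) :
  continuous q -> (forall s : R, 0 <= s -> 0 <= q s) -> (forall t, pot N q t <= B) ->
  (forall x, p x * f (u x) < (1 + u x) * q (enorm x)) ->
  ~ pos_entire_large_solution p f u.
Proof.
move=> qc q0 GB pq [[uc [u1 [u1c [u2 u2c]]]] [ueq [u0 ularge]]].
pose G (x : E) := pot N q (enorm x).
have G0 (x : E) : 0 <= G x by exact: pot_ge0.
have Gc : continuous G by exact: continuous_pot_enorm.
pose z (x : E) := (1 + u x) * expR (- G x).
have zc : continuous z.
  apply: continuous_rV_M; first by apply: continuous_rV_D => //; exact: continuous_rV_cst.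
  move=> x; apply: (cvg_comp G (fun s : R => expR (- s)) (Gc x)).
  have : continuous (fun s : R => expR (- s)).
    by move=> s; apply: (cvg_comp (fun s : R => - s) expR); [exact: cvgN cvg_id|exact: continuous_expR].
  exact.
have [x0 hmin] : exists x0, forall x, z x0 <= z x.
  apply: coercive_minimum => //.
  have [R0 hR] := ularge (z 0 * expR B); exists R0 => x /hR h.
  rewrite -[ltRHS]/((1 + u x) * expR (- G x)) expRN ltr_pdivlMr ?expR_gt0//.
  apply: (@le_lt_trans _ _ (z 0 * expR B)); last by lra.
  rewrite ler_pM2l ?ler_expR ?GB// mulr_gt0 ?expR_gt0//; have := u0 0; lra.
pose c := z x0.
have c0 : 0 < c by rewrite mulr_gt0 ?expR_gt0//; have := u0 x0; lra.
have above x : c * expR (G x) <= 1 + u x by rewrite -ler_pdivlMr ?expR_gt0// -expRN; exact: hmin.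
have at0 : c * expR (G x0) = 1 + u x0 by rewrite /c /z expRN divfK// gt_eqF// expR_gt0.
have test i : partial i u x0 = c * expR (G x0) * radial_d1 q i x0 /\
    c * expR (G x0) * radial_d2 q i x0 <= partial i (partial i u) x0.
  pose l (s : R) : E := x0 + s *: ebasis i.
  have l0 : l 0 = x0 by rewrite /l scale0r addr0.
  have dG (s : R) : is_derive s 1 (fun s => G (l s)) (radial_d1 q i (l s)).
    by apply: is_derive_line; exact: is_derive_radial.
  have du (s : R) : is_derive s 1 (fun s => 1 + u (l s)) (partial i u (l s)).
    have du : is_derive s 1 (fun s => u (l s)) (partial i u (l s)).
      by apply: is_derive_line; exact: DeriveDef (u1 i _) erefl.
    by apply: (is_derive_eq (is_deriveD (is_derive_cst (1 : R) s 1) du)); exact: add0r.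
  have dpu : is_derive (0 : R) 1 (fun s => partial i u (l s)) (partial i (partial i u) x0).
    by apply: is_derive_line; rewrite -/(l 0) l0; exact: DeriveDef (u2 i i _) erefl.
  have dD : is_derive (0 : R) 1 (fun s => radial_d1 q i (l s)) (radial_d2 q i x0).
    by apply: is_derive_line; rewrite -/(l 0) l0; exact: is_derive_radial2.
  have := touching_exponential c0 du dpu dG dD.
  rewrite !l0; apply => //; move=> s; exact: above.
have ex0 := expR_gt0 (G x0).
have : p x0 * f (u x0) < p x0 * f (u x0); last by rewrite ltxx.
(* At the minimum the gradient of [u] is [c * expR (G x0)] times that of [G], and its Laplacian is
   at least the same multiple. The operator is positively homogeneous of degree one, so its value on
   [u] is at least [(1 + u x0) * q (enorm x0)]. *)
apply: (lt_le_trans (pq x0)); rewrite -ueq -at0.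
have s0 : 0 <= slope N q (enorm x0) by apply: slope_ge0 => //; exact: enorm_ge0.
have -> : q (enorm x0) = \sum_i radial_d2 q i x0 + l2norm (fun i => radial_d1 q i x0).
  by rewrite radial_laplacian// radial_gradient//; ring.
rewrite mulrDr; apply: lerD.
  by rewrite mulr_sumr; apply: ler_sum => i _; have [_] := test i.
apply: eq_ler.
transitivity (l2norm (fun i => partial i u x0)) => //.
rewrite -[in LHS](ger0_norm (ltW (mulr_gt0 c0 ex0))) -l2normZ.
by apply: eq_l2norm => i; have [-> _] := test i.
Qed.

End Comparison.

(** * The radial equation *)

Section RadialSolution.
Context {R : realType} {N : nat}.
Hypothesis N0 : (0 < N)%N.
Variables (Lam : R) (phi f : R -> R).
Hypotheses (Lam0 : 0 <= Lam) (phi_cont : continuous phi) (phi0 : forall s, 0 <= phi s)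
  (f_mono : forall s t : R, 0 <= s -> s <= t -> f s <= f t)
  (f_ge0 : forall s : R, 0 <= s -> 0 <= f s)
  (f_cont : forall a e : R, 0 <= a -> 0 < e -> exists d : R, 0 < d /\
    forall b, 0 <= b -> `|b - a| < d -> `|f b - f a| < e)
  (f_le : forall s : R, 1 <= s -> f s <= Lam * s).

Lemma continuous_nonlinearity (v : R -> R) : continuous v -> (forall t, 0 <= v t) ->
  continuous (fun t => f (v t)).
Proof.
move=> vc v0 t; apply/cvgrPdist_lt => e e0.
have [d [d0 hd]] := f_cont (v0 t) e0.
have /cvgrPdist_lt/(_ _ d0) := vc t; apply: filterS => s st.
by rewrite distrC; apply: hd => //; rewrite distrC.
Qed.

Let V (t : R) : R := expR (Lam * pot N phi t).

Let T (v : R -> R) (t : R) : R := 1 + pot N (fun s => phi s * f (v s)) `|t|.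

(** Bounding increments, and not only values, by those of [V] is a condition stable under suprema,
    and it makes the supremum continuous. *)
Let controlled (v : R -> R) := [/\ v 0 = 1, forall t, v t = v `|t| &
  forall s r : R, 0 <= s -> s <= r -> 0 <= v r - v s <= V r - V s].

Let V_deriv (t : R) : 0 < t -> is_derive t 1 V (V t * (Lam * (t * slope N phi t))).
Proof.
move=> t0; have dp := is_derive_pot N0 phi_cont t0.
have dl : is_derive t 1 (fun t => Lam * pot N phi t) (Lam * (t * slope N phi t)).
  apply: (is_derive_eq (is_deriveM (is_derive_cst (Lam : R) t 1) dp)).
  transitivity (Lam * (t * slope N phi t) + pot N phi t * 0) => //.
  by rewrite mulr0 addr0.
exact: (@is_derive1_comp R expR (fun t => Lam * pot N phi t) t _ _ (is_derive_expR _) dl).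
Qed.

Let V_right0 : V x @[x --> 0^'+] --> V 0.
Proof.
apply: (cvg_comp (fun t : R => Lam * pot N phi t) expR); last exact: continuous_expR.
by apply: cvgM; [exact: cvg_cst|exact: pot_right0].
Qed.

Let V0 : V 0 = 1. Proof. by rewrite /V pot0 mulr0 expR0. Qed.

Let V_mono s r : 0 <= s -> s <= r -> V s <= V r.
Proof. by move=> s0 sr; rewrite ler_expR ler_wpM2l// pot_mono. Qed.

Let controlled_bounds v : controlled v -> forall t, 1 <= v t /\ v t <= V `|t|.
Proof.
move=> [v0 ve vi] t; have := vi 0 `|t| (lexx 0) (normr_ge0 t); rewrite v0 V0 -ve => /andP[h1 h2].
by split; lra.
Qed.

Let controlled_continuous v : controlled v -> continuous v.
Proof.
move=> [v0 ve vi] t; apply/cvgrPdist_lt => e e0.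
have Vc : continuous (fun t : R => V `|t|) := continuous_even_ray V_right0 V_deriv.
have /cvgrPdist_lt/(_ _ e0) := Vc t; apply: filterS => s; apply: le_lt_trans.
rewrite (ve t) (ve s); have [st|ts] := leP `|s| `|t|.
  have /andP[h1 h2] := vi _ _ (normr_ge0 s) st.
  by rewrite ger0_norm//; apply: le_trans h2 _; exact: ler_norm.
have /andP[h1 h2] := vi _ _ (normr_ge0 t) (ltW ts).
by rewrite distrC ger0_norm// distrC; apply: le_trans h2 _; exact: ler_norm.
Qed.

Let source_cont v : controlled v -> continuous (fun s => phi s * f (v s)).
Proof.
move=> vK s; apply: cvgM; first exact: phi_cont.
apply: continuous_nonlinearity; first exact: controlled_continuous.
move=> t; have [h _] := controlled_bounds vK t; lra.
Qed.

Let source_ge0 v : controlled v -> forall s, 0 <= phi s * f (v s).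
Proof.
by move=> vK s; rewrite mulr_ge0// f_ge0//; have [h _] := controlled_bounds vK s; lra.
Qed.

Let increments (a b c d : R) : b <= a -> c - b <= d - a -> 0 <= 1 + a - (1 + b) <= d - c.
Proof. by move=> ba cd; apply/andP; split; lra. Qed.

Let sub_sup (a b c d : R) : a - b <= d -> b <= c -> a <= d + c.
Proof. by move=> ab bc; lra. Qed.

Let T_controlled v : controlled v -> controlled (T v).
Proof.
move=> vK; split; first by rewrite /T normr0 pot0 addr0.
  by move=> t; rewrite /T normr_id.
move=> s r s0 sr; have r0 : 0 <= r := le_trans s0 sr.
rewrite /T (ger0_norm s0) (ger0_norm r0).
have sc := source_cont vK; have sg := source_ge0 vK.
have h1 : pot N (fun s => phi s * f (v s)) s <= pot N (fun s => phi s * f (v s)) r by apply: pot_mono.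
have h2 : V s - pot N (fun s => phi s * f (v s)) s <= V r - pot N (fun s => phi s * f (v s)) r.
  apply: (@ray_nondecreasing R (fun t => V t - pot N (fun s => phi s * f (v s)) t)
    (fun t => V t * (Lam * (t * slope N phi t)) - t * slope N (fun s => phi s * f (v s)) t) s r s0 sr).
  - by apply: cvgB; [exact: V_right0|exact: pot_right0].
  - move=> t t0; exact: is_deriveB (V_deriv t0) (is_derive_pot N0 sc t0).
  - move=> t t0; rewrite subr_ge0.
    (* The factor [V t] is frozen inside the potential: for [x <= t], [f (v x) <= Lam * v x <= Lam *
       V x <= Lam * V t], so the integrands can be compared pointwise. *)
    have -> : V t * (Lam * (t * slope N phi t)) = t * slope N (fun s => Lam * V t * phi s) t.
      by rewrite slopeZ//; ring.
    rewrite ler_wpM2l ?(ltW t0)// slope_le ?(ltW t0)//.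
      by move=> x; apply: cvgM; [exact: cvg_cst|exact: phi_cont].
    move=> x x0 xt; rewrite mulrC ler_wpM2r//.
    have [v1 vV] := controlled_bounds vK x.
    apply: le_trans (f_le v1) _; apply: ler_wpM2l Lam0 _ _ _.
    by apply: le_trans vV _; rewrite (ger0_norm x0); exact: V_mono.
exact: increments h1 h2.
Qed.

Let T_mono v w : controlled v -> controlled w -> (forall t, v t <= w t) -> forall t, T v t <= T w t.
Proof.
move=> vK wK vw t; rewrite /T lerD2l; apply: pot_le => //; try exact: source_cont.
move=> s s0; rewrite ler_wpM2l// f_mono//; have [h _] := controlled_bounds vK s; lra.
Qed.

(* As in Tarski's theorem, the fixed point is the pointwise supremum of the controlled
   functions lying below their image under [T]. *)
Lemma radial_solution : exists v : R -> R, [/\ continuous v, forall t, 1 <= v t,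
  forall t, 0 <= t -> v t = 1 + pot N (fun s => phi s * f (v s)) t &
  forall t, 0 <= t -> v t <= expR (Lam * pot N phi t)].
Proof.
pose S (v : R -> R) := controlled v /\ forall t, v t <= T v t.
have S1 : S (fun=> 1).
  have K1 : controlled (fun=> 1).
    split=> // s r s0 sr; rewrite subrr lexx/= subr_ge0; exact: V_mono.
  split=> // t; rewrite /T lerDl pot_ge0// => s s0; exact: source_ge0 K1 s.
pose vals t : set R := [set y | exists v, S v /\ y = v t].
have vals_ub t : has_ubound (vals t).
  by exists (V `|t|) => _ [v [[vK _] ->]]; have [] := controlled_bounds vK t.
have vals_ne t : vals t !=set0 by exists 1, (fun=> 1).
pose v t := sup (vals t).
have Sv w t : S w -> w t <= v t by move=> wS; apply: ub_le_sup => //; exists w.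
have v_le t y : (forall w, S w -> w t <= y) -> v t <= y.
  by move=> h; apply: ge_sup => // _ [w [wS ->]]; exact: h.
have vK : controlled v.
  split.
  - apply/eqP; rewrite eq_le (Sv _ _ S1) andbT; apply: v_le => w [[w0 _ _] _]; by rewrite w0.
  - move=> t; congr sup; apply/seteqP; split=> _ [w [wS ->]]; exists w; split=> //.
      by case: wS => -[_ we _] _; exact: we.
    by case: wS => -[_ we _] _; rewrite -we.
  - move=> s r s0 sr; apply/andP; split.
      rewrite subr_ge0; apply: v_le => w wS; apply: le_trans (Sv w r wS).
      by case: wS => -[_ _ wi] _; have /andP[+ _] := wi s r s0 sr; rewrite subr_ge0.
    rewrite lerBlDr; apply: v_le => w wS; have := Sv w s wS.
    by case: wS => -[_ _ wi] _; have /andP[_ +] := wi s r s0 sr; exact: sub_sup.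
have vT t : v t <= T v t.
  apply: v_le => w wS; have [wK wT] := wS.
  by apply: le_trans (wT t) _; apply: T_mono => // x; exact: Sv.
have TvS : S (T v) by split; [exact: T_controlled|apply: T_mono => //; exact: T_controlled].
have vE t : v t = T v t by apply/eqP; rewrite eq_le vT Sv.
exists v; split.
- exact: controlled_continuous.
- by move=> t; have [] := controlled_bounds vK t.
- by move=> t t0; rewrite vE /T (ger0_norm t0).
- by move=> t t0; have [_] := controlled_bounds vK t; rewrite (ger0_norm t0).
Qed.

End RadialSolution.

(** * Existence between barriers *)

Section DiscreteApproximation.
Context {R : realType} {N : nat}.
Local Notation E := 'rV[R]_N.
Local Notation lat := 'rV[int]_N.

Lemma uniform_consistency (P : E -> R) (D1 D2 : 'I_N -> E -> R) (rho m : R) :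
  (forall i y, is_derive y (ebasis i) P (D1 i y)) ->
  (forall i y, is_derive y (ebasis i) (D1 i) (D2 i y)) ->
  (forall i, continuous (D1 i)) -> (forall i, continuous (D2 i)) -> 0 < m ->
  exists h0 : R, 0 < h0 /\ forall (h : R) (k : lat), 0 < h -> h <= h0 -> box rho h k ->
    `|dop (h / 2) (fun l => P (at_mesh h l)) k -
      h ^+ 2 * (\sum_i D2 i (at_mesh h k) + l2norm (fun i => D1 i (at_mesh h k)))| <= h ^+ 2 * m.
Proof.
move=> dP dD c1 c2 m0.
have N1 : 0 < 2 * N%:R + 1 :> R by rewrite ltr_wpDl// mulr_ge0.
pose e := m / (2 * N%:R + 1); have e0 : 0 < e by rewrite divr_gt0.
have near i : \forall d \near (0 : R)^'+, forall x y, inbox rho x -> inball x d y ->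
    `|D1 i y - D1 i x| <= e /\ `|D2 i y - D2 i x| <= e.
  have [d1 [d10 h1]] := box_uniform_continuous rho (c1 i) e0.
  have [d2 [d20 h2]] := box_uniform_continuous rho (c2 i) e0.
  near=> d => x y xr xy; split; apply: ltW.
    by apply: h1 => //; apply: inball_le xy; near: d; exact: nbhs_right_le.
  by apply: h2 => //; apply: inball_le xy; near: d; exact: nbhs_right_le.
have : \forall d \near (0 : R)^'+, 0 < d /\ forall i x y, inbox rho x -> inball x d y ->
    `|D1 i y - D1 i x| <= e /\ `|D2 i y - D2 i x| <= e.
  near=> d; split; first by near: d; exact: nbhs_right_gt.
  by near: d; apply: filter_forall.
move=> /filter_ex[d [d0 hd]]; exists (d / 2); split; first by rewrite divr_gt0.
move=> h k h0 hd2 bk.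
apply: le_trans (@consistency R N P D1 D2 _ _ h e k h0 dP dD _) _.
  move=> i t th; apply: hd.
    by move=> j; rewrite mxE; exact: bk.
  move=> j; have -> : (at_mesh h k + t *: ebasis i) 0 j = at_mesh h k 0 j + t * (j == i)%:R.
    by rewrite mxE [X in _ + X]mxE ebasisE.
  rewrite addrAC subrr add0r normrM.
  apply: (@le_lt_trans _ _ h); last by lra.
  by case: (j == i); rewrite /= ?normr1 ?normr0 ?mulr1 ?mulr0 ?(ltW h0).
rewrite ler_wpM2l ?sqr_ge0// /e mulrA ler_pdivrMr// mulrC ler_pM2l//; lra.
Unshelve. all: by end_near.
Qed.

Variable i0 : 'I_N.

Definition bump (x : E) : R := expR (2 * x 0 i0).
Definition bump_d1 (i : 'I_N) (x : E) : R := if i == i0 then 2 * bump x else 0.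
Definition bump_d2 (i : 'I_N) (x : E) : R := if i == i0 then 4 * bump x else 0.

Lemma bump_gt0 x : 0 < bump x. Proof. exact: expR_gt0. Qed.

Lemma continuous_bump : continuous bump.
Proof.
move=> x; apply: (cvg_comp (fun x : E => 2 * x 0 i0) expR); last exact: continuous_expR.
have cc : continuous (fun x : E => x 0 i0) by move=> y; apply/rV_cvgP => e e0; exists e; split=> // z; exact.
exact: (continuous_rV_M (@continuous_rV_cst R N 2) cc).
Qed.

Lemma continuous_bump_d1 i : continuous (bump_d1 i).
Proof.
rewrite /bump_d1; case: (i == i0); last exact: continuous_rV_cst.
exact: (continuous_rV_M (@continuous_rV_cst R N 2) continuous_bump).
Qed.

Lemma continuous_bump_d2 i : continuous (bump_d2 i).
Proof.
rewrite /bump_d2; case: (i == i0); last exact: continuous_rV_cst.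
exact: (continuous_rV_M (@continuous_rV_cst R N 4) continuous_bump).
Qed.

Lemma is_derive_bump i x : is_derive x (ebasis i) bump (bump_d1 i x).
Proof.
have lineE (s : R) : (x + s *: ebasis i) 0 i0 = x 0 i0 + s * (i == i0)%:R.
  by rewrite mxE [X in _ + X]mxE ebasisE eq_sym.
apply: is_derive_of_line.
have -> : (fun s : R => bump (x + s *: ebasis i)) = expR \o (fun s : R => 2 * (x 0 i0 + s * (i == i0)%:R)).
  by apply/funext => s; rewrite /bump lineE.
have dl : is_derive (0 : R) 1 (fun s : R => 2 * (x 0 i0 + s * (i == i0)%:R)) (2 * (i == i0)%:R).
  have d1 := is_deriveM (is_derive_cst (2 : R) (0 : R) 1) (is_deriveD (is_derive_cst (x 0 i0 : R) (0 : R) 1)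
    (is_deriveM (is_derive_id (0 : R) 1) (is_derive_cst ((i == i0)%:R : R) (0 : R) 1))).
  apply: (is_derive_eq d1).
  transitivity (2 * (0 + (0 * 0 + (i == i0)%:R * 1)) + (x 0 i0 + 0 * (i == i0)%:R) * 0 : R) => //; ring.
apply: (is_derive_eq (@is_derive1_comp R expR _ 0 _ _ (is_derive_expR _) dl)).
rewrite mul0r addr0 /bump_d1 -/(bump x).
by case: (i == i0); rewrite ?mulr1 ?mulr0// mulrC.
Qed.

Lemma is_derive_bump_d1 i x : is_derive x (ebasis i) (bump_d1 i) (bump_d2 i x).
Proof.
rewrite /bump_d1 /bump_d2; case: (eqVneq i i0) => [->|_]; last exact: is_derive_cst.
have d1 := is_deriveZ (2 : R) (is_derive_bump i0 x).
apply: (is_derive_eq d1); rewrite /bump_d1 eqxx.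
transitivity (2 * (2 * bump x) : R) => //; ring.
Qed.

Lemma sum_bump_d2 x : \sum_i bump_d2 i x = 4 * bump x.
Proof. by rewrite /bump_d2 -big_mkcond big_pred1_eq. Qed.

Lemma l2norm_bump_d1 x : l2norm (fun i => bump_d1 i x) = 2 * bump x.
Proof.
rewrite /l2norm (bigD1 i0)//= big1 ?addr0 /bump_d1 ?eqxx.
  by rewrite sqrtr_sqr ger0_norm// mulr_ge0// ltW// bump_gt0.
by move=> i /negPf ->; rewrite expr0n.
Qed.

Lemma perturbed_operator (s : R) (V1 V2 : 'I_N -> E -> R) x :
  `|\sum_i (V2 i x + s * bump_d2 i x) + l2norm (fun i => V1 i x + s * bump_d1 i x) -
    (\sum_i V2 i x + l2norm (fun i => V1 i x) + s * (4 * bump x))| <= `|s| * (2 * bump x).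
Proof.
rewrite big_split/= -mulr_sumr sum_bump_d2.
rewrite (_ : _ - _ = l2norm (fun i => V1 i x + s * bump_d1 i x) - l2norm (fun i => V1 i x)); last by ring.
apply: le_trans (l2norm_lip _ _) _; apply: eq_ler.
rewrite -l2norm_bump_d1 -l2normZ; apply: eq_l2norm => i; ring.
Qed.

End DiscreteApproximation.

(** * Discrete solutions between perturbed barriers *)

Section Sandwich.
Context {R : realType} {N : nat}.
Hypothesis N0 : (0 < N)%N.
Local Notation E := 'rV[R]_N.
Local Notation lat := 'rV[int]_N.
Variables (p : E -> R) (f : R -> R) (V W : E -> R) (V1 V2 W1 W2 : 'I_N -> E -> R).
Hypotheses (p0 : forall x, 0 <= p x) (f_mono : forall s t : R, 0 <= s -> s <= t -> f s <= f t)
  (f_cont : forall a e : R, 0 <= a -> 0 < e -> exists d : R, 0 < d /\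
    forall b, 0 <= b -> `|b - a| < d -> `|f b - f a| < e)
  (dV : forall i y, is_derive y (ebasis i) V (V1 i y))
  (dV1 : forall i y, is_derive y (ebasis i) (V1 i) (V2 i y))
  (V1c : forall i, continuous (V1 i)) (V2c : forall i, continuous (V2 i))
  (dW : forall i y, is_derive y (ebasis i) W (W1 i y))
  (dW1 : forall i y, is_derive y (ebasis i) (W1 i) (W2 i y))
  (W1c : forall i, continuous (W1 i)) (W2c : forall i, continuous (W2 i))
  (Vge1 : forall x, 1 <= V x) (VW : forall x, V x <= W x)
  (subV : forall x, p x * f (V x) <= \sum_i V2 i x + l2norm (fun i => V1 i x))
  (superW : forall x, \sum_i W2 i x + l2norm (fun i => W1 i x) <= p x * f (W x)).

Let i0 : 'I_N := Ordinal N0.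
Local Notation Z := (@bump R N i0).

Let perturbed_consistency (P : E -> R) (D1 D2 : 'I_N -> E -> R) (s c rho m : R) :
  (forall i y, is_derive y (ebasis i) P (D1 i y)) ->
  (forall i y, is_derive y (ebasis i) (D1 i) (D2 i y)) ->
  (forall i, continuous (D1 i)) -> (forall i, continuous (D2 i)) -> 0 < m ->
  exists h0 : R, 0 < h0 /\ forall (h : R) (k : lat), 0 < h -> h <= h0 -> box rho h k ->
    `|dop (h / 2) (fun l => P (at_mesh h l) + s * Z (at_mesh h l) + c) k -
      h ^+ 2 * (\sum_i D2 i (at_mesh h k) + l2norm (fun i => D1 i (at_mesh h k)) + s * (4 * Z (at_mesh h k)))|
    <= h ^+ 2 * (m + `|s| * (2 * Z (at_mesh h k))).
Proof.
move=> dP dD c1 c2 m0.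
have dPs i y : is_derive y (ebasis i) (fun y => P y + s * Z y + c) (D1 i y + s * bump_d1 i0 i y).
  have d1 := is_deriveD (is_deriveD (dP i y) (is_deriveZ s (is_derive_bump i0 i y))) (is_derive_cst c y (ebasis i)).
  by apply: (is_derive_eq d1); rewrite addr0.
have dDs i y : is_derive y (ebasis i) (fun y => D1 i y + s * bump_d1 i0 i y) (D2 i y + s * bump_d2 i0 i y).
  exact: is_deriveD (dD i y) (is_deriveZ s (is_derive_bump_d1 i0 i y)).
have c1s i : continuous (fun y => D1 i y + s * bump_d1 i0 i y).
  apply: continuous_rV_D; first exact: c1.
  exact: (continuous_rV_M (@continuous_rV_cst R N s) (@continuous_bump_d1 R N i0 i)).
have c2s i : continuous (fun y => D2 i y + s * bump_d2 i0 i y).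
  apply: continuous_rV_D; first exact: c2.
  exact: (continuous_rV_M (@continuous_rV_cst R N s) (@continuous_bump_d2 R N i0 i)).
have [h0 [h00 H]] := uniform_consistency rho dPs dDs c1s c2s m0.
exists h0; split=> // h k hp hh0 bk; have {H} := H h k hp hh0 bk.
have := perturbed_operator i0 s D1 D2 (at_mesh h k).
have h2 : 0 <= h ^+ 2 by exact: sqr_ge0.
move=> /(ler_wpM2l h2); rewrite -{1}(ger0_norm h2) -normrM => e1 e2.
rewrite [leRHS]mulrDr; apply: le_trans (lerD e2 e1).
by apply: le_trans _ (ler_normD _ _); apply: eq_ler; congr (`|_|); ring.
Qed.

(* The Laplacian of [bump] is twice its gradient norm: adding small multiples of it makes the
   barriers strict, and the strictness absorbs the consistency error of the scheme. *)
Lemma discrete_sandwich (n : nat) : exists (h : R) (u : lat -> R),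
  [/\ 0 < h, h <= n.+1%:R^-1,
   forall k, box n%:R h k -> [/\ V (at_mesh h k) - n.+1%:R^-1 <= u k, u k <= W (at_mesh h k) + 1 & 0 <= u k] &
   forall k, box n%:R h k -> dop (h / 2) u k = h ^+ 2 * (p (at_mesh h k) * f (u k))].
Proof.
pose rho : R := n%:R + 1.
have n10 : 0 < n.+1%:R^-1 :> R by rewrite invr_gt0 ltr0n.
have n11 : n.+1%:R^-1 <= 1 :> R by rewrite invf_le1 ?ltr0n// ler1n.
have [M [M0 hM]] := continuous_bounded_box rho (@continuous_bump R N i0).
(* The perturbation of the barriers is at most [d * M = n.+1%:R^-1] on the box, so it disappears in
   the limit. *)
pose d := n.+1%:R^-1 / M; have d0 : 0 < d by rewrite divr_gt0.
have dM : d * M = n.+1%:R^-1 by rewrite divfK// gt_eqF.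
have dM1 : d * M <= 1 by rewrite dM.
pose zm : R := expR (2 * - rho); have zm0 : 0 < zm by exact: expR_gt0.
have Zlow (x : E) : inbox rho x -> zm <= Z x.
  by move=> bx; rewrite ler_expR ler_pM2l//; have := bx i0; rewrite ler_norml => /andP[].
have Zup (x : E) : inbox rho x -> Z x <= M by move=> bx; apply: le_trans (ler_norm _) (hM x bx).
(* The consistency error allowed is the least gain from [bump]: its Laplacian yields [4 * d] times
   [bump], the gradient norm may cost half of that, and [zm] is a lower bound for [bump] on the
   box. *)
pose m := 2 * d * zm; have m0 : 0 < m by exact: (mulr_gt0 (mulr_gt0 (ltr0Sn R 1) d0) zm0).
have [hv [hv0 Hv]] := perturbed_consistency d (- (d * M)) n%:R dV dV1 V1c V2c m0.
have [hw [hw0 Hw]] := perturbed_consistency (- d) (d * M) n%:R dW dW1 W1c W2c m0.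
pose h := Num.min n.+1%:R^-1 (Num.min hv hw).
have h0 : 0 < h by rewrite !lt_min n10 hv0.
have hn : h <= n.+1%:R^-1 by rewrite ge_min lexx.
have hhv : h <= hv by rewrite !ge_min lexx orbT.
have hhw : h <= hw by rewrite !ge_min lexx !orbT.
have h1 : h <= 1 by exact: le_trans hn n11.
have bmesh (r : R) k : box r h k -> inbox r (at_mesh h k) by move=> bk i; rewrite mxE; exact: bk.
(* The shift by [d * M] keeps [v] below [V] and [w] above [W], so that monotonicity of [f] preserves
   the inequalities; [v] stays nonnegative because [V >= 1] and [d * M <= 1]. *)
pose v (k : lat) := V (at_mesh h k) + d * Z (at_mesh h k) + - (d * M).
pose w (k : lat) := W (at_mesh h k) + - d * Z (at_mesh h k) + d * M.
have sub01 : n%:R <= rho by rewrite /rho lerDl.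
have bnds k : box rho h k -> [/\ 0 < d * Z (at_mesh h k), d * Z (at_mesh h k) <= d * M & m <= 2 * (d * Z (at_mesh h k))].
  move=> /bmesh bk; split; first by rewrite mulr_gt0// bump_gt0.
    by rewrite ler_pM2l// Zup.
  by rewrite /m -mulrA ler_pM2l// ler_pM2l// Zlow.
have h20 : 0 < h ^+ 2 by rewrite exprn_gt0.
have [||||||||||u [ub ueq]] := @perron R N (h / 2) (fun k => h ^+ 2 * p (at_mesh h k)) f (box n%:R h) (box rho h) v w.
- by apply/andP; split; lra.
- by move=> k; rewrite mulr_ge0// ltW.
- exact: f_cont.
- by move=> k; apply: box_le.
- by move=> k i bk; apply: box_ee => //; rewrite (ltW h0).
- by move=> k i bk; apply: boxBee => //; rewrite (ltW h0).
- move=> k bk; have [z0 z1 _] := bnds k bk; rewrite /v.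
  by move: dM1 z0 z1 (Vge1 (at_mesh h k)); move: (d * M) (d * _) => a b; lra.
- move=> k bk; have [z0 z1 _] := bnds k bk; have := VW (at_mesh h k); rewrite /v /w; lra.
- move=> k bk; have bk' := box_le sub01 bk; have [z0 z1 zm1] := bnds k bk'.
  have := Hv h k h0 hhv bk; rewrite -/v (gtr0_norm d0) ler_norml => /andP[e1 _].
  apply: (@le_trans _ _ (h ^+ 2 * (p (at_mesh h k) * f (V (at_mesh h k))))).
    rewrite -mulrA ler_pM2l// ler_wpM2l// f_mono//.
      by have := Vge1 (at_mesh h k); rewrite /v; lra.
    by rewrite /v; lra.
  apply: (@le_trans _ _ (h ^+ 2 * (\sum_i V2 i (at_mesh h k) + l2norm (fun i => V1 i (at_mesh h k))))).
    by rewrite ler_pM2l.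
  move: e1; set S := \sum_i V2 i (at_mesh h k) + l2norm (fun i => V1 i (at_mesh h k)) => e1.
  have : h ^+ 2 * m <= h ^+ 2 * (2 * (d * Z (at_mesh h k))) by rewrite ler_pM2l.
  move: e1; move: S (h ^+ 2) (dop _ _ _) (Z _) => S a b c; lra.
- move=> k bk; have bk' := box_le sub01 bk; have [z0 z1 zm1] := bnds k bk'.
  have := Hw h k h0 hhw bk; rewrite -/w normrN (gtr0_norm d0) ler_norml => /andP[_ e1].
  apply: (@le_trans _ _ (h ^+ 2 * (p (at_mesh h k) * f (W (at_mesh h k))))); last first.
    rewrite -[leRHS]mulrA ler_pM2l// ler_wpM2l// f_mono//.
      by have := Vge1 (at_mesh h k); have := VW (at_mesh h k); lra.
    by rewrite /w; lra.
  apply: (@le_trans _ _ (h ^+ 2 * (\sum_i W2 i (at_mesh h k) + l2norm (fun i => W1 i (at_mesh h k))))); last first.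
    by rewrite ler_pM2l.
  move: e1; set S := \sum_i W2 i (at_mesh h k) + l2norm (fun i => W1 i (at_mesh h k)) => e1.
  have : h ^+ 2 * m <= h ^+ 2 * (2 * (d * Z (at_mesh h k))) by rewrite ler_pM2l.
  move: e1; move: S (h ^+ 2) (dop _ _ _) (Z _) => S a b c; lra.
exists h, u; split=> // k bk.
  have bk' := box_le sub01 bk; have [z0 z1 _] := bnds k bk'.
  have := ub k bk'; rewrite /v /w mulNr => /andP[u1 u2].
  have := Vge1 (at_mesh h k); rewrite dM in u1 u2 z1.
  move: u1 u2 z0 z1 n11 => + + + + + V1'; move: (n.+1%:R^-1) (d * _) => a b; split; lra.
by rewrite ueq// mulrA.
Qed.

End Sandwich.

(** * The entire solution between two barriers *)

Section EntireSolution.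
Context {R : realType} {N : nat}.
Hypothesis N0 : (0 < N)%N.
Local Notation E := 'rV[R]_N.
Local Notation lat := 'rV[int]_N.

Lemma loc_holder_continuous (alpha : R) (p : E -> R) : 0 < alpha ->
  loc_holder_on alpha setT p -> continuous p.
Proof.
move=> alpha0 p_holder x; apply/rV_cvgP => e e0.
have N1 : 0 < N%:R + 1 :> R by rewrite ltr_wpDl.
have [C HC] := p_holder (enorm x + 1) (ltr_wpDl (enorm_ge0 x) ltr01).
pose C' := `|C| + 1; have C0 : 0 < C' by rewrite ltr_wpDl.
pose c := Num.min 1 ((e / C') `^ alpha^-1).
have eC : 0 < e / C' by rewrite divr_gt0.
have c0 : 0 < c by rewrite lt_min ltr01 powR_gt0.
exists (c / (N%:R + 1)); split; first by rewrite divr_gt0.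
move=> y xy; have yx : enorm (y - x) < c.
  apply: (@le_lt_trans _ _ (N%:R * (c / (N%:R + 1)))).
    by apply: enorm_inbox => i; rewrite !mxE ltW//; exact: xy.
  rewrite mulrA ltr_pdivrMr// mulrC ltr_pM2l//; lra.
have [yx1 yx2] : enorm (y - x) < 1 /\ enorm (y - x) < (e / C') `^ alpha^-1.
  by move: yx; rewrite lt_min => /andP.
apply: (@le_lt_trans _ _ (C' * enorm (y - x) `^ alpha)).
  apply: le_trans (HC y x I I _ _) _.
  - have := enorm_lip y x; have := ler_norm (enorm y - enorm x); lra.
  - by rewrite lerDl.
  - by rewrite ler_wpM2r ?powR_ge0//; have := ler_norm C; rewrite /C'; lra.
rewrite mulrC -ltr_pdivlMr//.
rewrite -[ltRHS]powRr1 ?(ltW eC)// -(mulVf (lt0r_neq0 alpha0)) powRrM.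
by rewrite gt0_ltr_powR ?nnegrE ?powR_ge0 ?enorm_ge0.
Qed.

Variables (alpha : R) (p : E -> R) (f : R -> R) (V W : E -> R) (V1 V2 W1 W2 : 'I_N -> E -> R).
Hypotheses (alpha0 : 0 < alpha) (p_holder : loc_holder_on alpha setT p)
  (p0 : forall x, 0 <= p x) (f_mono : forall s t : R, 0 <= s -> s <= t -> f s <= f t)
  (f_holder : loc_holder_halfline alpha f) (f00 : f 0 = 0)
  (dV : forall i y, is_derive y (ebasis i) V (V1 i y))
  (dV1 : forall i y, is_derive y (ebasis i) (V1 i) (V2 i y))
  (Vc : continuous V) (V1c : forall i, continuous (V1 i)) (V2c : forall i, continuous (V2 i))
  (dW : forall i y, is_derive y (ebasis i) W (W1 i y))
  (dW1 : forall i y, is_derive y (ebasis i) (W1 i) (W2 i y))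
  (Wc : continuous W) (W1c : forall i, continuous (W1 i)) (W2c : forall i, continuous (W2 i))
  (Vge1 : forall x, 1 <= V x) (VW : forall x, V x <= W x)
  (subV : forall x, p x * f (V x) <= \sum_i V2 i x + l2norm (fun i => V1 i x))
  (superW : forall x, \sum_i W2 i x + l2norm (fun i => W1 i x) <= p x * f (W x)).

Lemma entire_solution : exists u : E -> R, [/\ C2 u,
  forall x, laplacian u x + grad_norm u x = p x * f (u x) & forall x, V x <= u x].
Proof.
have f_cont := holder_continuous alpha0 f_holder.
have f_ge0 s : 0 <= s -> 0 <= f s by move=> s0; rewrite -f00; exact: f_mono.
have [h Hh] := choice (fun n => discrete_sandwich N0 p0 f_mono f_cont dV dV1 V1c V2c dW dW1 W1c W2c Vge1 VW subV superW n).
have [u Hu] := choice Hh.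
have h0 n : 0 < h n by have [] := Hu n.
have hn n : h n <= n.+1%:R^-1 by have [] := Hu n.
have u0 n k : box n%:R (h n) k -> 0 <= u n k by have [_ _ H _] := Hu n => /H[].
have u_low n k : box n%:R (h n) k -> V (at_mesh (h n) k) - n.+1%:R^-1 <= u n k by have [_ _ H _] := Hu n => /H[].
have u_eq n k : box n%:R (h n) k -> dop (h n / 2) (u n) k = h n ^+ 2 * (p (at_mesh (h n) k) * f (u n k)).
  by have [_ _ _ H] := Hu n => /H.
have u_bnd rho : exists M : R, forall n k, rho <= n%:R -> box rho (h n) k -> u n k <= M.
  have [M [M0 hM]] := continuous_bounded_box rho Wc.
  exists (M + 1) => n k rn bk; have [_ _ H _] := Hu n.
  have [_ + _] := H k (box_le rn bk).
  have := hM (at_mesh (h n) k); rewrite ler_norml => hb.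
  have /hb/andP[_] : inbox rho (at_mesh (h n) k) by move=> i; rewrite mxE; exact: bk.
  lra.
have [q [q2 qa]] : exists q : nat, (2 <= q)%N /\ 1 <= q%:R * alpha.
  have [n0 hn0] := nat_above alpha^-1; exists (n0 + 2)%N; split; first by rewrite leq_addl.
  by rewrite -ler_pdivrMr// mul1r; apply: hn0; rewrite leq_addr.
have B0 := uniform_bound u0 u_bnd.
have B1 := uniform_gradient alpha0 p0 p_holder f_mono f00 h0 hn u0 u_bnd u_eq.
have B2 := uniform_gradient_holder N0 alpha0 p0 p_holder f_mono f00 h0 hn u0 u_bnd u_eq.
have B3 := uniform_higher_differences N0 alpha0 p0 p_holder f_mono f_holder f00 h0 hn u0 u_bnd u_eq q2 qa (leqnn _).
have [UF [UFU UFoo]] := ultraFilterLemma (F := \oo) _.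
pose U := ulim UF h u; pose v i := vlim UF h u i.
have Uc : continuous U by exact: (continuous_ulim UFoo h0 hn B0 B1).
have vc i : continuous (v i) by exact: (continuous_vlim UFoo h0 hn B1 B2 (i := i)).
have dU i x : is_derive x (ebasis i) U (v i x) by exact: (is_derive_ulim UFoo h0 hn B0 B1 B2 i x).
(* Indexing by pairs lets one choice produce all second derivatives, the mixed ones included, as
   [C2] requires. *)
have second (ij : 'I_N * 'I_N) : exists w : E -> R, continuous w /\
    forall x, is_derive x (ebasis ij.2) (v ij.1) (w x).
  exact: (vlim_derivable UFoo h0 hn q2 B1 B2 B3 ij.1 ij.2).
have [w Hw] := choice second.
have partialE i : partial i U = v i by apply/funext => x; have [_ <-] := dU i x.
have partial2E i j : partial j (partial i U) = w (i, j).
  by apply/funext => x; rewrite partialE; have [_ <-] := (Hw (i, j)).2 x.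
(* At stage [n] the lower barrier is lowered by [n.+1%:R^-1] and evaluated at the rounded point;
   both errors vanish along the ultrafilter. *)
have VU x : V x <= U x.
  apply/ler_addgt0Pr => e e0; have e2 : 0 < e / 2 by lra.
  have [rho bx] := inbox_exists x.
  have [d [d0 hd]] := (rV_cvgP _ _ _).1 (@Vc x) _ e2.
  have d2 : 0 < d / 2 by lra.
  have [n1 hn1] := mesh_small hn d2.
  have [n2 hn2] := @mesh_small R (fun n => n.+1%:R^-1) (fun n => lexx _) _ e2.
  have [n3 hn3] := nat_above (rho + 1).
  rewrite -lerBlDr.
  have cl : u n (fl h n x) @[n --> UF] --> U x by exact: (ulim_near UFoo h0 hn B0 B1 ler01 (fun n => fl_near h0 n x)).
  apply: (ultra_le (n0 := (n1 + n2 + n3)%N) (a := fun=> V x - e) UFoo _ cl); first exact: cvg_cst.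
  move=> n nn; have m1 : (n1 <= n)%N by lia.
  have m2 : (n2 <= n)%N by lia.
  have m3 : (n3 <= n)%N by lia.
  have fn := fl_near h0 n x.
  have bn : box n%:R (h n) (fl h n x) by apply: box_le (hn3 n m3) (near_mesh_box hn ler01 fn bx).
  have := u_low n _ bn; have := hn2 n m2.
  have : `|V (at_mesh (h n) (fl h n x)) - V x| < e / 2.
    apply: hd => j; rewrite mxE; apply: le_lt_trans (fn j) _.
    by rewrite mul1r; have := hn1 n m1; lra.
  rewrite ltr_norml => /andP[+ _] /=; move: (n.+1%:R^-1 : R) => a; lra.
exists U; split; last exact: VU.
- split; first exact: Uc.
  split; first by move=> i x; exact: @ex_derive _ _ _ _ _ _ _ (dU i x).
  split; first by move=> i; rewrite partialE.
  split; last by move=> i j; rewrite partial2E; exact: (Hw (i, j)).1.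
  by move=> i j x; rewrite partialE; exact: @ex_derive _ _ _ _ _ _ _ ((Hw (i, j)).2 x).
- move=> x.
  have <- := @limit_equation R N UF UFU h u p f U v (fun i => w (i, i)) UFoo h0 hn
    (fun x c k => @ulim_near R N UF UFU h u UFoo h0 hn B0 B1 x c k) (discrete_lipschitz h0 B1) Uc vc
    (fun i => (Hw (i, i)).1) dU (fun i => (Hw (i, i)).2) p0 (loc_holder_continuous alpha0 p_holder)
    f_ge0 f_cont u0 _ u_eq x; last by move=> y; have := VU y; have := Vge1 y; lra.
  congr (_ + _); first by apply: eq_bigr => i _; rewrite partial2E.
  by apply: eq_l2norm => i; rewrite partialE.
Qed.

End EntireSolution.

(** * The criterion *)

Section Growth.
Context {R : realType} {N : nat}.
Hypothesis N3 : (3 <= N)%N.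
Local Notation E := 'rV[R]_N.
Local Notation mu := (@lebesgue_measure R).
Variables (alpha : R) (p : E -> R) (f : R -> R).
Hypotheses (alpha0 : 0 < alpha) (p_holder : loc_holder_on alpha setT p) (p0 : forall x, 0 <= p x)
  (f_mono : forall s t : R, 0 <= s -> s <= t -> f s <= f t) (f00 : f 0 = 0)
  (f_pos : forall s : R, 0 < s -> 0 < f s)
  (f_lin : has_ubound [set f s / s | s in [set s : R | 1 <= s]]).

Let N0 : (0 < N)%N. Proof. exact: leq_trans N3. Qed.

Local Notation Lam := (Lambda_of f).
(* Extended evenly, the radial profiles of [p] are continuous on the whole line. *)
Definition phi (s : R) : R := phi_max p `|s|.
Definition psi (s : R) : R := psi_min p `|s|.
Definition gap (s : R) : R := phi s - psi s.

Lemma Lambda_ge0 : 0 <= Lam.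
Proof.
apply: (@le_trans _ _ (f 1 / 1)); first by rewrite divr1 ltW// f_pos.
by apply: ub_le_sup => //; exists 1 => /=.
Qed.

Lemma nonlinearity_le (s : R) : 1 <= s -> f s <= Lam * s.
Proof.
move=> s1; rewrite -ler_pdivrMr; last exact: lt_le_trans s1.
by apply: ub_le_sup => //; exists s.
Qed.

(** Moving the argument up by 1 brings it into the range of the supremum defining [Lam]. This is why
    the necessity argument compares [1 + u] and not [u]. *)
Lemma nonlinearity_le1 (s : R) : 0 <= s -> f s <= Lam * (1 + s).
Proof.
move=> s0; apply: le_trans (nonlinearity_le _); first by apply: f_mono => //; rewrite lerDr.
by rewrite lerDl.
Qed.

Lemma continuous_phi : continuous phi.
Proof. exact: continuous_phi_max N0 _ _ alpha0 p_holder. Qed.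

Lemma continuous_psi : continuous psi.
Proof. exact: continuous_psi_min N0 _ _ alpha0 p_holder. Qed.

Lemma continuous_gap : continuous gap.
Proof. by move=> s; apply: cvgB; [exact: continuous_phi|exact: continuous_psi]. Qed.

Lemma psi_ge0 (s : R) : 0 <= psi s.
Proof. exact: psi_min_ge0 N0 _ _ alpha0 p_holder _ p0 (normr_ge0 s). Qed.

Lemma gap_ge0 (s : R) : 0 <= gap s.
Proof. by rewrite subr_ge0; exact: psi_le_phi N0 _ _ alpha0 p_holder _ (normr_ge0 s). Qed.

Lemma phi_ge0 (s : R) : 0 <= phi s.
Proof. by have := gap_ge0 s; have := psi_ge0 s; rewrite /gap; lra. Qed.

Lemma p_le_phi x : p x <= phi (enorm x).
Proof. by rewrite /phi (ger0_norm (enorm_ge0 x)); exact: phi_max_ge N0 _ _ alpha0 p_holder x. Qed.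

Lemma psi_le_p x : psi (enorm x) <= p x.
Proof. by rewrite /psi (ger0_norm (enorm_ge0 x)); exact: psi_min_le N0 _ _ alpha0 p_holder x. Qed.

(* The function Psi of the paper. *)
Definition weight (s : R) : R := expR (Lam / (N%:R - 2) * prim (fun s => s * psi s) `|s|).

Lemma continuous_idM (q : R -> R) : continuous q -> continuous (fun s : R => s * q s).
Proof. by move=> qc s; apply: cvgM; [exact: cvg_id|exact: qc]. Qed.

Lemma N2_gt0 : 0 < N%:R - 2 :> R.
Proof. by rewrite subr_gt0 ltr_nat. Qed.

Lemma continuous_weight : continuous weight.
Proof.
have c1 := continuous_even_prim (continuous_idM continuous_psi).
move=> s; apply: (cvg_comp (fun s : R => Lam / (N%:R - 2) * prim (fun s => s * psi s) `|s|) expR).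
  by apply: cvgM; [exact: cvg_cst|exact: c1].
exact: continuous_expR.
Qed.

Lemma weight_ge1 s : 1 <= weight s.
Proof.
rewrite -[leLHS]expR0 ler_expR mulr_ge0//; first by rewrite divr_ge0 ?Lambda_ge0// ltW// N2_gt0.
by apply: prim_ge0 => r r0; rewrite mulr_ge0// psi_ge0.
Qed.

(** The integrand is the derivative [t * slope N psi t] of [pot N psi], so divergence of the
    integral means that this potential is unbounded. *)
Lemma criterion :
  (\int[mu]_(t in `[1%R, +oo[) (expR (- t) * (t ^+ N.-1)^-1 *
     Rintegral mu `[0, t] (fun s => expR s * s ^+ N.-1 * psi_min p s))%:E = +oo)%E <->
  (forall M : R, exists t, 1 <= t /\ M < pot N psi t).
Proof.
have -> : (\int[mu]_(t in `[1%R, +oo[) (expR (- t) * (t ^+ N.-1)^-1 *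
     Rintegral mu `[0, t] (fun s => expR s * s ^+ N.-1 * psi_min p s))%:E =
   \int[mu]_(t in `[1%R, +oo[) (t * slope N psi `|t|)%:E)%E.
  apply: eq_integral => t; rewrite inE/= in_itv/= andbT => t1; congr EFin.
  have t0 : 0 < t by apply: lt_le_trans t1.
  rewrite (gtr0_norm t0) slope_pos ?gt_eqF//.
  have -> : Rintegral mu `[0, t] (fun s => expR s * s ^+ N.-1 * psi_min p s) = prim (density N psi) t.
    by apply: eq_prim => s s0 _; rewrite /density /psi (ger0_norm s0).
  rewrite -[in RHS](prednK N0) exprS; field.
  by rewrite expf_neq0 gt_eqF.
apply: ray_integral_infinite.
- exact: continuous_pot_integrand N0 _ continuous_psi.
- move=> s s1; have s0 : 0 <= s by apply: le_trans s1.
  by rewrite mulr_ge0// slope_ge0// => r _; exact: psi_ge0.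
- move=> t t1; have t0 : 0 < t by apply: lt_le_trans t1.
  by rewrite (gtr0_norm t0); exact: is_derive_pot N0 _ _ continuous_psi t0.
Qed.

Hypothesis oscillation : (\int[mu]_(r in `[0%R, +oo[)
      (r * (phi_max p r - psi_min p r) * Psi_of N f (psi_min p) r)%:E < +oo)%E.

Lemma gap_weight_bounded : exists M : R, forall t, prim (fun s => s * (gap s * weight s)) t <= M.
Proof.
apply: prim_bounded.
- apply: continuous_idM => s; apply: cvgM; [exact: continuous_gap|exact: continuous_weight].
- move=> s s0; rewrite !mulr_ge0 ?gap_ge0//; have := weight_ge1 s; lra.
- move: oscillation; congr (_ < _)%E.
  apply: eq_integral => t; rewrite inE/= in_itv/= andbT => t0; congr EFin.
  rewrite -mulrA /gap /phi /psi /weight (ger0_norm t0); congr (_ * (_ * expR (_ * _))).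
  by apply: eq_prim => s s0 _; rewrite /psi (ger0_norm s0).
Qed.

(** As [weight >= 1], the oscillation hypothesis bounds the integral of [s * gap s], and [pot_bound]
    turns this into a bound on the potential. Hence [pot N phi] and [pot N psi] differ by a bounded
    amount. *)
Lemma pot_gap_bounded : exists M : R, forall t, 0 <= t -> pot N gap t <= M.
Proof.
have [M hM] := gap_weight_bounded; exists (M / (N%:R - 2)) => t t0.
rewrite ler_pdivlMr ?N2_gt0// mulrC.
apply: le_trans (pot_bound N0 continuous_gap _ _ t0) _; [by move=> s _; exact: gap_ge0|exact: (ltnW N3)|].
apply: le_trans (hM t); apply: prim_le; first exact: continuous_idM continuous_gap.
  apply: continuous_idM => s; apply: cvgM; [exact: continuous_gap|exact: continuous_weight].
by move=> s s0 _; rewrite ler_wpM2l// ler_peMr ?gap_ge0// weight_ge1.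
Qed.

Lemma prim_exp_bounded (t : R) : 0 <= t -> prim (fun s => s * expR (- s)) t <= 1.
Proof.
move=> t0; pose F (s : R) : R := - ((1 + s) * expR (- s)).
have dF (s : R) : is_derive s 1 F (s * expR (- s)).
  have dN : is_derive s 1 (fun s : R => - s) (- 1) by exact: is_deriveN (is_derive_id s 1).
  have dE : is_derive s 1 (fun s : R => expR (- s)) (expR (- s) * - 1).
    exact: (@is_derive1_comp R expR (fun s : R => - s) s _ _ (is_derive_expR _) dN).
  have d1 := is_deriveN (is_deriveM (is_deriveD (is_derive_cst (1 : R) s 1) (is_derive_id s 1)) dE).
  apply: (is_derive_eq d1).
  transitivity (- ((1 + s) * (expR (- s) * -1) + expR (- s) * (0 + 1))) => //; by ring.
rewrite (@prim_eq R F)//.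
- rewrite /F addr0 oppr0 expR0 mulr1 opprK addrC gerDl oppr_le0 mulr_ge0 ?expR_ge0//; lra.
- apply: continuous_idM => s; apply: (cvg_comp (fun s : R => - s) expR); [exact: cvgN cvg_id|exact: continuous_expR].
- apply: cvg_at_right_filter; apply/differentiable_continuous/derivable1_diffP.
  exact: @ex_derive _ _ _ _ _ _ _ (dF 0).
Qed.

Lemma continuous_decay : continuous (fun s : R => expR (- `|s|)).
Proof.
move=> s; apply: (cvg_comp (fun s : R => - `|s|) expR); last exact: continuous_expR.
by apply: cvgN; exact: cvg_norm cvg_id.
Qed.

(** The term [expR (- s)] provides the strict inequality in the necessity proof; it is harmless
    since its potential is bounded. *)
Lemma pot_decay_bounded (t : R) : 0 <= t -> pot N (fun s => expR (- `|s|)) t <= 1 / (N%:R - 2).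
Proof.
move=> t0; rewrite ler_pdivlMr ?N2_gt0// mulrC.
apply: le_trans (pot_bound N0 continuous_decay _ (ltnW N3) t0) _; first by move=> s _; exact: expR_ge0.
apply: le_trans (prim_exp_bounded t0); apply: eq_ler.
by apply: eq_prim => s s0 _; rewrite (ger0_norm s0).
Qed.

Lemma pot_phi (t : R) : pot N phi t = pot N psi t + pot N gap t.
Proof.
have -> : phi = (fun s => psi s + gap s) by apply/funext => s; rewrite /gap addrC subrK.
exact: (@potD R N N0 psi gap t continuous_psi continuous_gap).
Qed.

Theorem necessity (u : E -> R) : pos_entire_large_solution p f u ->
  (forall M : R, exists t, 1 <= t /\ M < pot N psi t).
Proof.
move=> usol M; apply: contrapT => nM.
have psiM t : 0 <= t -> pot N psi t <= M.
  move=> t0; have [t1|t1] := leP 1 t.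
    by rewrite leNgt; apply/negP => h; apply: nM; exists t.
  apply: (@le_trans _ _ (pot N psi 1)).
    by apply: pot_mono => //; [exact: continuous_psi|move=> s _; exact: psi_ge0|exact: ltW].
  by rewrite leNgt; apply/negP => h; apply: nM; exists 1.
have [M2 gapM] := pot_gap_bounded.
pose q (s : R) := Lam * phi s + expR (- `|s|).
have c1 : continuous (fun s : R => Lam * phi s) by move=> s; apply: cvgM; [exact: cvg_cst|exact: continuous_phi].
have qc : continuous q by move=> s; apply: cvgD; [exact: c1|exact: continuous_decay].
have q0 s : 0 <= q s by rewrite addr_ge0 ?expR_ge0// mulr_ge0 ?Lambda_ge0 ?phi_ge0.
have potq t : 0 <= t -> pot N q t <= Lam * (M + M2) + 1 / (N%:R - 2).
  move=> t0; rewrite /q potD//; last exact: continuous_decay.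
  rewrite potZ//; last exact: continuous_phi.
  apply: lerD; last exact: pot_decay_bounded.
  apply: ler_wpM2l; first exact: Lambda_ge0.
  by rewrite pot_phi; apply: lerD; [exact: psiM|exact: gapM].
have [_ [_ [u0 _]]] := usol.
apply: (@bounded_supersolution_barrier R N N0 p u f q (Lam * (M + M2) + 1 / (N%:R - 2))) (usol) => //.
(* For negative [t] the interval of integration is empty and the potential is 0, its value at the
   origin. *)
- move=> t; have [t0|t0] := leP 0 t; first exact: potq.
  apply: le_trans (potq 0 (lexx _)); rewrite pot0 /pot /prim set_itv_ge ?Rintegral_set0//.
  by rewrite bnd_simp -ltNge.
- move=> x; have ux := u0 x.
  apply: (@le_lt_trans _ _ (phi (enorm x) * (Lam * (1 + u x)))).
    apply: ler_pM => //; [|exact: p_le_phi|exact: nonlinearity_le1 (ltW ux)].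
    by apply: ltW; exact: f_pos.
  have -> : phi (enorm x) * (Lam * (1 + u x)) = (1 + u x) * (Lam * phi (enorm x)) by ring.
  by rewrite ltr_pM2l ?ltrDl ?expR_gt0//; lra.
Qed.

Hypothesis f_holder : loc_holder_halfline alpha f.

Theorem sufficiency : (forall M : R, exists t, 1 <= t /\ M < pot N psi t) ->
  exists u : E -> R, pos_entire_large_solution p f u.
Proof.
move=> infinite.
have f_cont := holder_continuous alpha0 f_holder.
have f_ge0 (s : R) : 0 <= s -> 0 <= f s by move=> s0; rewrite -f00; exact: f_mono.
have [v [vc v1 vE vle]] :=
  radial_solution N0 Lambda_ge0 continuous_phi phi_ge0 f_mono f_ge0 f_cont nonlinearity_le.
pose g (s : R) := f (v s).
have v0 (s : R) : 0 <= v s by have := v1 s; lra.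
have gc : continuous g by exact: (continuous_nonlinearity f_cont).
have g0 (s : R) : 0 <= g s by exact: f_ge0.
have times_g (q : R -> R) : continuous q -> continuous (fun s : R => q s * g s).
  by move=> qc s; apply: cvgM; [exact: qc|exact: gc].
have c1 := times_g _ continuous_phi; have c2 := times_g _ continuous_psi.
have c3 := times_g _ continuous_gap.
have [M2 gapM] := pot_gap_bounded; have [M hM] := gap_weight_bounded.
(* In [pot N phi = pot N psi + pot N gap] the second potential is at most [M2], whence this
   constant; the first, by [pot_bound], is at most the integral in the exponent of [weight] divided
   by [N%:R - 2]. *)
pose K := Lam * expR (Lam * M2).
have K0 : 0 <= K by rewrite mulr_ge0 ?Lambda_ge0 ?expR_ge0.
have g_weight (s : R) : 0 <= s -> g s <= K * weight s.
  move=> s0; apply: le_trans (nonlinearity_le (v1 s)) _.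
  rewrite /K -mulrA; apply: ler_wpM2l; first exact: Lambda_ge0.
  apply: le_trans (vle s s0) _; rewrite /weight -expRD ler_expR (ger0_norm s0) pot_phi mulrDr addrC.
  apply: lerD; first by apply: ler_wpM2l; [exact: Lambda_ge0|exact: gapM].
  rewrite -mulrA; apply: ler_wpM2l; first exact: Lambda_ge0.
  rewrite mulrC ler_pdivlMr ?N2_gt0// mulrC.
  by apply: pot_bound => //; [exact: continuous_psi|move=> r _; exact: psi_ge0|exact: (ltnW N3)].
pose B := K * M / (N%:R - 2).
have potB (t : R) : 0 <= t -> pot N (fun s => gap s * g s) t <= B.
  move=> t0; rewrite ler_pdivlMr ?N2_gt0// mulrC.
  have gg0 (s : R) : 0 <= s -> 0 <= gap s * g s by move=> _; rewrite mulr_ge0 ?gap_ge0.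
  apply: le_trans (pot_bound N0 c3 gg0 (ltnW N3) t0) _.
  have cw : continuous (fun s : R => s * (gap s * weight s)).
    by apply: continuous_idM => s; apply: cvgM; [exact: continuous_gap|exact: continuous_weight].
  apply: (@le_trans _ _ (K * prim (fun s : R => s * (gap s * weight s)) t)); last exact: ler_wpM2l.
  rewrite -primZ//; apply: prim_le; first exact: continuous_idM.
    by move=> s; apply: cvgM; [exact: cvg_cst|exact: cw].
  move=> s s0 _; rewrite [leRHS]mulrCA; apply: ler_wpM2l => //.
  by rewrite [leRHS]mulrCA; apply: ler_wpM2l; [exact: gap_ge0|exact: g_weight].
(* [V] is [v (enorm x)] written as a potential, so that its derivatives are explicit. The operator
   sends [W] to [psi * f (v)], which is at most [p * f (W)] because [psi <= p] and [v = V <= W]; the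
   constant [B] in [W] exists to secure [V <= W]. *)
pose V (x : E) := 1 + pot N (fun s => phi s * g s) (enorm x).
pose W (x : E) := 1 + B + pot N (fun s => psi s * g s) (enorm x).
have VE x : V x = v (enorm x) by rewrite vE ?enorm_ge0.
have radial (c : R) (q : R -> R) : continuous q ->
    (forall i (y : E), is_derive y (ebasis i) (fun x : E => c + pot N q (enorm x)) (radial_d1 q i y)) /\
    continuous (fun x : E => c + pot N q (enorm x)).
  move=> qc; split=> [i y|].
    apply: (is_derive_eq (is_deriveD (is_derive_cst (c : R) y (ebasis i)) (is_derive_radial N0 qc i y))).
    exact: add0r.
  by apply: continuous_rV_D; [exact: continuous_rV_cst|exact: continuous_pot_enorm].
have operator (q : R -> R) (x : E) : (forall s : R, 0 <= q s) ->
    \sum_i radial_d2 q i x + l2norm (fun i => radial_d1 q i x) = q (enorm x).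
  move=> q0; rewrite radial_laplacian// radial_gradient ?subrK//.
  by apply: slope_ge0 => //; exact: enorm_ge0.
have q10 (s : R) : 0 <= phi s * g s by rewrite mulr_ge0 ?phi_ge0.
have q20 (s : R) : 0 <= psi s * g s by rewrite mulr_ge0 ?psi_ge0.
have VW x : V x <= W x.
  rewrite /V /W -addrA lerD2l.
  rewrite (_ : (fun s => phi s * g s) = (fun s => gap s * g s + psi s * g s)).
    by rewrite potD// lerD2r potB// enorm_ge0.
  by apply/funext => s; rewrite /gap; ring.
have [u [uC2 ueq Vu]] := @entire_solution R N N0 alpha p f V W
  (radial_d1 (fun s => phi s * g s)) (radial_d2 (fun s => phi s * g s))
  (radial_d1 (fun s => psi s * g s)) (radial_d2 (fun s => psi s * g s))
  alpha0 p_holder p0 f_mono f_holder f00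
  (radial 1 _ c1).1 (is_derive_radial2 N0 c1) (radial 1 _ c1).2 (continuous_radial_d1 N0 c1) (continuous_radial_d2 N0 c1)
  (radial (1 + B) _ c2).1 (is_derive_radial2 N0 c2) (radial (1 + B) _ c2).2 (continuous_radial_d1 N0 c2) (continuous_radial_d2 N0 c2)
  (fun x => le_trans (v1 _) (eq_ler (esym (VE x)))) VW
  (fun x => le_trans (ler_wpM2r (f_ge0 _ (le_trans (v0 _) (eq_ler (esym (VE x))))) (p_le_phi x))
    (eq_ler (etrans (congr1 (fun y => phi (enorm x) * f y) (VE x)) (esym (operator _ x q10)))))
  (fun x => le_trans (eq_ler (operator _ x q20)) (ler_pM (psi_ge0 _) (g0 _) (psi_le_p x)
     (f_mono (v0 _) (le_trans (eq_ler (esym (VE x))) (VW x))))).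
exists u; split=> //; split=> //; split.
  by move=> x; apply: lt_le_trans (Vu x); rewrite VE; apply: lt_le_trans (v1 _).
have f1 : 0 < f 1 by exact: f_pos.
(* Since [v >= 1] and [phi >= psi], the potential in [V] dominates [f 1 * pot N psi], which is
   unbounded and non-decreasing; hence the level [L / f 1]. *)
move=> L; have [t [t1 Lt]] := infinite (L / f 1); exists t => x tx.
apply: lt_le_trans (Vu x); rewrite ltr_pdivrMr// mulrC in Lt; apply: (lt_le_trans Lt).
have cf : continuous (fun s => f 1 * psi s) by move=> s; apply: cvgM; [exact: cvg_cst|exact: continuous_psi].
rewrite -(@potZ R N N0 (f 1) psi t continuous_psi).
apply: (@le_trans _ _ (pot N (fun s => f 1 * psi s) (enorm x))).
  apply: pot_mono => //; [|lra|exact: ltW].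
  by move=> s _; rewrite mulr_ge0 ?psi_ge0// ltW.
apply: (@le_trans _ _ (pot N (fun s => phi s * g s) (enorm x))); last by rewrite /V lerDr.
apply: pot_le => // s _; rewrite mulrC; apply: ler_pM; [exact: psi_ge0|exact: ltW| |exact: f_mono].
by have := gap_ge0 s; rewrite /gap subr_ge0.
Qed.

End Growth.

Theorem theorem2 (R : realType) (N : nat) (alpha : R)
  (p : 'rV[R]_N -> R) (f : R -> R) :
  (3 <= N)%N ->
  0 < alpha -> alpha < 1 ->
  loc_holder_on alpha setT p ->
  (forall x, 0 <= p x) ->
  (forall s t : R, 0 <= s -> s <= t -> f s <= f t) ->
  loc_holder_halfline alpha f ->
  f 0 = 0 ->
  (forall s : R, 0 < s -> 0 < f s) ->
  has_ubound [set f s / s | s in [set s : R | 1 <= s]] ->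
  (\int[lebesgue_measure]_(r in `[0%R, +oo[)
      (r * (phi_max p r - psi_min p r) * Psi_of N f (psi_min p) r)%:E < +oo)%E ->
  ((exists u : 'rV[R]_N -> R, pos_entire_large_solution p f u) <->
   (\int[lebesgue_measure]_(t in `[1%R, +oo[)
      (expR (- t) * (t ^+ N.-1)^-1 *
       Rintegral lebesgue_measure `[0, t]
         (fun s => expR s * s ^+ N.-1 * psi_min p s))%:E = +oo)%E).
Proof.
move=> N3 alpha0 _ p_holder p0 f_mono f_holder f00 f_pos f_lin osc.
rewrite (criterion N3 alpha0 p_holder p0); split=> [[u usol]|infinite].
  exact: (necessity N3 alpha0 p_holder p0 f_mono f_pos f_lin osc usol).
exact: (sufficiency N3 alpha0 p_holder p0 f_mono f00 f_pos f_lin osc f_holder infinite).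
Qed.
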